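(* Let $\Lambda:I\to L(W)$ be a (not necessarily monotonic) smooth curve with Young diagram $D$ satisfying condition (G) (defined in the context), and let $r_i^+,r_i^-$ be its $i$th positive and negative inertia indices. Then there exists a normal moving frame $(\{E_a(t)\}_{a\in\Delta},\{F_a(t)\}_{a\in\Delta})$ of $\Lambda(\cdot)$. Moreover, given such a frame, a moving frame $(\{\widetilde E_a(t)\}_{a\in\Delta},\{\widetilde F_a(t)\}_{a\in\Delta})$ is a normal moving frame of $\Lambda(\cdot)$ if and only if for every $1\le i\le d$ there exists a constant matrix $U_i\in O(r_i^+,r_i^-)$ such that for all $t$ $$\widetilde E_a(t)=E_a(t)U_i,\qquad \widetilde F_a(t)=F_a(t)\,I_{r_i^+,r_i^-}U_iI_{r_i^+,r_i^-}\qquad\text{for all }a\in\Upsilon_i.$$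
   Context: **Curves.** $W$ is a real $2m$-dimensional vector space with symplectic form $\omega$; $L(W)$ is the set of Lagrangian subspaces; $\Lambda:I\to L(W)$ is a smooth curve on an interval $I$. For any smooth curve of subspaces $\Lambda(\cdot)$ of $W$, $\mathfrak S(\Lambda)$ is the set of smooth curves $\ell$ in $W$ with $\ell(t)\in\Lambda(t)$ for all $t$; the $i$th extension is $\Lambda^{(i)}(\tau)=\mathrm{span}\{\frac{d^j}{d\tau^j}\ell(\tau):\ell\in\mathfrak S(\Lambda),\,0\le j\le i\}$; the contractions are $\Lambda_{(0)}=\Lambda$ and $\Lambda_{(i)}(\tau)=\{v\in\Lambda_{(i-1)}(\tau):\exists\,\ell\in\mathfrak S(\Lambda_{(i-1)}),\ \ell(\tau)=v,\ \ell'(\tau)\in\Lambda_{(i-1)}(\tau)\}$. Expressions such as $(\Lambda_{(k)})^{(n)}(t)$ mean the $n$th extension of the curve $t\mapsto\Lambda_{(k)}(t)$. Standing assumptions: $\dim\Lambda^{(i)}(t)$ is independent of $t$ for every $i$, and $\Lambda^{(p)}(t)=W$ for some integer $p$. The velocity $\dot\Lambda(t)$ is identified with the quadratic form $v\mapsto\omega(\ell'(t),\ell(t))$ on $\Lambda(t)$, $\ell\in\mathfrak S(\Lambda)$, $\ell(t)=v$. **Diagrams.** The Young diagram $D$ of the curve has $\dim\Lambda^{(i)}-\dim\Lambda^{(i-1)}$ boxes in its $i$th column ($\Lambda^{(0)}=\Lambda$). Any Young diagram $D$ is uniquely a union of $d$ rectangular diagrams $D_i$ ($r_i$ rows, $p_i$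 columns), stacked from top to bottom, with $p_1>\dots>p_d$. The reduction $\Delta$ has $d$ rows, the $i$th of length $p_i$. Boxes of $\Delta$ are superboxes, rows are levels; $\Upsilon_i$ is the $i$th level. The $j$th superbox of the $i$th level corresponds to the $j$th column of $D_i$ and has size $r_i$. $a_i,\sigma_i$ are the first and last superboxes of $\Upsilon_i$; the $\sigma_i$ are special, $\mathcal S=\{\sigma_1,\dots,\sigma_d\}$; $\mathcal F_1$ is the first column of $\Delta$; $l,r$ are left and right shifts by one superbox. **Condition (G):** for every $1\le i\le d-1$ and every $t$, the rank of the restriction of $\dot\Lambda(t)$ to $(\Lambda_{(p_i-1)})^{(p_i-1)}(t)$ equals $\sum_{k=1}^ir_k$. For such a curve let $\Gamma_i^\pm$ be the positive and negative inertia indices of $\dot\Lambda(t)|_{(\Lambda_{(p_i-1)})^{(p_i-1)}(t)}$, $1\le i\le d$, $\Gamma_0^\pm=0$, and $r_i^\pm=\Gamma_i^\pm-\Gamma_{i-1}^\pm$ (independent of $t$; $r_i^++r_i^-=r_i$); $r_i^+$ and $r_i^-$ are the $i$th positive and negative inertia indices of $\Lambda$. $I_{r_i^+,r_i^-}$ is the diagonal $r_i\times r_i$ matrix with first $r_i^+$ diagonal entries $1$ and the others $-1$; $O(r_i^+,r_i^-)=\{U:U^TI_{r_i^+,r_i^-}U=I_{r_i^+,r_i^-}\}$. **Normal mappings.** $R:\Delta\times\Delta\to\{\text{real matrices}\}$ is compatible with $D$ if $R(a,b)$ has size $s_2\times s_1$ whenever $a,b$ have sizes $s_1,s_2$; symmetric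 if $R(b,a)=R(a,b)^T$. For $1\le j<i\le d$ consider the tuple of pairs $$(a_j,a_i),(a_j,r(a_i)),(r(a_j),r(a_i)),(r(a_j),r^2(a_i)),\dots,(r^{p_i-1}(a_j),r^{p_i-1}(a_i)),(r^{p_i}(a_j),r^{p_i-1}(a_i)),\dots,(r^{p_j-1}(a_j),r^{p_i-1}(a_i)).\quad(\ast)$$ (Alternately shift the second and the first entry until the second entry is special; then shift only the first.) A symmetric compatible $R$ is quasi-normal if (1) among all $R(a,b)$ with $b$ not higher than $a$, the only possibly nonzero ones are $R(a,a)$, $R(a,r(a))$ and $R(r(a),a)$ for nonspecial $a$, and $R(a,b)$ for pairs appearing in the tuples $(\ast)$, $1\le j<i\le d$; (2) $R(a,r(a))$ is antisymmetric for every nonspecial $a$. It is normal if in addition, for all $j<i$, the matrices corresponding to the first $p_j-p_i-1$ pairs of $(\ast)$ vanish. **Frames.** A Darboux frame $(\{e_\alpha\}_{\alpha\in D},\{f_\alpha\}_{\alpha\in D})$ of $W$ satisfies $\omega(e_\alpha,e_\beta)=\omega(f_\alpha,f_\beta)=\omega(f_\alpha,e_\beta)-\delta_{\alpha,\beta}=0$. For a superbox $a$ with corresponding boxes $\alpha_1,\dots,\alpha_s$ of $D$ (top to bottom), $E_a=(e_{\alpha_1},\dots,e_{\alpha_s})$, $F_a=(f_{\alpha_1},\dots,f_{\alpha_s})$ (rows of vectors). A smooth moving Darboux frame is a normal moving frame of a curve $\Lambda$ satisfying condition (G) if $\Lambda(t)=\mathrm{span}\{E_a(t)\}_{a\in\Delta}$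 for all $t$ and there are normal mappings $R_t$ with $$E_a'=E_{l(a)}\ (a\in\Delta\setminus\mathcal F_1),\quad E_a'=F_aI_{r_i^+,r_i^-}\ (a\in\mathcal F_1\cap\Upsilon_i),$$ $$F_a'=\sum_{b\in\Delta}E_bR_t(a,b)-F_{r(a)}\ (a\in\Delta\setminus\mathcal S),\quad F_a'=\sum_{b\in\Delta}E_bR_t(a,b)\ (a\in\mathcal S).$$ *)

(* Defs.v *)
From HB Require Import structures.
From mathcomp Require Import all_boot all_order all_algebra ring lra.
From mathcomp Require Import all_classical all_reals all_analysis.

Set Implicit Arguments.
Unset Strict Implicit.
Unset Printing Implicit Defensive.

Import Order.TTheory GRing.Theory Num.Theory.
Import numFieldNormedType.Exports.

Local Open Scope classical_set_scope.
Local Open Scope ring_scope.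

(** * Smooth curves on an arbitrary interval *)

(* [I] need not be open: at an endpoint belonging to [I] these are one-sided
   derivatives. *)
Definition diff_quotient_within {R : realType} (I : interval R) (f : R -> R)
    (t : R) : set_system R :=
  (fun h => h^-1 * (f (h + t) - f t)) @ within [set h | h + t \in I] 0^'.

Definition derivable_within {R : realType} (I : interval R) (f : R -> R)
    (t : R) : Prop :=
  cvg (diff_quotient_within I f t).

Definition derive_within {R : realType} (I : interval R) (f : R -> R)
    (t : R) : R :=
  lim (diff_quotient_within I f t).

(* A finite-dimensional vector space carries a unique smooth structure, given
   by the coordinates in any basis. *)
Definition vcoord {R : realType} {W : vectType R} (i : 'I_(\dim {:W})) (v : W) : R :=
  coord (vbasis {:W}) i v.

Definition vderive {R : realType} {W : vectType R} (I : interval R)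
    (l : R -> W) (t : R) : W :=
  \sum_i derive_within I (fun s => vcoord i (l s)) t *: (vbasis {:W})`_i.

Definition vsmooth {R : realType} {W : vectType R} (I : interval R)
    (l : R -> W) : Prop :=
  forall (n : nat) (i : 'I_(\dim {:W})) (t : R), t \in I ->
    derivable_within I (fun s => vcoord i (iter n (vderive I) l s)) t.

Definition nondegenerate_itv {R : realType} (I : interval R) : Prop :=
  exists x y, [/\ x \in I, y \in I & x < y].

Lemma within_proper {R : realType} (I : interval R) (t : R) :
  nondegenerate_itv I -> t \in I ->
  ProperFilter (within [set h | h + t \in I] 0^').
Proof.
move=> [x [y [xI yI xy]]] tI; apply: Build_ProperFilter_ex.
move=> P /nbhs_ballP[e /= e0 Pe].
have [z [zI zt]] : exists z, z \in I /\ z != t.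
  case: (eqVneq x t) => [xt|?]; last by exists x.
  by exists y; split=> //; rewrite -xt gt_eqF.
pose c := Num.min 1 (e / 2 / `|z - t|).
have zt0 : 0 < `|z - t| by rewrite normr_gt0 subr_eq0.
have c0 : 0 < c by rewrite /c lt_min ltr01 !divr_gt0.
have c1 : c <= 1 by rewrite /c ge_min lexx.
exists (c * (z - t)); apply: Pe => /=.
- rewrite /ball /= sub0r normrN normrM gtr0_norm //.
  apply: (@le_lt_trans _ _ (e / 2)).
    by rewrite -ler_pdivlMr // /c ge_min lexx orbT.
  by rewrite ltr_pdivrMr // ltr_pMr // ltr1n.
- by rewrite mulf_neq0 ?(gt_eqF c0) // subr_eq0.
have itv : is_interval [set` I] by exact: interval_is_interval.
have [zlt|tlt] := leP z t.
  by apply: (itv z t) => //; apply/andP; split; nra.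
by apply: (itv t z) => //; apply/andP; split; nra.
Qed.

Lemma eq_diff_quotient {R : realType} (I : interval R) (f g : R -> R) t :
  t \in I -> {in I, f =1 g} ->
  diff_quotient_within I f t = diff_quotient_within I g t.
Proof.
move=> tI fg; apply/funext => A; rewrite /diff_quotient_within.
change (0^' (fun h => h + t \in I -> A (h^-1 * (f (h + t) - f t))) =
        0^' (fun h => h + t \in I -> A (h^-1 * (g (h + t) - g t)))).
congr (0^' _); apply/funext => h; apply/propext.
by split=> H hI; move: (H hI); rewrite (fg _ hI) (fg _ tI).
Qed.

Lemma derive_within_lin {R : realType} (I : interval R) (f g : R -> R) (a t : R) :
  nondegenerate_itv I -> t \in I ->
  derivable_within I f t -> derivable_within I g t ->
  derivable_within I (fun s => a * f s + g s) t /\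
  derive_within I (fun s => a * f s + g s) t
  = a * derive_within I f t + derive_within I g t.
Proof.
move=> I_nd tI cf cg; have PF := within_proper I_nd tI.
have H : diff_quotient_within I (fun s => a * f s + g s) t
    --> a * derive_within I f t + derive_within I g t.
  rewrite /diff_quotient_within (_ : (fun h => _) = (fun h =>
    a * (h^-1 * (f (h + t) - f t)) + h^-1 * (g (h + t) - g t))); last first.
    by apply/funext => h; ring.
  by apply: cvgD => //; apply: cvgM => //; exact: cvg_cst.
by split; [exact: (cvgP _ H) | exact: cvg_lim H].
Qed.

Lemma vcoordP {R : realType} {W : vectType R} (u v : W) :
  (forall i, vcoord i u = vcoord i v) -> u = v.
Proof.
move=> uv; rewrite (coord_vbasis (memvf u)) (coord_vbasis (memvf v)).
by apply: eq_bigr => i _; congr (_ *: _); exact: uv.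
Qed.

Lemma vcoord_lin {R : realType} {W : vectType R} i (a : R) (u v : W) :
  vcoord i (a *: u + v) = a * vcoord i u + vcoord i v.
Proof. by rewrite /vcoord linearP. Qed.

Lemma vcoord_vderive {R : realType} {W : vectType R} (I : interval R)
    (l : R -> W) t i :
  vcoord i (vderive I l t) = derive_within I (fun s => vcoord i (l s)) t.
Proof. by rewrite /vcoord coord_sum_free // (basis_free (vbasisP _)). Qed.

Lemma eq_vderive {R : realType} {W : vectType R} (I : interval R)
    (f g : R -> W) : {in I, f =1 g} -> {in I, vderive I f =1 vderive I g}.
Proof.
move=> fg t tI; apply: vcoordP => i; rewrite !vcoord_vderive /derive_within.
by rewrite (@eq_diff_quotient _ _ _ (fun s => vcoord i (g s))) // => s /fg ->.
Qed.

Lemma iter_vderive_lin {R : realType} {W : vectType R} (I : interval R)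
    (f g : R -> W) (a : R) n :
  nondegenerate_itv I -> vsmooth I f -> vsmooth I g ->
  {in I, iter n (vderive I) (fun s => a *: f s + g s)
    =1 fun s => a *: iter n (vderive I) f s + iter n (vderive I) g s}.
Proof.
move=> I_nd sf sg; elim: n => [//|n IHn] t tI /=.
rewrite (eq_vderive IHn tI); apply: vcoordP => i.
rewrite vcoord_lin !vcoord_vderive.
have [_ <-] := derive_within_lin a I_nd tI (sf n i t tI) (sg n i t tI).
by congr derive_within; apply/funext => s; rewrite vcoord_lin.
Qed.

Lemma vsmooth_lin {R : realType} {W : vectType R} (I : interval R)
    (f g : R -> W) (a : R) :
  nondegenerate_itv I -> vsmooth I f -> vsmooth I g ->
  vsmooth I (fun s => a *: f s + g s).
Proof.
move=> I_nd sf sg n i t tI; rewrite /derivable_within.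
rewrite (@eq_diff_quotient _ _ _ (fun s => a * vcoord i (iter n (vderive I) f s)
  + vcoord i (iter n (vderive I) g s))) //.
  by have [] := derive_within_lin a I_nd tI (sf n i t tI) (sg n i t tI).
by move=> s sI; rewrite iter_vderive_lin // vcoord_lin.
Qed.

Lemma vderive0 {R : realType} {W : vectType R} (I : interval R) :
  nondegenerate_itv I -> {in I, vderive I (fun=> 0 : W) =1 fun=> 0}.
Proof.
move=> I_nd t tI; have PF := within_proper I_nd tI.
apply: vcoordP => i; rewrite vcoord_vderive /vcoord linear0 /derive_within.
rewrite /diff_quotient_within; apply: cvg_lim => //.
rewrite (_ : (fun h : R => _) = cst 0); first exact: cvg_cst.
by apply/funext => h; rewrite subrr mulr0.
Qed.

Lemma vsmooth0 {R : realType} {W : vectType R} (I : interval R) :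
  nondegenerate_itv I -> vsmooth I (fun=> 0 : W).
Proof.
move=> I_nd n i t tI; have PF := within_proper I_nd tI.
rewrite /derivable_within (@eq_diff_quotient _ _ _ (cst 0)) //; last first.
  move=> s sI; suff -> : iter n (vderive I) (fun=> 0 : W) s = 0.
    by rewrite /vcoord linear0.
  elim: n s sI => [//|n IHn] s sI /=.
  by rewrite (eq_vderive IHn sI) vderive0.
apply: (cvgP 0); rewrite /diff_quotient_within.
rewrite (_ : (fun h : R => _) = cst 0); first exact: cvg_cst.
by apply/funext => h; rewrite subrr mulr0.
Qed.

(** * Curves of subspaces *)

Definition vspan {R : realType} {W : vectType R} (A : set W) : {vspace W} :=
  xget 0%VS [set U : {vspace W} | (forall v, A v -> v \in U) /\
    (forall V : {vspace W}, (forall v, A v -> v \in V) -> (U <= V)%VS)].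

Lemma vspanP {R : realType} {W : vectType R} (A : set W) :
  (forall v, A v -> v \in vspan A) /\
  (forall V : {vspace W}, (forall v, A v -> v \in V) -> (vspan A <= V)%VS).
Proof.
pose P k := `[< exists X : seq W,
  (forall v, v \in X -> A v) /\ \dim <<X>> = k >].
have exP : exists k, P k by exists (\dim <<[::] : seq W>>); apply/asboolP; exists [::].
have ubP k : P k -> (k <= \dim {:W})%N.
  by move=> /asboolP[X [_ <-]]; exact/dimvS/subvf.
case: (ex_maxnP exP ubP) => k /asboolP[X [XA dimX]] kmax.
suff : [set U : {vspace W} | (forall v, A v -> v \in U) /\
    (forall V : {vspace W}, (forall v, A v -> v \in V) -> (U <= V)%VS)] <<X>>%VS.
  by rewrite /vspan; case: xgetP => [U -> [] //|/(_ <<X>>%VS)].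
split=> [v Av|V AV]; last by apply/span_subvP => v /XA /AV.
have : P (\dim <<v :: X>>).
  apply/asboolP; exists (v :: X); split=> // w.
  by rewrite inE => /orP[/eqP ->|/XA].
move=> /kmax; rewrite -dimX => le.
have sub : (<<X>> <= <<v :: X>>)%VS by rewrite span_cons addvSr.
have /eqP -> : (<<X>> == <<v :: X>>)%VS by rewrite eqEdim sub.
by apply: memv_span; rewrite mem_head.
Qed.

Lemma vspan_id {R : realType} {W : vectType R} (A : set W) v :
  A 0 -> (forall (a : R) u w, A u -> A w -> A (a *: u + w)) ->
  v \in vspan A <-> A v.
Proof.
move=> A0 Alin; have [Asub Amin] := vspanP A; split=> [|/Asub//].
pose P k := `[< exists U : {vspace W},
  (forall u, u \in U -> A u) /\ \dim U = k >].
have exP : exists k, P k.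
  by exists 0%N; apply/asboolP; exists 0%VS; split=> [u|]; rewrite ?memv0 ?dimv0 // => /eqP ->.
have ubP k : P k -> (k <= \dim {:W})%N.
  by move=> /asboolP[U [_ <-]]; exact/dimvS/subvf.
case: (ex_maxnP exP ubP) => k /asboolP[U [UA dimU]] kmax.
suff /Amin /subvP sub : forall u, A u -> u \in U by move=> /sub /UA.
move=> u Au; have : P (\dim (<[u]> + U)).
  apply/asboolP; exists (<[u]> + U)%VS; split=> // w.
  by move=> /memv_addP[_ /vlineP[a ->]] [w' /UA Aw' ->]; exact: Alin.
move=> /kmax; rewrite -dimU => le.
have /eqP -> : (U == <[u]> + U)%VS by rewrite eqEdim addvSr.
exact: (subvP (addvSl _ _) _ (memv_line u)).
Qed.

(* Smoothness as a map into a Grassmannian: local smooth frames.  (A frame that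
   is smooth near [t0] only can be cut off without changing it near [t0].) *)
Definition smooth_subspaces {R : realType} {W : vectType R} (I : interval R)
    (L : R -> {vspace W}) : Prop :=
  forall t0, t0 \in I -> exists (n : nat) (b : 'I_n -> R -> W),
    (forall k, vsmooth I (b k)) /\
    (\forall t \near t0, t \in I -> basis_of (L t) [tuple b k t | k < n]).

Definition sections {R : realType} {W : vectType R} (I : interval R)
    (L : R -> {vspace W}) : set (R -> W) :=
  [set l | vsmooth I l /\ forall t, t \in I -> l t \in L t].

Definition nth_extension {R : realType} {W : vectType R} (I : interval R)
    (L : R -> {vspace W}) (n : nat) (t : R) : {vspace W} :=
  vspan [set v | exists l j,
    [/\ sections I L l, (j <= n)%N & v = iter j (vderive I) l t]].

(* For [t \in I] the set below is already a subspace, see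
   [memv_contraction1]. *)
Definition contraction1 {R : realType} {W : vectType R} (I : interval R)
    (L : R -> {vspace W}) (t : R) : {vspace W} :=
  vspan [set v | v \in L t /\
    exists l, [/\ sections I L l, l t = v & vderive I l t \in L t]].

Lemma memv_contraction1 {R : realType} {W : vectType R} (I : interval R)
    (L : R -> {vspace W}) t v :
  nondegenerate_itv I -> t \in I ->
  v \in contraction1 I L t <->
  v \in L t /\ exists l, [/\ sections I L l, l t = v & vderive I l t \in L t].
Proof.
move=> I_nd tI; apply: vspan_id => /= [|a u w].
  split; first exact: mem0v.
  exists (fun=> 0); split=> //; last by rewrite vderive0 ?mem0v.
  by split; [exact: vsmooth0 | move=> *; exact: mem0v].
have lin (V : {vspace W}) x y : x \in V -> y \in V -> a *: x + y \in V.
  by move=> xV yV; rewrite memvD // memvZ.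
move=> [uL [f [[sf fL] fu f'L]]] [wL [g [[sg gL] gw g'L]]].
split; first exact: lin.
exists (fun s => a *: f s + g s); split; last 2 first.
- by rewrite fu gw.
- by have /= -> := iter_vderive_lin a 1 I_nd sf sg tI; exact: lin.
split; first exact: vsmooth_lin.
by move=> s sI; exact: lin (fL s sI) (gL s sI).
Qed.

Definition nth_contraction {R : realType} {W : vectType R} (I : interval R)
    (L : R -> {vspace W}) (n : nat) : R -> {vspace W} :=
  iter n (contraction1 I) L.

Definition lagrangian {R : realType} {W : vectType R}
    (omega : {skew_symmetric W}) (L : {vspace W}) : bool :=
  (L <= orthov omega L)%VS && ((\dim L).*2 == \dim {:W}).

(** * Quadratic forms *)

(* The value does not depend on the section through [v]. *)
Definition velocity {R : realType} {W : vectType R} (I : interval R)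
    (omega : {skew_symmetric W}) (L : R -> {vspace W}) (t : R) (v : W) : R :=
  let l := xget (fun=> 0) [set l | sections I L l /\ l t = v] in
  omega (vderive I l t) (l t).

Definition polar {R : realType} {W : vectType R} (q : W -> R) (u v : W) : R :=
  (q (u + v) - q u - q v) / 2.

Definition quad_rank {R : realType} {W : vectType R} (q : W -> R)
    (V : {vspace W}) : nat :=
  \rank (\matrix_(i < \dim V, j < \dim V)
           polar q (vbasis V)`_i (vbasis V)`_j).

Definition pos_inertia {R : realType} {W : vectType R} (q : W -> R)
    (V : {vspace W}) : nat :=
  \max_(k < (\dim V).+1 | `[< exists U : {vspace W},
     [/\ (U <= V)%VS, \dim U = k & forall u, u \in U -> u != 0 -> 0 < q u] >]) k.

(** * Young diagrams

   A diagram made of [d] stacked rectangles is given by the numbers of rows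
   [r i] and of columns [p i] of the rectangles; indices start at 0, so the
   superboxes of level [i] are the [j : 'I_(p i)]. *)

Definition is_rect_diagram (d : nat) (r p : 'I_d -> nat) : Prop :=
  [/\ forall i, (0 < r i)%N, forall i, (0 < p i)%N &
      forall i j : 'I_d, (i < j)%N -> (p j < p i)%N].

Definition is_young_diagram_of {R : realType} {W : vectType R} (I : interval R)
    (L : R -> {vspace W}) (d : nat) (r p : 'I_d -> nat) : Prop :=
  is_rect_diagram r p /\
  forall n t, t \in I ->
    (\dim (nth_extension I L n.+1 t) - \dim (nth_extension I L n t))%N
    = (\sum_(i < d | (n < p i)%N) r i)%N.

(* $(\Lambda_{(k)})^{(k)}(t)$ *)
Definition ext_contr {R : realType} {W : vectType R} (I : interval R)
    (L : R -> {vspace W}) (k : nat) (t : R) : {vspace W} :=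
  nth_extension I (nth_contraction I L k) k t.

Definition condition_G {R : realType} {W : vectType R} (I : interval R)
    (omega : {skew_symmetric W}) (L : R -> {vspace W})
    (d : nat) (r p : 'I_d -> nat) : Prop :=
  forall (i : 'I_d) t, (i.+1 < d)%N -> t \in I ->
    quad_rank (velocity I omega L t) (ext_contr I L (p i).-1 t)
    = (\sum_(k < d | (k <= i)%N) r k)%N.

Definition Gamma_pos {R : realType} {W : vectType R} (I : interval R)
    (omega : {skew_symmetric W}) (L : R -> {vspace W})
    (d : nat) (p : 'I_d -> nat) (t : R) (i : 'I_d) : nat :=
  pos_inertia (velocity I omega L t) (ext_contr I L (p i).-1 t).

(* The sum has the single term [Gamma_pos] of the previous level, or no term
   on the top level.  The subtraction does not truncate: the subspaces
   [ext_contr I L (p i).-1 t] increase with [i]. *)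
Definition r_pos {R : realType} {W : vectType R} (I : interval R)
    (omega : {skew_symmetric W}) (L : R -> {vspace W})
    (d : nat) (p : 'I_d -> nat) (t : R) (i : 'I_d) : nat :=
  (Gamma_pos I omega L p t i
   - \sum_(k < d | k.+1 == i :> nat) Gamma_pos I omega L p t k)%N.

(* $I_{k, n-k}$ *)
Definition sig_mx {R : realType} (n k : nat) : 'M[R]_n :=
  diag_mx (\row_(j < n) (if (j < k)%N then 1 else -1)).

(* $O(k, n-k)$ *)
Definition is_pseudo_orthogonal {R : realType} (n k : nat) (U : 'M[R]_n) : Prop :=
  U^T *m sig_mx n k *m U = sig_mx n k.

(** * Normal mappings *)

Definition compatible_map (R : realType) (d : nat) (r p : 'I_d -> nat) : Type :=
  forall i : 'I_d, 'I_(p i) -> forall i' : 'I_d, 'I_(p i') -> 'M[R]_(r i', r i).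

(* The column indices of the successive pairs when the higher level has [pj]
   superboxes and the lower one [pi] superboxes, [0 < pi < pj]. *)
Definition star_pairs (pj pi : nat) : seq (nat * nat) :=
  flatten [seq [:: (k, k); (k, k.+1)] | k <- iota 0 pi.-1]
  ++ [seq (k, pi.-1) | k <- iota pi.-1 (pj - pi.-1)].

Definition symmetric_map {R : realType} (d : nat) (r p : 'I_d -> nat)
    (M : compatible_map R r p) : Prop :=
  forall i (j : 'I_(p i)) i' (j' : 'I_(p i')), M i' j' i j = (M i j i' j')^T.

Definition quasi_normal {R : realType} (d : nat) (r p : 'I_d -> nat)
    (M : compatible_map R r p) : Prop :=
  [/\ symmetric_map M,
      forall i (j j' : 'I_(p i)),
        M i j i j' <> 0 -> [\/ j = j', j' = j.+1 :> nat | j = j'.+1 :> nat],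
      forall (i i' : 'I_d) (j : 'I_(p i)) (j' : 'I_(p i')), (i < i')%N ->
        M i j i' j' <> 0 -> (val j, val j') \in star_pairs (p i) (p i') &
      forall i (j j' : 'I_(p i)), j' = j.+1 :> nat ->
        (M i j i j')^T = - M i j i j'].

Definition normal_map {R : realType} (d : nat) (r p : 'I_d -> nat)
    (M : compatible_map R r p) : Prop :=
  quasi_normal M /\
  forall (i i' : 'I_d) (j : 'I_(p i)) (j' : 'I_(p i')), (i < i')%N ->
    (val j, val j') \in take (p i - p i' - 1)%N (star_pairs (p i) (p i')) ->
    M i j i' j' = 0.

(** * Moving frames *)

(* [E i j k] is the [k]th vector of the row attached to the [j]th superbox of
   level [i]. *)
Definition vframe (R : realType) (W : vectType R) (d : nat)
    (r p : 'I_d -> nat) : Type :=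
  forall i : 'I_d, 'I_(p i) -> 'I_(r i) -> R -> W.

(* Product of a row of vectors and a matrix. *)
Definition vrow_mul {R : realType} {W : vectType R} (m n : nat)
    (X : 'I_m -> W) (M : 'M[R]_(m, n)) (k : 'I_n) : W :=
  \sum_(h < m) M h k *: X h.

Definition darboux {R : realType} {W : vectType R}
    (omega : {skew_symmetric W}) (d : nat) (r p : 'I_d -> nat)
    (E F : vframe W r p) (t : R) : Prop :=
  forall i (j : 'I_(p i)) (k : 'I_(r i)) i' (j' : 'I_(p i')) (k' : 'I_(r i')),
  [/\ omega (E i j k t) (E i' j' k' t) = 0,
      omega (F i j k t) (F i' j' k' t) = 0 &
      omega (F i j k t) (E i' j' k' t)
      = [&& i == i' :> nat, j == j' :> nat & k == k' :> nat]%:R].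

Definition structure_equations {R : realType} {W : vectType R} (I : interval R)
    (d : nat) (r p : 'I_d -> nat) (rp : 'I_d -> nat)
    (E F : vframe W r p) (M : compatible_map R r p) (t : R) : Prop :=
  let ER i (j : 'I_(p i)) (k : 'I_(r i)) : W :=
    \sum_(i' < d) \sum_(j' < p i')
      vrow_mul (fun h => E i' j' h t) (M i j i' j') k in
  [/\ forall i (j0 j : 'I_(p i)) k, j = j0.+1 :> nat ->
        vderive I (E i j k) t = E i j0 k t,
      forall i (j : 'I_(p i)) k, j = 0%N :> nat ->
        vderive I (E i j k) t
        = vrow_mul (fun h => F i j h t) (sig_mx (r i) (rp i)) k,
      forall i (j j1 : 'I_(p i)) k, j1 = j.+1 :> nat ->
        vderive I (F i j k) t = ER i j k - F i j1 k t &
      forall i (j : 'I_(p i)) k, p i = j.+1 ->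
        vderive I (F i j k) t = ER i j k].

Definition normal_moving_frame {R : realType} {W : vectType R}
    (I : interval R) (omega : {skew_symmetric W}) (L : R -> {vspace W})
    (d : nat) (r p : 'I_d -> nat) (rp : 'I_d -> nat)
    (E F : vframe W r p) : Prop :=
  [/\ forall i (j : 'I_(p i)) k, vsmooth I (E i j k) /\ vsmooth I (F i j k),
      forall t, t \in I -> darboux omega E F t,
      forall t, t \in I ->
        L t = (\sum_(i < d) \sum_(j < p i) \sum_(k < r i) <[E i j k t]>)%VS &
      exists M : R -> compatible_map R r p, forall t, t \in I ->
        normal_map (M t) /\ structure_equations I rp E F (M t) t].

(* Main.v *)
(* Writing $e$ for the last row $E_{\sigma}$ of every level, the whole tuple E
   consists of derivatives of $e$, and the matrices $\omega(e_s^{(k)}, e_u^{(l)})$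
   contain all the information.  A normal frame exists over $e$ if and only if
   these pairings vanish for $k + l < 2 \max(p_s, p_u)$ between levels of different
   lengths, and on a level of length $p$ vanish for $k + l \le 2p$ except that for
   $k + l = 2p - 1$ they are $\pm$ the constant signature matrix ([normal_gen]).
   The rows F are then determined column by column: the part of $F_{r(a)}$ along E
   is prescribed by $\omega(F', F')$ and by the shape of a normal mapping.

   Such generators $e$ are built level by level, from long rows to short ones.  The
   new ones are sought in the contraction of order $p_i - 1$, orthogonally to the
   generators already found; a linear differential equation makes their pairings
   of order $2p_i$ vanish and those of order $2p_i - 1$ constant, the latter being
   nondegenerate by condition (G), or by a dimension count on the last level.

   Two families of generators expand into each other triangularly with respect
   to the order of the derivatives; the orders of vanishing leave only a
   constant pseudo-orthogonal matrix on every level, and F follows by its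
   uniqueness. *)

Require Import Defs.
From HB Require Import structures.
From mathcomp Require Import all_boot all_order all_algebra zify ring lra.
From mathcomp Require Import all_classical all_reals all_analysis.

Set Implicit Arguments.
Unset Strict Implicit.
Unset Printing Implicit Defensive.

Import Order.TTheory GRing.Theory Num.Theory.
Import numFieldNormedType.Exports.

Local Open Scope classical_set_scope.
Local Open Scope ring_scope.

(** * Calculus on an interval *)

(** The curve need not be monotonic, so the forms are indefinite and a Gram-Schmidt process could
    meet isotropic vectors. One identity takes the place of positivity. If the pairings of two
    curves of total order below n vanish, those of order n depend on the position of the derivatives
    only through a sign, and those of order n + 1 also through multiples of the derivative of the
    pairing of order n. With n = 2p - 1, the pairings of order 2p - 1 are constant as soon as those
    of order 2p vanish. So it suffices to normalise a level at one time, and for the same reason two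
    families of generators differ by constant matrices. Contractions enter by duality: the
    contraction of order q is the skew-orthogonal complement of the extension of order q. Its
    dimension is therefore read off the Young diagram, and membership in it is a statement about
    pairings. The number of positive signs on a level is at first whatever Sylvester's law returns.
    It is identified afterwards, at every time, with the inertia index of the curve, so the
    constancy of these indices comes out of the construction. *)

Definition has_deriv {R : realType} (I : interval R) (f : R -> R) (t l : R) :=
  diff_quotient_within I f t --> l.

(** The epsilon-delta form restricts to subintervals at once and treats endpoints of [I] like
    interior points. *)
Definition continuous_on {R : realType} (I : interval R) (f : R -> R) (t : R) :=
  forall e, 0 < e -> exists2 d, 0 < d &
    forall s, s \in I -> `|s - t| < d -> `|f s - f t| <= e.

Lemma continuous_on_within {R : realType} (f : R -> R) (s t : R) : s < t ->
  (forall x, x \in `[s, t] -> continuous_on `[s, t] f x) ->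
  {within `[s, t], continuous f}.
Proof.
move=> st cont; apply/(continuous_within_itvP _ st); split.
- move=> x; rewrite in_itv /= => /andP[sx xt].
  apply/cvgrPdist_le => e e0; have [|d d0 Hd] := cont x _ e e0.
    by rewrite in_itv /= !ltW.
  apply/nbhs_ballP; exists (Num.min d (Num.min (x - s) (t - x))).
    by rewrite /= !lt_min d0 !subr_gt0 sx.
  move=> y; rewrite /ball /= !lt_min => /and3P[yd ys yt].
  rewrite distrC; apply: Hd; last by rewrite distrC.
  rewrite in_itv /=.
  by move: ys yt; rewrite !ltr_norml => /andP[? ?] /andP[? ?]; apply/andP; split; lra.
- apply/cvgrPdist_le => e e0; have [|d d0 Hd] := cont s _ e e0.
    by rewrite in_itv /= lexx ltW.
  rewrite near_withinE; apply/nbhs_ballP; exists (Num.min d (t - s)).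
    by rewrite /= !lt_min d0 subr_gt0.
  move=> y; rewrite /ball /= !lt_min => /andP[yd yt] sy.
  rewrite distrC; apply: Hd; last by rewrite distrC.
  rewrite in_itv /=.
  by move: yt; rewrite !ltr_norml => /andP[? ?]; apply/andP; split; lra.
- apply/cvgrPdist_le => e e0; have [|d d0 Hd] := cont t _ e e0.
    by rewrite in_itv /= lexx ltW.
  rewrite near_withinE; apply/nbhs_ballP; exists (Num.min d (t - s)).
    by rewrite /= !lt_min d0 subr_gt0.
  move=> y; rewrite /ball /= !lt_min => /andP[yd yt] sy.
  rewrite distrC; apply: Hd; last by rewrite distrC.
  rewrite in_itv /=.
  by move: yt; rewrite !ltr_norml => /andP[? ?]; apply/andP; split; lra.
Qed.

Section ScalarCalculus.
Context {R : realType} (I : interval R) (I_nd : nondegenerate_itv I).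
Implicit Types (f g : R -> R) (t l k : R).

(** Clearing the denominator makes the estimate meaningful at [s = t] too, so that no punctured
    neighbourhoods appear afterwards. *)
Lemma has_derivP f t l : t \in I ->
  has_deriv I f t l <-> forall e, 0 < e -> exists2 d, 0 < d &
    forall s, s \in I -> `|s - t| < d -> `|f s - f t - l * (s - t)| <= e * `|s - t|.
Proof.
move=> tI; have PF := within_proper I_nd tI; split.
  move=> /cvgrPdist_le H e e0.
  have : \forall h \near within [set h | h + t \in I] 0^',
    `|l - h^-1 * (f (h + t) - f t)| <= e := H e e0.
  rewrite near_withinE => /nbhs_ballP[d /= d0 Hd].
  exists d => // s sI sd; have [->|st] := eqVneq s t.
    by rewrite !subrr mulr0 subrr normr0 mulr0.
  have st0 : s - t != 0 by rewrite subr_eq0.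
  have := Hd (s - t); rewrite /ball /= sub0r normrN => /(_ sd) /(_ st0).
  rewrite subrK => /(_ sI).
  rewrite -(ler_pM2r (_ : 0 < `|s - t|)) ?normr_gt0 // -normrM mulrBl.
  by rewrite mulrAC mulVf // mul1r distrC.
move=> H; apply/cvgrPdist_le => e e0; have [d d0 Hd] := H e e0.
change (\forall h \near within [set h | h + t \in I] 0^',
  `|l - h^-1 * (f (h + t) - f t)| <= e).
rewrite near_withinE; apply/nbhs_ballP; exists d => //= h.
rewrite /ball /= sub0r normrN => hd h0 hI.
have := Hd (h + t) hI; rewrite addrK => /(_ hd) hle.
rewrite -(ler_pM2r (_ : 0 < `|h|)) ?normr_gt0 // -normrM mulrBl.
by rewrite mulrAC mulVf // mul1r distrC.
Qed.

Lemma has_deriv_derivable f t l : has_deriv I f t l -> derivable_within I f t.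
Proof. by move=> H; exact: (cvgP _ H). Qed.

Lemma has_derivE f t l : t \in I -> has_deriv I f t l -> derive_within I f t = l.
Proof. by move=> tI H; have PF := within_proper I_nd tI; exact: cvg_lim H. Qed.

Lemma has_deriv_eq f g t l : {in I, f =1 g} -> t \in I ->
  has_deriv I f t l -> has_deriv I g t l.
Proof. by move=> fg tI; rewrite /has_deriv (eq_diff_quotient tI fg). Qed.

Lemma has_deriv_cst c t : t \in I -> has_deriv I (fun=> c) t 0.
Proof.
move=> tI; apply/has_derivP => // e e0; exists 1 => // s _ _.
by rewrite subrr mul0r subr0 normr0 mulr_ge0 // ltW.
Qed.

Lemma has_derivD f g t k l : t \in I -> has_deriv I f t k -> has_deriv I g t l ->
  has_deriv I (fun s => f s + g s) t (k + l).
Proof.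
move=> tI fk gl; have PF := within_proper I_nd tI; rewrite /has_deriv /diff_quotient_within.
rewrite (_ : (fun h => _) = (fun h =>
    (h^-1 * (f (h + t) - f t)) + h^-1 * (g (h + t) - g t))).
  exact: cvgD.
by apply/funext => h; ring.
Qed.

Lemma has_deriv_continuous f t l : t \in I -> has_deriv I f t l -> continuous_on I f t.
Proof.
move=> tI /has_derivP -/(_ tI) H e e0; have [d d0 Hd] := H 1 ltr01.
have l1 : 0 < `|l| + 1 by rewrite ltr_wpDl.
exists (Num.min d (e / (`|l| + 1))).
  by rewrite lt_min d0 divr_gt0.
move=> s sI; rewrite lt_min => /andP[sd se].
have := Hd s sI sd; rewrite mul1r => Hs.
have -> : f s - f t = (f s - f t - l * (s - t)) + l * (s - t) by ring.
apply: (le_trans (ler_normD _ _)); rewrite normrM.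
apply: (@le_trans _ _ ((`|l| + 1) * `|s - t|)); first by rewrite mulrDl mul1r addrC lerD.
by rewrite mulrC -ler_pdivlMr // ltW.
Qed.

Lemma has_derivM f g t k l : t \in I -> has_deriv I f t k -> has_deriv I g t l ->
  has_deriv I (fun s => f s * g s) t (k * g t + f t * l).
Proof.
move=> tI fk gl; have PF := within_proper I_nd tI.
have cg : (fun h => g (h + t)) @ within [set h | h + t \in I] 0^' --> g t.
  apply/cvgrPdist_le => e e0.
  have [d d0 Hd] := has_deriv_continuous tI gl e0.
  change (\forall h \near within [set h | h + t \in I] 0^', `|g t - g (h + t)| <= e).
  rewrite near_withinE; apply/nbhs_ballP; exists d => //= h.
  rewrite /ball /= sub0r normrN => hd h0 hI; rewrite distrC.
  by apply: Hd => //; rewrite addrK.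
rewrite /has_deriv /diff_quotient_within.
rewrite (_ : (fun h => _) = (fun h =>
    (h^-1 * (f (h + t) - f t)) * g (h + t) + f t * (h^-1 * (g (h + t) - g t)))).
  by apply: cvgD; apply: cvgM => //; exact: cvg_cst.
by apply/funext => h; ring.
Qed.

Lemma has_derivN f t k : t \in I -> has_deriv I f t k -> has_deriv I (fun s => - f s) t (- k).
Proof.
move=> tI fk; have := has_derivM tI (has_deriv_cst (-1) tI) fk.
rewrite mul0r add0r mulN1r; apply: has_deriv_eq => // s _; by rewrite mulN1r.
Qed.

Lemma has_derivB f g t k l : t \in I -> has_deriv I f t k -> has_deriv I g t l ->
  has_deriv I (fun s => f s - g s) t (k - l).
Proof. by move=> tI fk gl; apply: has_derivD => //; exact: has_derivN. Qed.

Lemma has_deriv_sum (J : Type) (r : seq J) (P : pred J) (f : J -> R -> R) (l : J -> R) t :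
  t \in I -> (forall i, has_deriv I (f i) t (l i)) ->
  has_deriv I (fun s => \sum_(i <- r | P i) f i s) t (\sum_(i <- r | P i) l i).
Proof.
move=> tI H; elim: r => [|a r IHr].
  rewrite big_nil; apply: (has_deriv_eq _ tI (has_deriv_cst 0 tI)) => s _.
  by rewrite big_nil.
rewrite big_cons; case: ifP => Pa.
  apply: (has_deriv_eq _ tI (has_derivD tI (H a) IHr)) => s _.
  by rewrite big_cons Pa.
by apply: (has_deriv_eq _ tI IHr) => s _; rewrite big_cons Pa.
Qed.

Lemma has_derivV f t k : t \in I -> f t != 0 -> has_deriv I f t k ->
  has_deriv I (fun s => (f s)^-1) t (- k * (f t)^-1 * (f t)^-1).
Proof.
move=> tI ft0 fk; have PF := within_proper I_nd tI.
have cf : (fun h => f (h + t)) @ within [set h | h + t \in I] 0^' --> f t.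
  apply/cvgrPdist_le => e e0.
  have [d d0 Hd] := has_deriv_continuous tI fk e0.
  change (\forall h \near within [set h | h + t \in I] 0^', `|f t - f (h + t)| <= e).
  rewrite near_withinE; apply/nbhs_ballP; exists d => //= h.
  rewrite /ball /= sub0r normrN => hd h0 hI; rewrite distrC.
  by apply: Hd => //; rewrite addrK.
have cfV := cvgV ft0 cf.
rewrite /has_deriv /diff_quotient_within.
have H : (fun h => - (h^-1 * (f (h + t) - f t)) * (f (h + t))^-1 * (f t)^-1)
    @ within [set h | h + t \in I] 0^' --> - k * (f t)^-1 * (f t)^-1.
  apply: cvgM; last exact: cvg_cst.
  have fk' : (fun h => h^-1 * (f (h + t) - f t))
    @ within [set h | h + t \in I] 0^' --> k by exact: fk.
  exact: (cvgM (cvgN fk') (cfV _)).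
(* The closed formula for the quotient holds only where [f] is nonzero, which continuity ensures
   near [t]. *)
apply: cvg_trans H; apply: near_eq_cvg.
have e0 : 0 < `|f t| / 2 by rewrite divr_gt0 // normr_gt0.
have [d d0 Hd] := has_deriv_continuous tI fk e0.
rewrite near_withinE; apply/nbhs_ballP; exists d => //= h.
rewrite /ball /= sub0r normrN => hd h0 hI.
have fh0 : f (h + t) != 0.
  apply/eqP => fh; have := Hd (h + t) hI; rewrite addrK => /(_ hd).
  rewrite fh sub0r normrN; apply/negP; rewrite -ltNge ltr_pdivrMr //.
  by rewrite ltr_pMr ?normr_gt0 // ltr1n.
by field; rewrite fh0 ft0 h0.
Qed.

Lemma derivative_interior f a b x l : a \in I -> b \in I -> x \in `]a, b[ ->
  has_deriv I f x l -> is_derive x 1 f l.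
Proof.
move=> aI bI; rewrite in_itv /= => /andP[ax xb] H.
have itv : is_interval [set` I] by exact: interval_is_interval.
have H' : (fun h : R => h^-1 *: (f (h *: 1 + x) - f x)) @ 0^' --> l.
  apply: cvg_trans H; rewrite /diff_quotient_within.
  rewrite (_ : (fun h : R => h^-1 *: _) = (fun h => h^-1 * (f (h + x) - f x))); last first.
    by apply/funext => h; rewrite /GRing.scale /= mulr1.
  apply: cvg_app; move=> A; rewrite /within /= => /nbhs_ballP[d /= d0 Hd].
  apply/nbhs_ballP; exists (Num.min d (Num.min (x - a) (b - x))).
    by rewrite /= !lt_min d0 !subr_gt0 ax.
  move=> h; rewrite /ball /= sub0r normrN !lt_min => /and3P[hd ha hb] h0.
  apply: Hd => //; first by rewrite /ball /= sub0r normrN.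
  apply: (itv a b) => //; apply/andP.
  by move: ha hb; rewrite !ltr_norml => /andP[? ?] /andP[? ?]; split; lra.
by split; [exact: (cvgP _ H') | exact: cvg_lim H'].
Qed.

Lemma MVT_on f g s t : s \in I -> t \in I -> s < t ->
  (forall x, x \in I -> has_deriv I f x (g x)) ->
  exists2 c, s < c < t & f t - f s = g c * (t - s).
Proof.
move=> sI tI st H; have itv : is_interval [set` I] by exact: interval_is_interval.
have sub x : s <= x <= t -> x \in I by move=> ?; apply: (itv s t).
have [||c] := @MVT R f g s t st.
- move=> x xst; apply: (derivative_interior sI tI (xst)); apply: H; apply: sub.
  by move: xst; rewrite in_itv /= => /andP[/ltW -> /ltW ->].
- apply: continuous_on_within => // x xst e e0.
  have xI : x \in I by apply: sub; move: xst; rewrite in_itv.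
  have [d d0 Hd] := has_deriv_continuous xI (H _ xI) e0.
  by exists d => // y; rewrite in_itv /= => /sub; exact: Hd.
by rewrite in_itv /= => cst E; exists c.
Qed.

Lemma has_deriv0_cst f s t : s \in I -> t \in I ->
  (forall x, x \in I -> has_deriv I f x 0) -> f s = f t.
Proof.
move=> sI tI H; wlog st : s t sI tI / s < t.
  by case: (ltgtP s t) => [st|ts|->] // /(_ _ _ _ _ _)H'; [|apply/esym]; apply: H'.
have [c _] := MVT_on sI tI st H.
by rewrite mul0r => /eqP; rewrite subr_eq0 => /eqP ->.
Qed.

End ScalarCalculus.

(** * Functions of finite and infinite order of differentiability *)

Section SmoothFunctions.
Context {R : realType} (I : interval R) (I_nd : nondegenerate_itv I).
Implicit Types (f g : R -> R) (t : R) (n : nat).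

(** Differentiability [n] times, without continuity of the last derivative. Smoothness of products
    and inverses goes through it: the derivative of [f * g] involves [f] and [g] again, so only an
    induction on a finite order closes. *)
Definition class_C n f := forall k t, (k < n)%N -> t \in I ->
  derivable_within I (iter k (derive_within I) f) t.

Definition smoothf f := forall n t, t \in I ->
  derivable_within I (iter n (derive_within I) f) t.

Lemma smoothfP f : smoothf f <-> forall n, class_C n f.
Proof. by split=> [H n k t _|H n t tI]; [exact: H | exact: (H n.+1)]. Qed.

Lemma class_CW n f : class_C n.+1 f -> class_C n f.
Proof. by move=> H k t kn; apply: H; apply: ltnW. Qed.

Lemma iter_derive_eq f g n : {in I, f =1 g} ->
  {in I, iter n (derive_within I) f =1 iter n (derive_within I) g}.
Proof.
move=> fg; elim: n => [//|n IHn] t tI /=; rewrite /derive_within.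
by rewrite (eq_diff_quotient tI IHn).
Qed.

Lemma class_C_eq n f g : {in I, f =1 g} -> class_C n f -> class_C n g.
Proof.
move=> fg H k t kn tI; rewrite /derivable_within.
by rewrite -(eq_diff_quotient tI (iter_derive_eq k fg)); exact: H.
Qed.

Lemma class_CS n f : class_C n.+1 f ->
  (forall t, t \in I -> has_deriv I f t (derive_within I f t)) /\
  class_C n (derive_within I f).
Proof.
move=> H; split=> [t tI|k t kn tI]; first exact: (H 0%N).
by rewrite -iterSr; exact: (H k.+1).
Qed.

Lemma class_C_has_deriv n f g : (forall t, t \in I -> has_deriv I f t (g t)) ->
  class_C n g -> class_C n.+1 f.
Proof.
move=> H Cg [|k] t kn tI; first exact: has_deriv_derivable (H t tI).
rewrite iterSr /derivable_within.
have fg : {in I, derive_within I f =1 g} by move=> s sI; apply: has_derivE => //; exact: H.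
by rewrite (eq_diff_quotient tI (iter_derive_eq k fg)); exact: Cg.
Qed.

Lemma class_CD n f g : class_C n f -> class_C n g -> class_C n (fun s => f s + g s).
Proof.
elim: n f g => [//|n IHn] f g /class_CS[hf cf] /class_CS[hg cg].
apply: (class_C_has_deriv (g := fun s => derive_within I f s + derive_within I g s)).
  by move=> t tI; apply: has_derivD => //; [exact: hf | exact: hg].
exact: IHn.
Qed.

Lemma class_C_cst n c : class_C n (fun=> c).
Proof.
elim: n c => [//|n IHn] c; apply: (class_C_has_deriv (g := fun=> 0)) => // t tI.
exact: has_deriv_cst.
Qed.

Lemma class_CM n f g : class_C n f -> class_C n g -> class_C n (fun s => f s * g s).
Proof.
elim: n f g => [//|n IHn] f g Cf Cg; have /class_CS[hf cf] := Cf; have /class_CS[hg cg] := Cg.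
apply: (class_C_has_deriv (g := fun s => derive_within I f s * g s + f s * derive_within I g s)).
  by move=> t tI; apply: has_derivM => //; [exact: hf | exact: hg].
by apply: class_CD; apply: IHn => //; exact: class_CW.
Qed.

Lemma class_CV n f : {in I, forall t, f t != 0} -> class_C n f -> class_C n (fun s => (f s)^-1).
Proof.
move=> f0; elim: n => [//|n IHn] Cf; have /class_CS[hf cf] := Cf.
apply: (class_C_has_deriv (g := fun s => - derive_within I f s * (f s)^-1 * (f s)^-1)).
  by move=> t tI; apply: has_derivV => //; [exact: f0 | exact: hf].
have Cv := IHn (class_CW Cf).
apply: class_CM => //; apply: class_CM => //.
apply: (@class_C_eq _ (fun s => -1 * derive_within I f s)) => [s _|]; first by rewrite mulN1r.
by apply: class_CM => //; exact: class_C_cst.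
Qed.

Lemma smoothf_has_deriv f t : smoothf f -> t \in I -> has_deriv I f t (derive_within I f t).
Proof. by move=> H tI; exact: (H 0%N). Qed.

Lemma smoothf_derive f : smoothf f -> smoothf (derive_within I f).
Proof. by move=> H n t tI; rewrite -iterSr; exact: H. Qed.

Lemma smoothf_eq f g : {in I, f =1 g} -> smoothf f -> smoothf g.
Proof. by move=> fg /smoothfP H; apply/smoothfP => n; exact: class_C_eq (H n). Qed.

Lemma smoothf_cst c : smoothf (fun=> c).
Proof. by apply/smoothfP => n; exact: class_C_cst. Qed.

Lemma smoothfD f g : smoothf f -> smoothf g -> smoothf (fun s => f s + g s).
Proof. by move=> /smoothfP Hf /smoothfP Hg; apply/smoothfP => n; exact: class_CD. Qed.

Lemma smoothfM f g : smoothf f -> smoothf g -> smoothf (fun s => f s * g s).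
Proof. by move=> /smoothfP Hf /smoothfP Hg; apply/smoothfP => n; exact: class_CM. Qed.

Lemma smoothfV f : {in I, forall t, f t != 0} -> smoothf f -> smoothf (fun s => (f s)^-1).
Proof. by move=> f0 /smoothfP Hf; apply/smoothfP => n; exact: class_CV. Qed.

Lemma smoothfN f : smoothf f -> smoothf (fun s => - f s).
Proof.
move=> Hf; apply: (@smoothf_eq (fun s => -1 * f s)) => [s _|]; first by rewrite mulN1r.
by apply: smoothfM => //; exact: smoothf_cst.
Qed.

Lemma smoothfB f g : smoothf f -> smoothf g -> smoothf (fun s => f s - g s).
Proof. by move=> Hf Hg; apply: smoothfD => //; exact: smoothfN. Qed.

Lemma smoothf_sum (J : Type) (r : seq J) (P : pred J) (f : J -> R -> R) :
  (forall i, P i -> smoothf (f i)) -> smoothf (fun s => \sum_(i <- r | P i) f i s).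
Proof.
move=> H; elim: r => [|a r IHr].
  by apply: (smoothf_eq _ (@smoothf_cst 0)) => s _; rewrite big_nil.
case Pa: (P a); last by apply: (smoothf_eq _ IHr) => s _; rewrite big_cons Pa.
by apply: (smoothf_eq _ (smoothfD (H _ Pa) IHr)) => s _; rewrite big_cons Pa.
Qed.

Lemma smoothf_prod (J : Type) (r : seq J) (P : pred J) (f : J -> R -> R) :
  (forall i, P i -> smoothf (f i)) -> smoothf (fun s => \prod_(i <- r | P i) f i s).
Proof.
move=> H; elim: r => [|a r IHr].
  by apply: (smoothf_eq _ (@smoothf_cst 1)) => s _; rewrite big_nil.
case Pa: (P a); last by apply: (smoothf_eq _ IHr) => s _; rewrite big_cons Pa.
by apply: (smoothf_eq _ (smoothfM (H _ Pa) IHr)) => s _; rewrite big_cons Pa.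
Qed.

Lemma smoothf_det n (M : R -> 'M[R]_n) :
  (forall i j, smoothf (fun s => M s i j)) -> smoothf (fun s => \det (M s)).
Proof.
move=> H; apply: smoothf_sum => s _; apply: smoothfM; first exact: smoothf_cst.
by apply: smoothf_prod.
Qed.

(** Cramer's rule: an entry of the inverse is a cofactor divided by the determinant. *)
Lemma smoothf_invmx n (M : R -> 'M[R]_n) : {in I, forall t, M t \in unitmx} ->
  (forall i j, smoothf (fun s => M s i j)) ->
  forall i j, smoothf (fun s => invmx (M s) i j).
Proof.
move=> U H i j; pose g s := (\det (M s))^-1 * \adj (M s) i j.
apply: (@smoothf_eq g) => [s sI|].
  by rewrite /invmx (U s sI) mxE.
apply: smoothfM.
  by apply: (smoothfV _ (smoothf_det H)) => t /U; rewrite unitmxE unitfE.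
apply: (@smoothf_eq (fun s => (-1) ^+ (j + i) * \det (row' j (col' i (M s))))).
  by move=> s _; rewrite mxE /cofactor.
apply: smoothfM; first exact: smoothf_cst.
apply: smoothf_det => a b.
by apply: (smoothf_eq _ (H (lift j a) (lift i b))) => s _; rewrite !mxE.
Qed.

Lemma smoothf_mulmx n m p (A : R -> 'M[R]_(n, m)) (B : R -> 'M[R]_(m, p)) :
  (forall i j, smoothf (fun s => A s i j)) -> (forall i j, smoothf (fun s => B s i j)) ->
  forall i j, smoothf (fun s => (A s *m B s) i j).
Proof.
move=> HA HB i j; apply: (@smoothf_eq (fun s => \sum_k A s i k * B s k j)).
  by move=> s _; rewrite mxE.
by apply: smoothf_sum => k _; exact: smoothfM.
Qed.

End SmoothFunctions.

(** * Smoothness is a local property *)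

Section Locality.
Context {R : realType} (I J : interval R).
Hypotheses (I_nd : nondegenerate_itv I) (J_nd : nondegenerate_itv J).
Hypothesis JI : forall x, x \in J -> x \in I.
Hypothesis J_open : forall x, x \in J -> exists2 d, 0 < d &
  forall s, s \in I -> `|s - x| < d -> s \in J.
Implicit Types (f : R -> R) (t l : R).

Lemma has_deriv_sub f t l : t \in J -> has_deriv I f t l -> has_deriv J f t l.
Proof.
move=> tJ /(has_derivP I_nd _ _ (JI tJ)) H; apply/has_derivP => // e e0.
by have [d d0 Hd] := H e e0; exists d => // s /JI; exact: Hd.
Qed.

Lemma has_deriv_open f t l : t \in J -> has_deriv J f t l -> has_deriv I f t l.
Proof.
move=> tJ /(has_derivP J_nd _ _ tJ) H; apply/(has_derivP I_nd _ _ (JI tJ)) => e e0.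
have [d d0 Hd] := H e e0; have [d' d'0 Hd'] := J_open tJ.
exists (Num.min d d'); first by rewrite lt_min d0.
move=> s sI; rewrite lt_min => /andP[sd sd'].
by apply: Hd => //; exact: Hd'.
Qed.

Lemma smoothf_sub f : smoothf I f -> smoothf J f.
Proof.
move=> /smoothfP H; apply/smoothfP => n; have := H n; elim: n f {H} => [//|n IHn] f.
move=> /class_CS[h c]; apply: (class_C_has_deriv J_nd (g := derive_within I f)).
  by move=> t tJ; apply: has_deriv_sub => //; apply: h; exact: JI.
exact: IHn.
Qed.

Lemma iter_derive_open f n : smoothf J f ->
  {in J, iter n (derive_within I) f =1 iter n (derive_within J) f}.
Proof.
move=> sf; elim: n => [//|n IHn] t tJ /=; apply: has_derivE => //; first exact: JI.
apply: has_deriv_open => //.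
apply: (has_deriv_eq _ _ (sf n t tJ)) => //; first by move=> s sJ; rewrite IHn.
Qed.

Lemma derivable_open f n t : smoothf J f -> t \in J ->
  derivable_within I (iter n (derive_within I) f) t.
Proof.
move=> sf tJ; apply: has_deriv_derivable; apply: has_deriv_open => //.
apply: (has_deriv_eq _ _ (sf n t tJ)) => //; first by move=> s sJ; rewrite iter_derive_open.
Qed.

End Locality.

(** [J] is the trace on [I] of an open ball, hence relatively open. Its nondegeneracy needs an
    argument because [t] may be an endpoint of [I]. *)
Lemma itv_ball {R : realType} (I : interval R) (t d : R) : nondegenerate_itv I -> t \in I ->
  0 < d -> exists J : interval R, [/\ nondegenerate_itv J, t \in J,
    forall x, (x \in J) = (x \in I) && (`|x - t| < d) &
    forall x, x \in J -> exists2 e, 0 < e & forall s, s \in I -> `|s - x| < e -> s \in J].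
Proof.
move=> I_nd tI d0; pose J := (I `&` `]t - d, t + d[)%O.
have JE x : (x \in J) = (x \in I) && (`|x - t| < d).
  rewrite in_itvI ltr_norml; congr (_ && _).
  by rewrite in_itv /=; apply/andP/andP => -[? ?]; split; lra.
have itv : is_interval [set` I] by exact: interval_is_interval.
exists J; split=> //; last first.
- move=> x; rewrite JE => /andP[xI xd]; exists (d - `|x - t|); first by rewrite subr_gt0.
  move=> s sI sx; rewrite JE sI /=; have -> : s - t = (s - x) + (x - t) by ring.
  by rewrite (le_lt_trans (ler_normD _ _)) // -ltrBrDr.
- by rewrite JE tI subrr normr0.
have [z zI zt] : exists2 z, z \in I & z != t.
  have [x [y [xI yI xy]]] := I_nd.
  case: (eqVneq x t) => [xt|?]; last by exists x.
  by exists y; rewrite // -xt gt_eqF.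
case: (ltgtP z t) zt => // zt _.
- exists (Num.max z (t - d / 2)), t; split; last by rewrite gt_max zt; lra.
    rewrite JE; apply/andP; split.
      apply: (itv z t) => //; rewrite le_max lexx /= ge_max (ltW zt) /=; lra.
    rewrite ltr_norml; case: (leP z (t - d/2)) => ?; lra.
  by rewrite JE tI subrr normr0.
- exists t, (Num.min z (t + d / 2)); split; last by rewrite lt_min zt; lra.
    by rewrite JE tI subrr normr0.
  rewrite JE; apply/andP; split.
    apply: (itv t z) => //; rewrite ge_min lexx /= le_min (ltW zt) /= andbT; lra.
  rewrite ltr_norml; case: (leP z (t + d/2)) => ?; lra.
Qed.

Lemma smoothf_local {R : realType} (I : interval R) (f : R -> R) :
  nondegenerate_itv I ->
  (forall t, t \in I -> exists2 d, 0 < d & forall J : interval R,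
    nondegenerate_itv J -> (forall x, x \in J -> x \in I /\ `|x - t| < d) ->
    (forall x, x \in J -> exists2 e, 0 < e &
      forall s, s \in I -> `|s - x| < e -> s \in J) -> smoothf J f) ->
  smoothf I f.
Proof.
move=> I_nd H n t tI; have [d d0 Hd] := H t tI.
have [J [J_nd tJ JE Jo]] := itv_ball I_nd tI d0.
have JI x : x \in J -> x \in I by rewrite JE => /andP[].
apply: (derivable_open I_nd J_nd JI Jo) tJ; apply: Hd => //.
by move=> x; rewrite JE => /andP[].
Qed.

(** * Antiderivatives on an arbitrary interval *)

Section Antiderivative.
Context {R : realType}.
Implicit Types (I J : interval R) (f g : R -> R).

Lemma has_deriv_nbhd I J f t l d : nondegenerate_itv I -> nondegenerate_itv J ->
  (forall x, x \in J -> x \in I) -> t \in J -> 0 < d ->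
  (forall s, s \in I -> `|s - t| < d -> s \in J) ->
  has_deriv J f t l -> has_deriv I f t l.
Proof.
move=> I_nd J_nd JI tJ d0 Hd /(has_derivP J_nd _ _ tJ) H.
apply/(has_derivP I_nd _ _ (JI _ tJ)) => e e0.
have [d' d'0 Hd'] := H e e0.
exists (Num.min d d'); first by rewrite lt_min d0.
move=> s sI; rewrite lt_min => /andP[sd sd'].
by apply: Hd' => //; exact: Hd.
Qed.

Lemma has_deriv_subset I J f t l : nondegenerate_itv I -> nondegenerate_itv J ->
  (forall x, x \in J -> x \in I) -> t \in J -> has_deriv I f t l -> has_deriv J f t l.
Proof.
move=> I_nd J_nd JI tJ /(has_derivP I_nd _ _ (JI _ tJ)) H; apply/has_derivP => // e e0.
by have [d d0 Hd] := H e e0; exists d => // s /JI; exact: Hd.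
Qed.

Lemma nondegenerate_seg (a b : R) : a < b -> nondegenerate_itv `[a, b].
Proof. by move=> ab; exists a, b; rewrite !in_itv /= !lexx ltW. Qed.

Lemma is_derive_has_deriv I f t l : nondegenerate_itv I -> t \in I ->
  is_derive t 1 f l -> has_deriv I f t l.
Proof.
move=> I_nd tI [df /= fl].
have H : (fun h : R => h^-1 *: (f (h *: 1 + t) - f t)) @ 0^' --> l by rewrite -fl; exact: df.
rewrite /has_deriv /diff_quotient_within.
rewrite (_ : (fun h => _) = (fun h : R => h^-1 *: (f (h *: 1 + t) - f t))).
  by apply: cvg_trans H; apply: cvg_app; exact: cvg_within.
by apply/funext => h; rewrite /GRing.scale /= mulr1.
Qed.

Lemma continuous_antiderivative f (a b : R) : continuous f ->
  exists F, forall x, a < x < b -> is_derive x 1 F (f x).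
Proof.
move=> cf.
exists (fun x => (\int[@lebesgue_measure R]_(t in [set` `[a, x]]) (f t))%R) => x /andP[ax xb].
have [] := @continuous_FTC1_closed R f a x b xb _ ax (cf x).
  apply: continuous_compact_integrable; first exact: segment_compact.
  exact: continuous_subspaceT.
by move=> D E; rewrite derive1E in E; split.
Qed.

(** Composing with the projection [c] of the line onto the segment, which is 1-Lipschitz, extends
    [f] continuously. Integration over the larger interval from [a - 1] to [b + 1] makes [a] and [b]
    interior points. *)
Lemma segment_antiderivative f (a b : R) : a < b ->
  (forall t, t \in `[a, b] -> continuous_on `[a, b] f t) ->
  exists F, forall t, t \in `[a, b] -> has_deriv `[a, b] F t (f t).
Proof.
move=> ab cf; pose c x := Num.max a (Num.min b x).
have cab x : c x \in `[a, b].
  by rewrite in_itv /= /c le_max lexx /= ge_max (ltW ab) /= ge_min lexx.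
have cE x : x \in `[a, b] -> c x = x.
  by rewrite in_itv /= /c => /andP[? ?]; rewrite min_r // max_r.
have cL x y : `|c y - c x| <= `|y - x|.
  rewrite /c; case: (leP b x) => ?; case: (leP b y) => ?;
  rewrite ?(max_r (ltW ab)) //.
  - by rewrite subrr normr0.
  - case: (leP a y) => ?; by rewrite ler_norml; case: (ger0P (y - x)) => ?; lra.
  - case: (leP a x) => ?; by rewrite ler_norml; case: (ger0P (y - x)) => ?; lra.
  - case: (leP a x) => ?; case: (leP a y) => ?; rewrite ler_norml;
    case: (ger0P (y - x)) => ?; lra.
have [|F HF] := @continuous_antiderivative (f \o c) (a - 1) (b + 1).
  move=> x; apply/cvgrPdist_le => e e0.
  have [d d0 Hd] := cf _ (cab x) e e0.
  apply/nbhs_ballP; exists d => //= y; rewrite /ball /= => xy.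
  rewrite distrC; apply: Hd => //; apply: le_lt_trans (cL _ _) _; by rewrite distrC.
exists F => t tab; apply: is_derive_has_deriv => //; first exact: nondegenerate_seg.
rewrite -[t in f t](cE _ tab); apply: HF.
by move: tab; rewrite in_itv /= => /andP[? ?]; apply/andP; split; lra.
Qed.

(** Since [I] may be open, closed or half-open, compactness arguments take place on a segment that
    contains [t0] and is a neighbourhood of [t] in [I]. If [t] is the largest or smallest point of
    [I], the segment stops there and any radius will do. *)
Lemma itv_cover I t0 t : nondegenerate_itv I -> t0 \in I -> t \in I ->
  exists a b d, [/\ a < b, (forall x, x \in `[a, b] -> x \in I), t0 \in `[a, b],
    t \in `[a, b] & 0 < d /\ forall s, s \in I -> `|s - t| < d -> s \in `[a, b]].
Proof.
move=> I_nd t0I tI; have itv : is_interval [set` I] by exact: interval_is_interval.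
have [b [bI bt bt0 [d1 d10 Hb]]] : exists b, [/\ b \in I, t <= b, t0 <= b &
    exists2 d, 0 < d & forall s, s \in I -> `|s - t| < d -> s <= b].
  have [[y yI ty]|] := pselect (exists2 y, y \in I & t < y).
    exists (Num.max y t0); split; rewrite ?le_max ?lexx ?orbT ?(ltW ty) //.
      by case: (leP y t0).
    exists (y - t); first by rewrite subr_gt0.
    move=> s sI; rewrite ltr_norml => /andP[_ ?]; rewrite le_max; apply/orP; left; lra.
  move=> H; have tmax s : s \in I -> s <= t.
    by move=> sI; rewrite leNgt; apply/negP => ts; apply: H; exists s.
  by exists t; split => //; [exact: tmax | exists 1 => // s sI _; exact: tmax].
have [a [aI at_ at0 [d2 d20 Ha]]] : exists a, [/\ a \in I, a <= t, a <= t0 &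
    exists2 d, 0 < d & forall s, s \in I -> `|s - t| < d -> a <= s].
  have [[y yI ty]|] := pselect (exists2 y, y \in I & y < t).
    exists (Num.min y t0); split; rewrite ?ge_min ?lexx ?orbT ?(ltW ty) //.
      by case: (leP y t0).
    exists (t - y); first by rewrite subr_gt0.
    move=> s sI; rewrite ltr_norml => /andP[? _]; rewrite ge_min; apply/orP; left; lra.
  move=> H; have tmin s : s \in I -> t <= s.
    by move=> sI; rewrite leNgt; apply/negP => ts; apply: H; exists s.
  by exists t; split => //; [exact: tmin | exists 1 => // s sI _; exact: tmin].
have Hd s : s \in I -> `|s - t| < Num.min d1 d2 -> s \in `[a, b].
  by move=> sI; rewrite lt_min => /andP[/Hb -/(_ sI) ? /Ha -/(_ sI) ?]; rewrite in_itv /=; apply/andP.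
exists a, b, (Num.min d1 d2); split=> //.
- rewrite lt_neqAle (le_trans at_ bt) andbT; apply/eqP => ab.
  have E s : s \in `[a, b] -> s = t.
    by move: at_ bt; rewrite in_itv /= -ab => ? ? /andP[? ?]; apply/eqP; rewrite eq_le; apply/andP; split; lra.
  have d0 : 0 < Num.min d1 d2 by rewrite lt_min d10.
  have [J [J_nd tJ JE _]] := itv_ball I_nd tI d0.
  have [x [y [xJ yJ xy]]] := J_nd.
  move: xJ yJ; rewrite !JE => /andP[xI /(Hd _ xI) /E xt] /andP[yI /(Hd _ yI) /E yt].
  by move: xy; rewrite xt yt ltxx.
- by move=> x; rewrite in_itv /= => xab; apply: (itv a b).
- by rewrite in_itv /= at0.
- by rewrite in_itv /= at_.
- by split; first by rewrite lt_min d10.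
Qed.

Lemma continuous_on_subset I J f t : (forall x, x \in J -> x \in I) ->
  continuous_on I f t -> continuous_on J f t.
Proof.
by move=> JI H e e0; have [d d0 Hd] := H e e0; exists d => // s /JI; exact: Hd.
Qed.

(** The value at [t] is the increment from [t0] to [t] of some antiderivative on a segment
    containing both. Two choices differ by a function of zero derivative between [t0] and [t], so
    the increment does not depend on the choice. *)
Lemma antiderivative I f t0 : nondegenerate_itv I -> t0 \in I ->
  (forall t, t \in I -> continuous_on I f t) ->
  exists G, G t0 = 0 /\ forall t, t \in I -> has_deriv I G t (f t).
Proof.
move=> I_nd t0I cf.
have H t : t \in I -> exists F a b d, [/\ a < b, (forall x, x \in `[a, b] -> x \in I),
    t0 \in `[a, b], t \in `[a, b] & [/\ 0 < d,
    forall s, s \in I -> `|s - t| < d -> s \in `[a, b] &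
    forall s, s \in `[a, b] -> has_deriv `[a, b] F s (f s)]].
  move=> tI; have [a [b [d [ab sub t0ab tab [d0 Hd]]]]] := itv_cover I_nd t0I tI.
  have [s /sub sI|F HF] := @segment_antiderivative f a b ab.
    exact: continuous_on_subset (cf s sI).
  by exists F, a, b, d; split.
pose g t := xget (fun=> 0) [set F | exists a b d, [/\ a < b, (forall x, x \in `[a, b] -> x \in I),
    t0 \in `[a, b], t \in `[a, b] & [/\ 0 < d,
    forall s, s \in I -> `|s - t| < d -> s \in `[a, b] &
    forall s, s \in `[a, b] -> has_deriv `[a, b] F s (f s)]]].
exists (fun t => g t t - g t t0); split; first by rewrite subrr.
have uniq F a b t : a < b -> t0 \in `[a, b] -> t \in `[a, b] ->
    (forall x, x \in `[a, b] -> x \in I) ->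
    (forall s, s \in `[a, b] -> has_deriv `[a, b] F s (f s)) ->
    g t t - g t t0 = F t - F t0.
  move=> ab t0ab tab sub HF; have [->|t0t] := eqVneq t t0; first by rewrite !subrr.
  have /cid[G' HG'] := H _ (sub _ tab).
  have : [set F | exists a b d, [/\ a < b, (forall x, x \in `[a, b] -> x \in I),
      t0 \in `[a, b], t \in `[a, b] & [/\ 0 < d,
      forall s, s \in I -> `|s - t| < d -> s \in `[a, b] &
      forall s, s \in `[a, b] -> has_deriv `[a, b] F s (f s)]]] (g t).
    by rewrite /g; case: xgetP => [G -> //|/(_ G')].
  move=> [a' [b' [d' [a'b' sub' t0' t' [_ _ HG]]]]].
  pose u := Num.min t t0; pose v := Num.max t t0.
  have uv : u < v by rewrite /u /v; case: (ltgtP t t0) t0t.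
  have J_nd := nondegenerate_seg uv.
  have Ju x : x \in `[u, v] -> x \in `[a, b].
    move: t0ab tab; rewrite !in_itv /= /u /v.
    by case: (leP t t0) => ? /andP[? ?] /andP[? ?] /andP[? ?]; apply/andP; split; lra.
  have Ju' x : x \in `[u, v] -> x \in `[a', b'].
    move: t0' t'; rewrite !in_itv /= /u /v.
    by case: (leP t t0) => ? /andP[? ?] /andP[? ?] /andP[? ?]; apply/andP; split; lra.
  have D s : s \in `[u, v] -> has_deriv `[u, v] (fun s => g t s - F s) s 0.
    move=> sJ; rewrite -(subrr (f s)); apply: has_derivB => //.
      by apply: (has_deriv_subset (nondegenerate_seg a'b') _ Ju') => //; apply: HG; exact: Ju'.
    by apply: (has_deriv_subset (nondegenerate_seg ab) _ Ju) => //; apply: HF; exact: Ju.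
  have tJ : t \in `[u, v] by rewrite in_itv /= /u /v ge_min le_max lexx.
  have t0J : t0 \in `[u, v] by rewrite in_itv /= /u /v ge_min le_max lexx !orbT.
  by have := has_deriv0_cst J_nd tJ t0J D; lra.
move=> t tI; have [F [a [b [d [ab sub t0ab tab [d0 Hd HF]]]]]] := H t tI.
have J_nd := nondegenerate_seg ab.
apply: (has_deriv_nbhd I_nd J_nd sub tab d0 Hd).
apply: (@has_deriv_eq _ _ (fun s => F s - F t0)) => //.
  by move=> s sab; rewrite (uniq F a b).
rewrite -[f t]subr0; apply: has_derivB => //; first exact: HF.
exact: has_deriv_cst.
Qed.

End Antiderivative.

(** * Linear differential equations *)

Section LinearODE.
Context {R : realType} (I : interval R) (I_nd : nondegenerate_itv I).

Lemma continuous_on_cst c t : continuous_on I (fun=> c : R) t.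
Proof. by move=> e e0; exists 1 => // s _ _; rewrite subrr normr0 ltW. Qed.

Lemma continuous_onD f g t : continuous_on I f t -> continuous_on I g t ->
  continuous_on I (fun s => f s + g s) t.
Proof.
move=> cf cg e e0; have e2 : 0 < e / 2 by rewrite divr_gt0.
have [d d0 Hd] := cf _ e2; have [d' d'0 Hd'] := cg _ e2.
exists (Num.min d d'); first by rewrite lt_min d0.
move=> s sI; rewrite lt_min => /andP[sd sd'].
rewrite (_ : f s + g s - _ = (f s - f t) + (g s - g t)); last by ring.
by rewrite (le_trans (ler_normD _ _)) // [e]splitr lerD ?Hd ?Hd'.
Qed.

Lemma continuous_onM f g t : continuous_on I f t -> continuous_on I g t ->
  continuous_on I (fun s => f s * g s) t.
Proof.
move=> cf cg e e0.
have k0 : 0 < `|f t| + `|g t| + 1 by rewrite ltr_wpDl // addr_ge0.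
pose h := Num.min 1 (e / (`|f t| + `|g t| + 1)).
have h0 : 0 < h by rewrite lt_min ltr01 divr_gt0.
have [d d0 Hd] := cf _ h0; have [d' d'0 Hd'] := cg _ h0.
exists (Num.min d d'); first by rewrite lt_min d0.
move=> s sI; rewrite lt_min => /andP[/Hd -/(_ sI) fs /Hd' -/(_ sI) gs].
rewrite (_ : f s * g s - _ = (f s - f t) * (g s - g t) + (f s - f t) * g t + f t * (g s - g t)); last by ring.
have h1 : h <= 1 by rewrite ge_min lexx.
have he : h * (`|f t| + `|g t| + 1) <= e by rewrite -ler_pdivlMr // ge_min lexx orbT.
rewrite (le_trans (ler_normD _ _)) // (le_trans (lerD (ler_normD _ _) (lexx _))) // !normrM.
have := normr_ge0 (f t); have := normr_ge0 (g t).
have := normr_ge0 (f s - f t); have := normr_ge0 (g s - g t).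
move: (`|f t|) (`|g t|) (`|f s - f t|) (`|g s - g t|) fs gs he => a b x y *.
have : x * y <= h by nra.
have : x * b <= h * b by nra.
have : a * y <= a * h by nra.
nra.
Qed.

Lemma continuous_on_sum n (f : 'I_n -> R -> R) t : (forall i, continuous_on I (f i) t) ->
  continuous_on I (fun s => \sum_i f i s) t.
Proof.
elim: n f => [|n IHn] f H.
  rewrite (_ : (fun s => _) = fun=> 0); first exact: continuous_on_cst.
  by apply/funext => s; rewrite big_ord0.
rewrite (_ : (fun s => _) = fun s => f ord0 s + \sum_(i < n) f (lift ord0 i) s).
  by apply: continuous_onD => //; apply: IHn => i; exact: H.
by apply/funext => s; rewrite big_ord_recl.
Qed.

Lemma bounded_on (a b : R) f : a < b -> (forall x, x \in `[a, b] -> x \in I) ->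
  (forall t, t \in I -> continuous_on I f t) ->
  exists2 M, 0 < M & forall t, t \in `[a, b] -> `|f t| <= M.
Proof.
move=> ab sub cf.
have [|c cab Hc] := @EVT_max R (fun s => `|f s|) a b (ltW ab).
  apply: continuous_on_within => // x xab e e0; have [d d0 Hd] := cf x (sub _ xab) e e0.
  by exists d => // s sab sx; rewrite (le_trans (ler_dist_dist _ _)) // Hd // sub.
exists (`|f c| + 1); first by rewrite ltr_wpDl.
by move=> t /Hc H; rewrite (le_trans H) // lerDl.
Qed.

(** The bound on [f] is the derivative of [sh], so by the mean value theorem the increments of [g]
    are dominated by those of [sh]. An even weight serves both sides of [t0], and the factor [l]
    lost by integration is what makes Picard's iteration contract. *)
Lemma cosh_comparison f g (a b t0 K l : R) : a < b -> t0 \in `[a, b] -> 0 < l -> 0 <= K ->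
  g t0 = 0 -> (forall t, t \in `[a, b] -> has_deriv `[a, b] g t (f t)) ->
  (forall t, t \in `[a, b] -> `|f t| <= K * l * (expR (l * (t - t0)) + expR (- l * (t - t0)))) ->
  forall t, t \in `[a, b] -> `|g t| <= K * (expR (l * (t - t0)) + expR (- l * (t - t0))).
Proof.
move=> ab t0ab l0 K0 g0 Hg Hf t tab; have J_nd := nondegenerate_seg ab.
pose sh s := K * (expR (l * (s - t0)) - expR (- l * (s - t0))).
have sh0 : sh t0 = 0 by rewrite /sh subrr !mulr0 expR0 subrr mulr0.
have Dsh s : s \in `[a, b] ->
    has_deriv `[a, b] sh s (K * l * (expR (l * (s - t0)) + expR (- l * (s - t0)))).
  move=> sab; apply: is_derive_has_deriv => //.
  rewrite (_ : K * l * _ = K * (l * expR (l * (s - t0)) - - l * expR (- l * (s - t0)))); last by ring.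
  have D c : is_derive s 1 (fun s => expR (c * (s - t0))) (c * expR (c * (s - t0))).
    have -> : (fun s => expR (c * (s - t0))) = expR \o (fun s => c * (s - t0)) by [].
    apply: is_derive_eq; rewrite /GRing.scale /=; ring.
  have := is_deriveZ K (is_deriveB (D l) (D (- l))).
  by [].
have pos s : 0 < expR (s : R) by exact: expR_gt0.
have mono u v : u \in `[a, b] -> v \in `[a, b] -> u < v -> `|g v - g u| <= sh v - sh u.
  move=> uab vab uv; rewrite ler_norml.
  have [c /andP[uc cv] E1] := MVT_on J_nd uab vab uv (fun x xab => has_derivD J_nd xab (Dsh x xab) (Hg x xab)).
  have [c' /andP[uc' cv'] E2] := MVT_on J_nd uab vab uv (fun x xab => has_derivB J_nd xab (Dsh x xab) (Hg x xab)).
  have cab x : u < x -> x < v -> x \in `[a, b].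
    by move: uab vab; rewrite !in_itv /= => /andP[? ?] /andP[? ?] ? ?; apply/andP; split; lra.
  have := Hf c (cab _ uc cv); rewrite ler_norml => /andP[h1 _].
  have := Hf c' (cab _ uc' cv'); rewrite ler_norml => /andP[_ h2].
  have p1 : 0 <= (K * l * (expR (l * (c - t0)) + expR (- l * (c - t0))) + f c) * (v - u).
    by apply: mulr_ge0; [lra | rewrite subr_ge0 ltW].
  have p2 : 0 <= (K * l * (expR (l * (c' - t0)) + expR (- l * (c' - t0))) - f c') * (v - u).
    by apply: mulr_ge0; [lra | rewrite subr_ge0 ltW].
  by apply/andP; split; lra.
have : `|g t| <= `|sh t|.
  case: (ltgtP t t0) => [tt0|t0t|->]; last by rewrite g0 normr0.
  - have := mono _ _ tab t0ab tt0; rewrite g0 sh0 !sub0r !normrN => H.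
    by rewrite (le_trans H) // -normrN ler_norm.
  - have := mono _ _ t0ab tab t0t; rewrite g0 sh0 !subr0 => H.
    by rewrite (le_trans H) // ler_norm.
move=> /le_trans; apply; rewrite /sh normrM ger0_norm // ler_wpM2l //.
have := pos (l * (t - t0)); have := pos (- l * (t - t0)).
by move=> ? ?; rewrite ler_norml; apply/andP; split; lra.
Qed.

(** The explicit rate makes this pointwise statement uniform wherever [B] is uniform, so no function
    space is needed. *)
Lemma geometric_tail (u : nat -> R) (B : R) : (forall l, `|u l| <= B / 2 ^+ l) ->
  exists x, forall k, `|x - \sum_(l < k) u l| <= 2 * B / 2 ^+ k.
Proof.
move=> H; pose S k := \sum_(l < k) u l.
have tail k m : `|S (k + m)%N - S k| <= 2 * B / 2 ^+ k - 2 * B / 2 ^+ (k + m).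
  elim: m => [|m IHm]; first by rewrite addn0 !subrr normr0.
  have SS : S (k + m.+1)%N = S (k + m)%N + u (k + m)%N by rewrite addnS /S big_ord_recr.
  rewrite SS addrAC (le_trans (ler_normD _ _)) //.
  have := H (k + m)%N; move: IHm; rewrite addnS exprS invfM.
  move: (2 ^+ (k + m))^-1 => z; lra.
have B0 : 0 <= B by have := le_trans (normr_ge0 _) (H 0%N); rewrite expr0 divr1.
have c : cvgn S.
  have -> : S = series u by apply/funext => k; rewrite /S /series /= big_mkord.
  apply: normed_cvg; apply: (@series_le_cvg _ _ (geometric B 2^-1)).
  - by move=> n; exact: normr_ge0.
  - by move=> n; rewrite /geometric /= mulr_ge0 // exprn_ge0 // invr_ge0.
  - by move=> n; rewrite /geometric /= exprVn; exact: H.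
  - by apply: is_cvg_geometric_series; rewrite ger0_norm ?invr_ge0 // invf_lt1 // ltr1n.
exists (lim (S @ \oo)) => k.
have ck : (fun n => `|S n - S k|) @ \oo --> `|lim (S @ \oo) - S k|.
  by apply: cvg_norm; apply: cvgB => //; exact: cvg_cst.
rewrite -(cvg_lim _ ck) //; apply: limr_le; first exact: (cvgP _ ck).
exists k => // n /= kn; have := tail k (n - k)%N; rewrite subnKC // => /le_trans; apply.
by rewrite lerBlDr lerDl !mulr_ge0 // invr_ge0 exprn_ge0.
Qed.

Lemma geometric_eq0 (x B : R) : (forall k, `|x| <= B / 2 ^+ k) -> x = 0.
Proof.
move=> H; apply/eqP; rewrite -normr_eq0; apply/eqP/le_anti; rewrite normr_ge0 andbT.
have ck : (fun k => B * (2^-1 : R) ^+ k) @ \oo --> 0.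
  by apply: cvg_geometric; rewrite ger0_norm ?invr_ge0 // invf_lt1 // ltr1n.
rewrite -(cvg_lim _ ck) //; apply: limr_ge; first exact: (cvgP _ ck).
by near=> k; rewrite exprVn; exact: H.
Unshelve. all: by end_near. Qed.

End LinearODE.

Section LinearODEExistence.
Context {R : realType} (I : interval R) (I_nd : nondegenerate_itv I).
Variables (n : nat) (A : 'I_n -> 'I_n -> R -> R) (t0 : R) (x0 : 'I_n -> R).
Hypotheses (t0I : t0 \in I) (A_smooth : forall i j, smoothf I (A i j)).

(* Picard iteration [u (k+1) = int (A u k)]; on a segment where [|A| <= M] the
   weight [cosh (l (t - t0))] with [l = 2 n M + 1] makes each step contract by
   the factor 1/2, so [\sum_k u k] converges geometrically. *)
Lemma linear_ode_continuous : exists x : 'I_n -> R -> R,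
  (forall i, x i t0 = x0 i) /\
  (forall i t, t \in I -> has_deriv I (x i) t (\sum_j A i j t * x j t)).
Proof.
have cA i j t : t \in I -> continuous_on I (A i j) t.
  by move=> tI; exact: (has_deriv_continuous I_nd tI (smoothf_has_deriv (@A_smooth i j) tI)).
(* [prim] is total, with an irrelevant value on discontinuous functions, so that the Picard iterates
   are a plain [iter]. *)
have /choice[prim Hprim] : forall f : R -> R, exists G,
    (forall t, t \in I -> continuous_on I f t) ->
    G t0 = 0 /\ forall t, t \in I -> has_deriv I G t (f t).
  move=> f; have [cf|ncf] := pselect (forall t, t \in I -> continuous_on I f t).
    by have [G HG] := antiderivative I_nd t0I cf; exists G.
  by exists f => /ncf.
pose Af (x : 'I_n -> R -> R) i t := \sum_j A i j t * x j t.
have cAf x i : (forall j t, t \in I -> continuous_on I (x j) t) ->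
    forall t, t \in I -> continuous_on I (Af x i) t.
  move=> cx t tI; apply: continuous_on_sum => j.
  by apply: continuous_onM; [exact: cA | exact: cx].
pose u k := iter k (fun x i => prim (Af x i)) (fun i (_ : R) => x0 i).
have cu k j t : t \in I -> continuous_on I (u k j) t.
  elim: k j t => [|k IHk] j t tI; first exact: continuous_on_cst.
  by have [_ /(_ t tI) H] := Hprim _ (cAf _ j IHk); exact: has_deriv_continuous H.
have uS k j : u k.+1 j t0 = 0 /\ forall t, t \in I -> has_deriv I (u k.+1 j) t (Af (u k) j t).
  by have := Hprim _ (cAf _ j (cu k)).
have bd a b : a < b -> (forall x, x \in `[a, b] -> x \in I) -> t0 \in `[a, b] ->
    exists B, exists2 M, 0 <= M & [/\ forall i j t, t \in `[a, b] -> `|A i j t| <= M &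
      forall k i t, t \in `[a, b] -> `|u k i t| <= B / 2 ^+ k].
  move=> ab sub t0ab.
  have [M M0 HM] : exists2 M, 0 <= M & forall i j t, t \in `[a, b] -> `|A i j t| <= M.
    have /choice[M HM] : forall ij : 'I_n * 'I_n, exists M,
        0 < M /\ forall t, t \in `[a, b] -> `|A ij.1 ij.2 t| <= M.
      move=> [i j]; have [M M0 HM] := bounded_on ab sub (cA i j).
      by exists M.
    exists (\sum_ij M ij); first by apply: sumr_ge0 => ij _; have [/ltW] := HM ij.
    move=> i j t tab; rewrite (bigD1 (i, j)) //=; have [_ /(_ t tab) H] := HM (i, j).
    by rewrite (le_trans H) // lerDl sumr_ge0 // => ij _; have [/ltW] := HM ij.
  pose l := 2 * n%:R * M + 1.
  have l0 : 0 < l by rewrite ltr_wpDl // !mulr_ge0.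
  pose ch t := expR (l * (t - t0)) + expR (- l * (t - t0)).
  have ch0 t : 0 < ch t by rewrite addr_gt0 // expR_gt0.
  pose C := \sum_i `|x0 i|.
  have C0 : 0 <= C by rewrite sumr_ge0.
  have J_nd := nondegenerate_seg ab.
  have Hu k i t : t \in `[a, b] -> `|u k i t| <= C / 2 ^+ k * ch t.
    elim: k i t => [|k IHk] i t tab.
      rewrite expr0 divr1 (@le_trans _ _ C) //.
        by rewrite /C (bigD1 i) //= lerDl sumr_ge0.
      rewrite ler_peMr //; have := expR_gt0 (l * (t - t0)).
      have := expR_gt0 (- l * (t - t0)).
      rewrite /ch; case: (lerP 0 (l * (t - t0))) => h.
        by have := expR_ge1Dx (l * (t - t0)); lra.
      by have := expR_ge1Dx (- l * (t - t0)); lra.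
    have [ui0 Hi] := uS k i.
    apply: (@cosh_comparison R (Af (u k) i) (u k.+1 i) a b t0) => //.
    - by rewrite mulr_ge0 // invr_ge0 exprn_ge0.
    - by move=> s sab; apply: (has_deriv_subset I_nd) => //; apply: Hi; exact: sub.
    move=> s sab; rewrite /Af (le_trans (ler_norm_sum _ _ _)) //.
    apply: (@le_trans _ _ (\sum_(j < n) M * (C / 2 ^+ k * ch s))).
      by apply: ler_sum => j _; rewrite normrM ler_pM // ?HM ?IHk.
    rewrite sumr_const card_ord -[_ *+ n]mulr_natl exprS invfM.
    have p0 : 0 <= C / 2 ^+ k * ch s.
      by rewrite !mulr_ge0 // ?invr_ge0 ?exprn_ge0 // ltW.
    rewrite (_ : C * (2^-1 / 2 ^+ k) * l * _ = (C / 2 ^+ k * ch s) * (l / 2)); last first.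
      by rewrite /ch; ring.
    rewrite (_ : n%:R * _ = (C / 2 ^+ k * ch s) * (n%:R * M)); last by ring.
    by rewrite ler_wpM2l // /l; lra.
  have cch t : t \in `[a, b] -> continuous_on `[a, b] ch t.
    move=> tab.
    have D c : is_derive t 1 (fun s => expR (c * (s - t0))) (c * expR (c * (t - t0))).
      have -> : (fun s => expR (c * (s - t0))) = expR \o (fun s => c * (s - t0)) by [].
      by apply: is_derive_eq; rewrite /GRing.scale /=; ring.
    exact: (has_deriv_continuous J_nd tab (is_derive_has_deriv J_nd tab (is_deriveD (D l) (D (- l))))).
  have [B B0 HB] := bounded_on ab (fun x xab => xab) cch.
  exists (C * B), M => //; split=> // k i t tab; rewrite (le_trans (Hu k i t tab)) //.
  rewrite mulrAC ler_wpM2r ?invr_ge0 ?exprn_ge0 // ler_wpM2l //.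
  by rewrite (le_trans (ler_norm _)) // HB.
pose S k i t := \sum_(l < k) u l i t.
(* The limit is chosen point by point, with a constant [B] depending on the point; by uniqueness of
   limits [tail] replaces it by a constant valid on a whole segment. *)
have /choice[x' Hx'] : forall it : 'I_n * R, exists z, it.2 \in I ->
    exists B, forall k, `|z - S k it.1 it.2| <= 2 * B / 2 ^+ k.
  move=> [i t] /=; have [tI|] := pselect (t \in I); last by exists 0.
  have [a [b [d [ab sub t0ab tab _]]]] := itv_cover I_nd t0I tI.
  have [B [M M0 [HM Hu]]] := bd a b ab sub t0ab.
  by have [z Hz] := geometric_tail (fun l => Hu l i t tab); exists z => _; exists B.
pose x i t := x' (i, t).
have tail a b : a < b -> (forall x, x \in `[a, b] -> x \in I) -> t0 \in `[a, b] ->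
    exists B, exists2 M, 0 <= M & (forall i j t, t \in `[a, b] -> `|A i j t| <= M) /\
      forall k i t, t \in `[a, b] -> `|x i t - S k i t| <= 2 * B / 2 ^+ k.
  move=> ab sub t0ab; have [B [M M0 [HM Hu]]] := bd a b ab sub t0ab.
  exists B, M => //; split=> // k i t tab.
  have [z Hz] := geometric_tail (fun l => Hu l i t tab).
  have [B' HB'] := Hx' (i, t) (sub _ tab).
  suff -> : x i t = z by exact: Hz.
  apply/eqP; rewrite -subr_eq0; apply/eqP/(@geometric_eq0 _ _ (2 * B + 2 * B')) => j.
  rewrite (_ : x i t - z = (x i t - S j i t) - (z - S j i t)); last by ring.
  rewrite (le_trans (ler_normB _ _)) // addrC mulrDl lerD //; exact: Hz.
have cS k i t : t \in I -> continuous_on I (S k i) t.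
  by move=> tI; apply: continuous_on_sum => j; exact: cu.
have cx i t : t \in I -> continuous_on I (x i) t.
  move=> tI e e0; have [a [b [d [ab sub t0ab tab [d0 Hd]]]]] := itv_cover I_nd t0I tI.
  have [B [M M0 [_ HB]]] := tail a b ab sub t0ab.
  have [k Hk] : exists k, 2 * B / 2 ^+ k <= e / 3.
    apply: contrapT => /forallNP H; have e3 : 0 < e / 3 by rewrite divr_gt0.
    have := lt0r_neq0 e3; rewrite (@geometric_eq0 _ (e / 3) (2 * B)) ?eqxx // => k.
    by rewrite gtr0_norm // ltW // ltNge; apply/negP/H.
  have e3 : 0 < e / 3 by rewrite divr_gt0.
  have [d' d'0 Hd'] := cS k i t tI _ e3.
  exists (Num.min d d'); first by rewrite lt_min d0.
  move=> s sI; rewrite lt_min => /andP[/Hd -/(_ sI) sab /Hd' -/(_ sI) Ss].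
  have h1 := le_trans (HB k i t tab) Hk; have h2 := le_trans (HB k i s sab) Hk.
  rewrite (_ : x i s - x i t = (x i s - S k i s) + (S k i s - S k i t) - (x i t - S k i t)); last by ring.
  rewrite (le_trans (ler_normB _ _)) // (le_trans (lerD (ler_normD _ _) (lexx _))) //; lra.
(* [y] is differentiable by construction. It agrees with [x] because the derivative of [S k.+1] is
   [Af (S k)], so that these partial sums converge to both. *)
pose y i t := x0 i + prim (Af x i) t.
have yP i : y i t0 = x0 i /\ forall t, t \in I -> has_deriv I (y i) t (Af x i t).
  have [p0 pP] := Hprim _ (cAf _ i cx); split=> [|t tI]; first by rewrite /y p0 addr0.
  rewrite -[Af x i t]add0r; apply: has_derivD => //; [exact: has_deriv_cst | exact: pP].
have yx i t : t \in I -> y i t = x i t.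
  move=> tI; have [a [b [d [ab sub t0ab tab _]]]] := itv_cover I_nd t0I tI.
  have [B [M M0 [HM HB]]] := tail a b ab sub t0ab.
  apply/eqP; rewrite -subr_eq0; apply/eqP.
  apply: (@geometric_eq0 _ _ (n%:R * M * (2 * B) * `|t - t0| + 2 * B)) => k.
  have B0 : 0 <= 2 * B / 2 ^+ k by rewrite (le_trans (normr_ge0 _) (HB k i t tab)).
  have DS s : s \in I -> has_deriv I (S k.+1 i) s (Af (S k) i s).
    move=> sI; rewrite (_ : Af (S k) i s = 0 + \sum_(l < k) Af (u l) i s).
      apply: (@has_deriv_eq _ _ (fun s => x0 i + \sum_(l < k) u l.+1 i s)) => //.
        by move=> v _; rewrite /S big_ord_recl.
      apply: has_derivD => //; first exact: has_deriv_cst.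
      by apply: has_deriv_sum => // l; have [_] := uS l i; exact.
    rewrite add0r /Af exchange_big /=; apply: eq_bigr => j _; by rewrite mulr_sumr.
  have S0 : S k.+1 i t0 = x0 i.
    by rewrite /S big_ord_recl /= big1 ?addr0 // => l _; have [] := uS l i.
  have key : `|y i t - S k.+1 i t| <= n%:R * M * (2 * B / 2 ^+ k) * `|t - t0|.
    have DD s : s \in I -> has_deriv I (fun s => y i s - S k.+1 i s) s (Af x i s - Af (S k) i s).
      by move=> sI; apply: has_derivB => //; [apply: (yP i).2 | exact: DS].
    have b' s : s \in `[a, b] -> `|Af x i s - Af (S k) i s| <= n%:R * M * (2 * B / 2 ^+ k).
      move=> sab; rewrite /Af -sumrB (le_trans (ler_norm_sum _ _ _)) //.
      rewrite -mulrA mulr_natl -[X in _ *+ X]card_ord -sumr_const; apply: ler_sum => j _.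
      by rewrite -mulrBr normrM ler_pM // ?HM ?HB.
    have abP s v c : s \in `[a, b] -> v \in `[a, b] -> s < c < v -> c \in `[a, b].
      rewrite !in_itv /= => /andP[? ?] /andP[? ?] /andP[? ?]; apply/andP; split; lra.
    have z0 : y i t0 - S k.+1 i t0 = 0 by rewrite (yP i).1 S0 subrr.
    case: (ltgtP t t0) => [tt0|t0t|->]; last by rewrite z0 subrr !normr0 mulr0.
      have [c cP E] := MVT_on I_nd tI t0I tt0 DD; rewrite z0 sub0r in E.
      by rewrite -normrN E normrM [`|t0 - t|]distrC ler_wpM2r // b' // (abP t t0).
    have [c cP E] := MVT_on I_nd t0I tI t0t DD; rewrite z0 subr0 in E.
    by rewrite E normrM ler_wpM2r // b' // (abP t0 t).
  rewrite (_ : y i t - x i t = (y i t - S k.+1 i t) - (x i t - S k.+1 i t)); last by ring.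
  rewrite (le_trans (ler_normB _ _)) // mulrDl; apply: lerD.
    by apply: le_trans key _; rewrite le_eqVlt; apply/orP; left; apply/eqP; ring.
  apply: le_trans (HB k.+1 i t tab) _; rewrite exprS invfM.
  move: B0; move: (2 ^+ k)^-1 => z ?; lra.
exists y; split=> [i|i t tI]; first exact: (yP i).1.
have := (yP i).2 t tI; rewrite /Af; congr (has_deriv _ _ _ _).
by apply: eq_bigr => j _; rewrite yx.
Qed.

(** Bootstrap: if all components are of class [k], the right-hand side is too, so they are of class
    [k.+1]. *)
Theorem linear_ode : exists x : 'I_n -> R -> R, [/\ forall i, x i t0 = x0 i,
  forall i, smoothf I (x i) &
  forall i t, t \in I -> has_deriv I (x i) t (\sum_j A i j t * x j t)].
Proof.
have [x [xt0 Dx]] := linear_ode_continuous; exists x; split=> // i; apply/smoothfP => k.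
elim: k i => [//|k IHk] i.
apply: (class_C_has_deriv I_nd (g := fun t => \sum_j A i j t * x j t)); first exact: Dx.
have : forall j, class_C I k (fun t => A i j t * x j t).
  by move=> j; apply: class_CM => //; have /smoothfP := @A_smooth i j; apply.
move: (index_enum _) => r H; elim: r => [|a r IHr].
  by apply: (@class_C_eq _ _ _ (fun=> 0)); [move=> s _; rewrite big_nil | exact: class_C_cst].
apply: (@class_C_eq _ _ _ (fun t => A i a t * x a t + \sum_(j <- r) A i j t * x j t)).
  by move=> s _; rewrite big_cons.
exact: class_CD.
Qed.

End LinearODEExistence.

(** * Vector-valued curves *)

Section VectorCalculus.
Context {R : realType} {W : vectType R} (I : interval R).
Hypothesis I_nd : nondegenerate_itv I.
Implicit Types (x y : R -> W) (f : R -> R) (t : R).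

Lemma iter_vcoord n x (i : 'I_(\dim {:W})) :
  (fun s => vcoord i (iter n (vderive I) x s)) =
  iter n (derive_within I) (fun s => vcoord i (x s)).
Proof.
elim: n => [//|n IHn]; apply/funext => s /=.
by rewrite vcoord_vderive IHn.
Qed.

Lemma vsmoothP x : vsmooth I x <-> forall i, smoothf I (fun s => vcoord i (x s)).
Proof.
split=> [H i n t tI|H n i t tI]; first by rewrite -iter_vcoord; exact: H.
by rewrite iter_vcoord; exact: H.
Qed.

Lemma iter_vderive_eq x y n : {in I, x =1 y} ->
  {in I, iter n (vderive I) x =1 iter n (vderive I) y}.
Proof. by move=> xy; elim: n => [//|n IHn] t tI /=; exact: eq_vderive. Qed.

Lemma vsmooth_eq x y : {in I, x =1 y} -> vsmooth I x -> vsmooth I y.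
Proof.
move=> xy /vsmoothP H; apply/vsmoothP => i.
by apply: (smoothf_eq _ (H i)) => s sI; rewrite xy.
Qed.

Lemma vsmooth_iter n x : vsmooth I x -> vsmooth I (iter n (vderive I) x).
Proof. by move=> H k i t tI; rewrite -iterD; exact: H. Qed.

Lemma vsmooth_derive x : vsmooth I x -> vsmooth I (vderive I x).
Proof. exact: (@vsmooth_iter 1). Qed.

Lemma vsmooth_cst (w : W) : vsmooth I (fun=> w).
Proof. by apply/vsmoothP => i; exact: smoothf_cst. Qed.

Lemma vcoordZ i a (w : W) : vcoord i (a *: w) = a * vcoord i w.
Proof. by rewrite /vcoord linearZ. Qed.

Lemma vcoordD i (v w : W) : vcoord i (v + w) = vcoord i v + vcoord i w.
Proof. by rewrite /vcoord linearD. Qed.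

Lemma vcoord_sum i (J : Type) (r : seq J) (P : pred J) (w : J -> W) :
  vcoord i (\sum_(j <- r | P j) w j) = \sum_(j <- r | P j) vcoord i (w j).
Proof. by rewrite /vcoord linear_sum. Qed.

Lemma vsmoothZ f x : smoothf I f -> vsmooth I x -> vsmooth I (fun s => f s *: x s).
Proof.
move=> Hf /vsmoothP Hx; apply/vsmoothP => i.
apply: (@smoothf_eq _ _ (fun s => f s * vcoord i (x s))).
  by move=> s _; rewrite vcoordZ.
exact: smoothfM.
Qed.

Lemma vsmoothD x y : vsmooth I x -> vsmooth I y -> vsmooth I (fun s => x s + y s).
Proof.
move=> /vsmoothP Hx /vsmoothP Hy; apply/vsmoothP => i.
apply: (@smoothf_eq _ _ (fun s => vcoord i (x s) + vcoord i (y s))).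
  by move=> s _; rewrite vcoordD.
exact: smoothfD.
Qed.

Lemma vsmoothN x : vsmooth I x -> vsmooth I (fun s => - x s).
Proof.
move=> Hx; apply: (@vsmooth_eq (fun s => (-1) *: x s)).
  by move=> s _; rewrite scaleN1r.
by apply: vsmoothZ => //; exact: smoothf_cst.
Qed.

Lemma vsmooth_sum (J : Type) (r : seq J) (P : pred J) (x : J -> R -> W) :
  (forall j, P j -> vsmooth I (x j)) -> vsmooth I (fun s => \sum_(j <- r | P j) x j s).
Proof.
move=> H; elim: r => [|a r IHr].
  by apply: (vsmooth_eq _ (@vsmooth_cst 0)) => s _; rewrite big_nil.
case Pa: (P a); last by apply: (vsmooth_eq _ IHr) => s _; rewrite big_cons Pa.
by apply: (vsmooth_eq _ (vsmoothD (H _ Pa) IHr)) => s _; rewrite big_cons Pa.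
Qed.

Lemma vsmooth_has_deriv x t i : vsmooth I x -> t \in I ->
  has_deriv I (fun s => vcoord i (x s)) t (vcoord i (vderive I x t)).
Proof. by move=> H tI; rewrite vcoord_vderive; exact: (H 0%N). Qed.

Lemma vderive_has_deriv x t (w : W) : t \in I ->
  (forall i, has_deriv I (fun s => vcoord i (x s)) t (vcoord i w)) -> vderive I x t = w.
Proof.
by move=> tI H; apply: vcoordP => i; rewrite vcoord_vderive; apply: has_derivE.
Qed.

Lemma vderiveZ f x t : t \in I -> smoothf I f -> vsmooth I x ->
  vderive I (fun s => f s *: x s) t = derive_within I f t *: x t + f t *: vderive I x t.
Proof.
move=> tI Hf Hx; apply: vderive_has_deriv => // i.
rewrite vcoordD !vcoordZ.
apply: (@has_deriv_eq _ _ (fun s => f s * vcoord i (x s))) => //.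
  by move=> s _; rewrite vcoordZ.
by apply: has_derivM => //; [exact: smoothf_has_deriv | exact: vsmooth_has_deriv].
Qed.

Lemma vderiveD x y t : t \in I -> vsmooth I x -> vsmooth I y ->
  vderive I (fun s => x s + y s) t = vderive I x t + vderive I y t.
Proof.
move=> tI Hx Hy; apply: vderive_has_deriv => // i; rewrite vcoordD.
apply: (@has_deriv_eq _ _ (fun s => vcoord i (x s) + vcoord i (y s))) => //.
  by move=> s _; rewrite vcoordD.
by apply: has_derivD => //; exact: vsmooth_has_deriv.
Qed.

Lemma vderiveN x t : t \in I -> vsmooth I x ->
  vderive I (fun s => - x s) t = - vderive I x t.
Proof.
move=> tI Hx; apply: vderive_has_deriv => // i.
rewrite -scaleN1r vcoordZ mulN1r.
apply: (@has_deriv_eq _ _ (fun s => - vcoord i (x s))) => //.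
  by move=> s _; rewrite -[in RHS]scaleN1r vcoordZ mulN1r.
by apply: has_derivN => //; exact: vsmooth_has_deriv.
Qed.

Lemma vderive_cst (w : W) t : t \in I -> vderive I (fun=> w) t = 0.
Proof.
move=> tI; apply: vderive_has_deriv => // i; rewrite /vcoord linear0.
exact: has_deriv_cst.
Qed.

Lemma vderive_sum (J : Type) (r : seq J) (P : pred J) (x : J -> R -> W) t : t \in I ->
  (forall j, P j -> vsmooth I (x j)) ->
  vderive I (fun s => \sum_(j <- r | P j) x j s) t = \sum_(j <- r | P j) vderive I (x j) t.
Proof.
move=> tI H; elim: r => [|a r IHr].
  rewrite big_nil -[RHS](vderive_cst 0 tI); apply: eq_vderive => // s sI.
  by rewrite big_nil.
rewrite big_cons; case Pa: (P a).
  rewrite -IHr -vderiveD //; [|exact: H|exact: vsmooth_sum].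
  by apply: eq_vderive => // s _; rewrite big_cons Pa.
by rewrite -IHr; apply: eq_vderive => // s _; rewrite big_cons Pa.
Qed.

Lemma iter_vderive_sum (J : finType) (P : pred J) (c : J -> R) (x : J -> R -> W) n :
  (forall j, P j -> vsmooth I (x j)) ->
  {in I, iter n (vderive I) (fun s => \sum_(j | P j) c j *: x j s)
    =1 fun s => \sum_(j | P j) c j *: iter n (vderive I) (x j) s}.
Proof.
move=> H; elim: n => [//|n IHn] t tI /=.
rewrite (eq_vderive IHn tI) vderive_sum //.
  apply: eq_bigr => j Pj; rewrite vderiveZ //; last exact/vsmooth_iter/H.
    by rewrite (has_derivE I_nd tI (has_deriv_cst I_nd (c j) tI)) scale0r add0r.
  exact: smoothf_cst.
by move=> j Pj; apply: vsmoothZ; [exact: smoothf_cst | exact/vsmooth_iter/H].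
Qed.

Lemma iter_vderiveB x y n : vsmooth I x -> vsmooth I y ->
  {in I, iter n (vderive I) (fun s => x s - y s)
    =1 fun s => iter n (vderive I) x s - iter n (vderive I) y s}.
Proof.
move=> Hx Hy; elim: n => [//|n IHn] t tI /=.
have Hx' := @vsmooth_iter n _ Hx; have Hy' := @vsmooth_iter n _ Hy.
by rewrite (eq_vderive IHn tI) (vderiveD tI Hx' (vsmoothN Hy')) vderiveN.
Qed.

Variable omega : {skew_symmetric W}.

Lemma omegaC (v w : W) : omega v w = - omega w v.
Proof. by rewrite hermC /= expr1 mulN1r. Qed.

Lemma omega_coord (v w : W) : omega v w =
  \sum_i \sum_j vcoord i v * vcoord j w * omega (vbasis {:W})`_i (vbasis {:W})`_j.
Proof.
rewrite {1}(coord_vbasis (memvf v)) linear_sumlz; apply: eq_bigr => i _.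
rewrite linearZl_LR /= {1}(coord_vbasis (memvf w)) linear_sumr mulr_sumr.
by apply: eq_bigr => j _; rewrite linearZr_LR /= mulrA.
Qed.

Lemma smoothf_omega x y : vsmooth I x -> vsmooth I y -> smoothf I (fun s => omega (x s) (y s)).
Proof.
move=> /vsmoothP Hx /vsmoothP Hy.
apply: (@smoothf_eq _ _ (fun s => \sum_i \sum_j vcoord i (x s) * vcoord j (y s) *
  omega (vbasis {:W})`_i (vbasis {:W})`_j)).
  by move=> s _; rewrite [RHS]omega_coord.
apply: smoothf_sum => // i _; apply: smoothf_sum => // j _; apply: smoothfM => //.
  by apply: smoothfM.
exact: smoothf_cst.
Qed.

Lemma has_deriv_omega x y t : t \in I -> vsmooth I x -> vsmooth I y ->
  has_deriv I (fun s => omega (x s) (y s)) t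
    (omega (vderive I x t) (y t) + omega (x t) (vderive I y t)).
Proof.
move=> tI Hx Hy; rewrite !omega_coord.
apply: (@has_deriv_eq _ _ (fun s => \sum_i \sum_j vcoord i (x s) * vcoord j (y s) *
  omega (vbasis {:W})`_i (vbasis {:W})`_j)) => //.
  by move=> s _; rewrite [RHS]omega_coord.
rewrite -big_split /=; apply: has_deriv_sum => // i.
rewrite -big_split /=; apply: has_deriv_sum => // j.
rewrite -mulrDl; set c := omega _ _.
have H := has_derivM I_nd tI (@vsmooth_has_deriv x t i Hx tI) (@vsmooth_has_deriv y t j Hy tI).
by have := has_derivM I_nd tI H (has_deriv_cst I_nd c tI); rewrite mulr0 addr0.
Qed.

Section Shift.
Variables (x y : R -> W) (n : nat).
Hypotheses (Hx : vsmooth I x) (Hy : vsmooth I y).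
Hypothesis low : forall b t, (b < n)%N -> t \in I -> omega (x t) (iter b (vderive I) y t) = 0.

(** Differentiating a pairing that vanishes identically moves one derivative from [y] to [x], so it
    is enough to know the pairings with [x] undifferentiated. *)
Lemma pairing_low a b t : (a + b < n)%N -> t \in I ->
  omega (iter a (vderive I) x t) (iter b (vderive I) y t) = 0.
Proof.
elim: a b t => [|a IHa] b t; first exact: low.
rewrite addSn => lt tI.
have H := has_deriv_omega tI (@vsmooth_iter a _ Hx) (@vsmooth_iter b _ Hy).
have /(has_derivE I_nd tI) := H.
rewrite -[X in _ + X]/(omega _ (iter b.+1 (vderive I) y t)) [X in _ + X]IHa ?addnS // addr0 => <-.
apply: has_derivE => //; apply: (has_deriv_eq _ _ (has_deriv_cst I_nd 0 tI)) => // s sI.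
by rewrite IHa // ltnW.
Qed.

(** At the first order [n] that may be nonzero, the pairings of order [n - 1] still have zero
    derivative, and each move costs only a sign. *)
Lemma pairing_shift a b t : (a + b)%N = n -> t \in I ->
  omega (iter a (vderive I) x t) (iter b (vderive I) y t) =
  (-1) ^+ a * omega (x t) (iter n (vderive I) y t).
Proof.
elim: a b t => [|a IHa] b t; first by rewrite add0n expr0 mul1r => ->.
rewrite addSn => E tI; have := has_deriv_omega tI (@vsmooth_iter a _ Hx) (@vsmooth_iter b _ Hy).
move=> /(has_derivE I_nd tI); rewrite -[X in _ + X]/(omega _ (iter b.+1 (vderive I) y t)).
rewrite IHa ?addnS // (@has_derivE _ _ I_nd _ _ 0) // => [/eqP|].
  by rewrite eq_sym addr_eq0 exprS mulN1r mulNr => /eqP.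
apply: (has_deriv_eq _ _ (has_deriv_cst I_nd 0 tI)) => // s sI.
by rewrite pairing_low // -E.
Qed.

(** One order higher, each move also costs the derivative of the pairing of order [n], and [a] moves
    cost it [a] times. For even [n.+1 = a] this expresses that derivative by the two extreme
    pairings of order [n.+1]. *)
Lemma pairing_shift2 a b t : (a + b)%N = n.+1 -> t \in I ->
  omega (iter a (vderive I) x t) (iter b (vderive I) y t) =
  (-1) ^+ a * (omega (x t) (iter n.+1 (vderive I) y t) -
    a%:R * derive_within I (fun s => omega (x s) (iter n (vderive I) y s)) t).
Proof.
elim: a b t => [|a IHa] b t; first by rewrite add0n expr0 mul1r mul0r subr0 => ->.
rewrite addSn => -[E] tI; have := has_deriv_omega tI (@vsmooth_iter a _ Hx) (@vsmooth_iter b _ Hy).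
move=> /(has_derivE I_nd tI); rewrite -[X in _ + X]/(omega _ (iter b.+1 (vderive I) y t)).
rewrite IHa ?addnS ?E //.
set g := fun s => omega (x s) (iter n (vderive I) y s).
have Dg : has_deriv I g t (derive_within I g t).
  by apply: smoothf_has_deriv => //; apply: smoothf_omega => //; exact: vsmooth_iter.
rewrite (@has_derivE _ _ I_nd _ _ ((-1) ^+ a * derive_within I g t)) //.
  by rewrite exprS -natr1; move: ((-1) ^+ a) => z; lra.
have := has_derivM I_nd tI (has_deriv_cst I_nd ((-1) ^+ a) tI) Dg.
rewrite mul0r add0r; apply: has_deriv_eq => // s sI.
by rewrite (pairing_shift E).
Qed.

End Shift.
End VectorCalculus.

Section LinearODEUniqueness.
Context {R : realType} (I : interval R) (I_nd : nondegenerate_itv I).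

(* The solutions of the adjoint equation [z' = - z A] pair with [x] to constants. *)
Lemma linear_ode_unique n (A : 'I_n -> 'I_n -> R -> R) (x : 'I_n -> R -> R) t0 t i :
  t0 \in I -> t \in I -> (forall i j, smoothf I (A i j)) ->
  (forall i t, t \in I -> has_deriv I (x i) t (\sum_j A i j t * x j t)) ->
  (forall i, x i t0 = 0) -> x i t = 0.
Proof.
move=> t0I tI HA Dx x0.
have HA' j k : smoothf I (fun s => - A k j s) by apply: smoothfN.
have [z [zt _ Dz]] := linear_ode I_nd (fun j => (j == i)%:R) tI HA'.
pose g s := \sum_j z j s * x j s.
have Dg s : s \in I -> has_deriv I g s 0.
  move=> sI; rewrite (_ : 0 = \sum_j ((\sum_k - A k j s * z k s) * x j s +
      z j s * (\sum_k A j k s * x k s))).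
    by apply: has_deriv_sum => // j; apply: has_derivM => //; [exact: Dz | exact: Dx].
  rewrite big_split /= (eq_bigr (fun j => \sum_k - (A k j s * z k s * x j s))); last first.
    by move=> j _; rewrite mulr_suml; apply: eq_bigr => k _; ring.
  rewrite exchange_big /= -big_split /= big1 // => k _.
  by rewrite mulr_sumr -big_split /= big1 // => j _; ring.
have := has_deriv0_cst I_nd tI t0I Dg; rewrite /g [RHS]big1; last first.
  by move=> j _; rewrite x0 mulr0.
rewrite (bigD1 i) //= zt eqxx mul1r big1 ?addr0 // => j ji.
by rewrite zt (negbTE ji) mul0r.
Qed.

Lemma has_deriv_mulmx n m p (A : R -> 'M[R]_(n, m)) (B : R -> 'M[R]_(m, p))
    (A' : 'M[R]_(n, m)) (B' : 'M[R]_(m, p)) t :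
  t \in I -> (forall i j, has_deriv I (fun s => A s i j) t (A' i j)) ->
  (forall i j, has_deriv I (fun s => B s i j) t (B' i j)) ->
  forall i j, has_deriv I (fun s => (A s *m B s) i j) t ((A' *m B t + A t *m B') i j).
Proof.
move=> tI HA HB i j; rewrite !mxE -big_split /=.
apply: (@has_deriv_eq _ _ (fun s => \sum_k A s i k * B s k j)) => //.
  by move=> s _; rewrite mxE.
by apply: has_deriv_sum => // k; exact: has_derivM.
Qed.

End LinearODEUniqueness.

Arguments has_deriv_mulmx {R I} I_nd {n m p A B A' B' t} _ _ _ i j.

(** * Coordinates, Gram matrices and orthogonal projectors *)

Section Coordinates.
Context {R : realType} {W : vectType R}.
Local Notation N := (\dim {:W}).
Implicit Types (u v w : W) (U V : {vspace W}).

Definition rc v : 'rV[R]_N := \row_i vcoord i v.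
Definition vr (a : 'rV[R]_N) : W := \sum_i a 0 i *: (vbasis {:W})`_i.
(** Vectors are coordinate rows, so matrices act on the right. *)
Definition mact (M : 'M[R]_N) v : W := vr (rc v *m M).

Lemma vcoord_vr i a : vcoord i (vr a) = a 0 i.
Proof. by rewrite /vcoord /vr coord_sum_free // (basis_free (vbasisP _)). Qed.

Lemma rcK : cancel rc vr.
Proof. by move=> v; apply: vcoordP => i; rewrite vcoord_vr mxE. Qed.

Lemma vrK : cancel vr rc.
Proof. by move=> a; apply/rowP => i; rewrite mxE vcoord_vr. Qed.

Lemma rc_mact M v : rc (mact M v) = rc v *m M.
Proof. by rewrite /mact vrK. Qed.

Lemma rc_sum n (c : 'I_n -> R) (w : 'I_n -> W) :
  rc (\sum_i c i *: w i) = (\row_i c i) *m (\matrix_(i, j) vcoord j (w i)).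
Proof.
apply/rowP => j; rewrite !mxE vcoord_sum; apply: eq_bigr => i _.
by rewrite !mxE vcoordZ.
Qed.

Definition frame_mx n (w : 'I_n -> W) : 'M[R]_(n, N) := \matrix_(i, j) vcoord j (w i).

(** If [a] is killed by the Gram matrix, the combination with coefficients [a] has zero length.
    Freeness thus becomes the nonvanishing of a determinant that is smooth in the frame. *)
Lemma gram_unitP n (w : 'I_n -> W) :
  reflect (free [tuple w i | i < n]) (frame_mx w *m (frame_mx w)^T \in unitmx).
Proof.
apply: (iffP idP) => [U|F].
  apply/freeP => c; rewrite (eq_bigr (fun i => c i *: w i)); last first.
    by move=> i _; rewrite -tnth_nth tnth_mktuple.
  move=> c0 i; have : (\row_i c i) *m frame_mx w = 0.
    by rewrite -rc_sum c0; apply/rowP => j; rewrite !mxE /vcoord linear0.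
  move=> /(congr1 (mulmx^~ (frame_mx w)^T)); rewrite mul0mx -mulmxA.
  move=> /(congr1 (mulmx^~ (invmx (frame_mx w *m (frame_mx w)^T)))).
  by rewrite mul0mx mulmxK // => /rowP/(_ i); rewrite !mxE.
rewrite -row_free_unit; apply: inj_row_free => a Ea.
have : (a *m frame_mx w) *m (a *m frame_mx w)^T = 0.
  by rewrite trmx_mul mulmxA -(mulmxA a) Ea mul0mx.
move=> /matrixP/(_ 0 0); rewrite !mxE => /eqP.
rewrite psumr_eq0 => [/allP E|j _]; last by rewrite !mxE sqr_ge0.
have aw0 : a *m frame_mx w = 0.
  apply/rowP => j; have := E j; rewrite mem_index_enum => /(_ isT).
  by rewrite !mxE mulf_eq0 orbb => /eqP.
have /freeP/(_ (fun i => a 0 i)) := F; rewrite (eq_bigr (fun i => a 0 i *: w i)); last first.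
  by move=> i _; rewrite -tnth_nth tnth_mktuple.
move=> H; apply/rowP => i; rewrite mxE; apply: H; rewrite -[LHS]rcK rc_sum.
rewrite (_ : \row_i a 0 i = a); last by apply/rowP => k; rewrite mxE.
by rewrite -/(frame_mx w) aw0 /vr big1 // => k _; rewrite mxE scale0r.
Qed.

Definition orth_projector U (P : 'M[R]_N) :=
  [/\ P^T = P, forall v, mact P v \in U & forall v, v \in U -> mact P v = v].

Lemma row_rc_mx (P : 'M[R]_N) i : row i P = rc (mact P (vr (delta_mx 0 i))).
Proof. by rewrite rc_mact vrK -rowE. Qed.

(** The rows of [P] lie in [U], so [P *m Q = P], and likewise [Q *m P = Q]; transposing one of these
    equations gives the other product. *)
Lemma orth_projector_unique U P Q : orth_projector U P -> orth_projector U Q -> P = Q.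
Proof.
have half P' Q' : orth_projector U P' -> orth_projector U Q' -> P' *m Q' = P'.
  move=> [_ P1 _] [_ _ Q2]; apply/row_matrixP => i.
  by rewrite row_mul row_rc_mx -rc_mact Q2.
move=> HP HQ; have := half P Q HP HQ; have := half Q P HQ HP.
move: HP HQ => [PT _ _] [QT _ _] E1 E2.
by rewrite -E2 -[LHS]trmxK trmx_mul PT QT E1.
Qed.

Definition frame_projector n (w : 'I_n -> W) : 'M[R]_N :=
  (frame_mx w)^T *m invmx (frame_mx w *m (frame_mx w)^T) *m frame_mx w.

Lemma frame_projectorP n (w : 'I_n -> W) U :
  basis_of U [tuple w i | i < n] -> orth_projector U (frame_projector w).
Proof.
move=> B; have /gram_unitP G := basis_free B.
have spanE : U = <<[tuple w i | i < n]>>%VS by rewrite (span_basis B).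
have wU i : w i \in U.
  by rewrite spanE memv_span //; apply/tnthP; exists i; rewrite tnth_mktuple.
split.
- rewrite /frame_projector !trmx_mul trmxK trmx_inv trmx_mul trmxK.
  by rewrite mulmxA.
- move=> v; rewrite /mact /frame_projector mulmxA; set a := rc v *m _.
  suff -> : vr (a *m frame_mx w) = \sum_i a 0 i *: w i.
    by apply: memv_suml => i _; apply: memvZ.
  rewrite -[RHS]rcK rc_sum; congr (vr (_ *m _)).
  by apply/rowP => i; rewrite [RHS]mxE.
- move=> v vU; apply: (can_inj rcK); rewrite rc_mact.
  have [c ->] : exists c : 'I_n -> R, v = \sum_i c i *: w i.
    exists (fun i => coord [tuple w i | i < n] i v); rewrite {1}(coord_basis B vU).
    by apply: eq_bigr => i _; rewrite -tnth_nth tnth_mktuple.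
  by rewrite rc_sum -/(frame_mx w) /frame_projector !mulmxA
    -(mulmxA _ (frame_mx w) (frame_mx w)^T) mulmxK.
Qed.

Lemma ex_orth_projector U : exists P, orth_projector U P.
Proof.
exists (frame_projector (fun i : 'I_(\dim U) => (vbasis U)`_i)).
apply: frame_projectorP.
have -> : [tuple (vbasis U)`_i | i < \dim U] = vbasis U; last exact: vbasisP.
by apply: eq_from_tnth => i; rewrite tnth_mktuple (tnth_nth 0).
Qed.

(** The basis is drawn from [A] itself, so that at a given time it can be lifted to curves of a
    generating family. *)
Lemma vspan_basis (A : set W) :
  exists X : seq W, (forall v, v \in X -> A v) /\ basis_of (vspan A) X.
Proof.
pose P k := `[< exists X : seq W, [/\ forall v, v \in X -> A v, free X & size X = k] >].
have exP : exists k, P k by exists 0%N; apply/asboolP; exists [::]; split=> //; exact: nil_free.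
have ubP k : P k -> (k <= N)%N.
  by move=> /asboolP[X [_ F <-]]; rewrite -(eqP F); exact/dimvS/subvf.
case: (ex_maxnP exP ubP) => k /asboolP[X [XA F sX]] kmax.
exists X; split=> //; rewrite basisEfree F /=.
have [As Am] := vspanP A.
have XV : (<<X>> <= vspan A)%VS by apply/span_subvP => v /XA /As.
rewrite XV /= -(eqP F); apply/dimvS/Am => v Av; apply: contrapT => /negP vX.
have : P k.+1.
  apply/asboolP; exists (v :: X); split; [|by rewrite free_cons vX|by rewrite /= sX].
  by move=> w; rewrite inE => /orP[/eqP ->|/XA].
by move=> /kmax; rewrite ltnn.
Qed.

End Coordinates.

(** * Smooth families of subspaces *)

Section Bundles.
Context {R : realType} {W : vectType R} (I : interval R).
Hypothesis I_nd : nondegenerate_itv I.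
Local Notation N := (\dim {:W}).
Implicit Types (x y : R -> W) (V : R -> {vspace W}) (Q : R -> 'M[R]_N) (t : R).

Definition smooth_mx m n (M : R -> 'M[R]_(m, n)) := forall i j, smoothf I (fun s => M s i j).

(** A subbundle is recorded by global smooth projections onto it, with unspecified kernels. Acting
    on constant vectors they give sections through any point. *)
Definition smooth_idempotent V Q := smooth_mx Q /\
  forall t, t \in I -> (forall v, mact (Q t) v \in V t) /\
                       (forall v, v \in V t -> mact (Q t) v = v).

Definition smooth_bundle V := exists Q, smooth_idempotent V Q.

Definition locally_framed V := forall t0, t0 \in I ->
  exists n (b : 'I_n -> R -> W), (forall k, vsmooth I (b k)) /\
    exists2 d, 0 < d & forall t, t \in I -> `|t - t0| < d ->
      basis_of (V t) [tuple b k t | k < n].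

Lemma smooth_subspaces_framed V : smooth_subspaces I V -> locally_framed V.
Proof.
move=> H t0 t0I; have [n [b [sb /nbhs_ballP[d /= d0 Hd]]]] := H t0 t0I.
exists n, b; split=> //; exists d => // t tI td; apply: Hd => //.
by rewrite /ball /= distrC.
Qed.

Lemma frame_mx_smooth n (b : 'I_n -> R -> W) : (forall k, vsmooth I (b k)) ->
  smooth_mx (fun s => frame_mx (fun k => b k s)).
Proof.
move=> H i j; have /vsmoothP/(_ j) := H i.
by apply: smoothf_eq => s _; rewrite mxE.
Qed.

Lemma smooth_mx_tr m n (M : R -> 'M[R]_(m, n)) : smooth_mx M -> smooth_mx (fun s => (M s)^T).
Proof. by move=> H i j; apply: (smoothf_eq _ (H j i)) => s _; rewrite mxE. Qed.

Lemma smooth_mx_mul m n p (A : R -> 'M[R]_(m, n)) (B : R -> 'M[R]_(n, p)) :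
  smooth_mx A -> smooth_mx B -> smooth_mx (fun s => A s *m B s).
Proof. by move=> HA HB i j; exact: smoothf_mulmx. Qed.

Lemma smooth_mx_cst m n (A : 'M[R]_(m, n)) : smooth_mx (fun=> A).
Proof. by move=> i j; exact: smoothf_cst. Qed.

Lemma smooth_mxB m n (A B : R -> 'M[R]_(m, n)) :
  smooth_mx A -> smooth_mx B -> smooth_mx (fun s => A s - B s).
Proof.
move=> HA HB i j; apply: (@smoothf_eq _ _ (fun s => A s i j - B s i j)).
  by move=> s _; rewrite !mxE.
exact: smoothfB.
Qed.

Lemma mxBE m n (A B : 'M[R]_(m, n)) i j : (A - B) i j = A i j - B i j.
Proof. by rewrite !mxE. Qed.

Lemma mxNE m n (A : 'M[R]_(m, n)) i j : (- A) i j = - A i j.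
Proof. by rewrite mxE. Qed.

Lemma mact_smooth Q x : smooth_mx Q -> vsmooth I x -> vsmooth I (fun s => mact (Q s) (x s)).
Proof.
move=> HQ /vsmoothP Hx; apply/vsmoothP => i.
apply: (@smoothf_eq _ _ (fun s => \sum_k vcoord k (x s) * Q s k i)).
  by move=> s _; rewrite vcoord_vr mxE; apply: eq_bigr => k _; rewrite mxE.
by apply: smoothf_sum => // k _; exact: smoothfM.
Qed.

Lemma bundle_section V Q t v : smooth_idempotent V Q -> t \in I -> v \in V t ->
  sections I V (fun s => mact (Q s) v) /\ mact (Q t) v = v.
Proof.
move=> [sQ HQ] tI vV; split; last by apply: (HQ t tI).2.
split; first by apply: (@mact_smooth _ (fun=> v)) => //; exact: vsmooth_cst.
by move=> s sI; apply: (HQ s sI).1.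
Qed.

Lemma ex_section V t v : smooth_bundle V -> t \in I -> v \in V t ->
  exists x, sections I V x /\ x t = v.
Proof.
by move=> [Q HQ] tI vV; exists (fun s => mact (Q s) v); exact: bundle_section.
Qed.

(* The orthogonal projectors for the coordinate inner product do not depend on
   the local frames, hence they glue. *)
Lemma framed_bundle V : locally_framed V -> smooth_bundle V.
Proof.
move=> H; have /choice[P HP] : forall t, exists P, orth_projector (V t) P.
  by move=> t; exact: ex_orth_projector.
exists P; split; last by move=> t _; have [_ ? ?] := HP t; split.
move=> i j; apply: smoothf_local => // t0 t0I.
have [n [b [sb [d d0 Hd]]]] := H t0 t0I; exists d => // J J_nd JI Jo.
have JI' u : u \in J -> u \in I by move=> /JI[].
have sbJ : forall i j, smoothf J (fun s => frame_mx (fun k => b k s) i j).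
  by move=> i' j'; apply: (smoothf_sub I_nd J_nd JI'); exact: frame_mx_smooth.
have sbTJ i' j' : smoothf J (fun s => (frame_mx (fun k => b k s))^T i' j').
  by apply: (smoothf_eq _ (sbJ j' i')) => s _; rewrite [RHS]mxE.
apply: (@smoothf_eq _ _ (fun s => frame_projector (fun k => b k s) i j)).
  move=> s sJ; have [sI sd] := JI _ sJ.
  congr (fun_of_matrix _ i j); apply: orth_projector_unique (HP s).
  exact/frame_projectorP/Hd.
apply: smoothf_mulmx => //; apply: smoothf_mulmx => //; apply: smoothf_invmx => //.
  by move=> s sJ; have [sI sd] := JI _ sJ; apply/gram_unitP/basis_free/Hd.
exact: smoothf_mulmx.
Qed.

Lemma smoothf_neq0_near f t0 : smoothf I f -> t0 \in I -> f t0 != 0 ->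
  exists2 d, 0 < d & forall t, t \in I -> `|t - t0| < d -> f t != 0.
Proof.
move=> Hf t0I f0; have e0 : 0 < `|f t0| / 2 by rewrite divr_gt0 // normr_gt0.
have [d d0 Hd] := has_deriv_continuous I_nd t0I (smoothf_has_deriv Hf t0I) e0.
exists d => // t tI td; apply/eqP => ft; have := Hd t tI td.
by rewrite ft sub0r normrN; apply/negP; rewrite -ltNge ltr_pdivrMr // ltr_pMr ?normr_gt0 // ltr1n.
Qed.

(** Generators that form a basis at [t0] stay free nearby, since their Gram determinant is
    continuous, and remain a basis because the dimension is constant. *)
Lemma generated_bundle (G : set (R -> W)) V : (forall g, G g -> vsmooth I g) ->
  (forall t, t \in I -> V t = vspan [set g t | g in G]) ->
  (forall s t, s \in I -> t \in I -> \dim (V s) = \dim (V t)) -> smooth_bundle V.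
Proof.
move=> sG VG Vdim; apply: framed_bundle => t0 t0I.
have [X [XG Xb]] := vspan_basis [set g t0 | g in G].
rewrite -VG // in Xb.
have /choice[b Hb] : forall k : 'I_(size X), exists g, G g /\ g t0 = X`_k.
  by move=> k; have [g Gg gX] := XG X`_k (mem_nth _ (ltn_ord k)); exists g.
have sb k : vsmooth I (b k) by apply: sG; have [] := Hb k.
have Xt : X = [tuple b k t0 | k < size X].
  apply: (@eq_from_nth _ 0) => [|i iX]; first by rewrite size_tuple.
  rewrite -[in RHS](_ : nat_of_ord (Ordinal iX) = i) // -tnth_nth tnth_mktuple.
  by have [_ ->] := Hb (Ordinal iX).
pose g s := \det (frame_mx (fun k => b k s) *m (frame_mx (fun k => b k s))^T).
have sg : smoothf I g.
  apply: smoothf_det => // i j; apply: smoothf_mulmx => // [|i' j'].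
    exact: frame_mx_smooth.
  exact: (smooth_mx_tr (frame_mx_smooth sb)).
have g0 : g t0 != 0.
  rewrite -unitfE -unitmxE; apply/gram_unitP.
  by rewrite -Xt; exact: basis_free Xb.
have [d d0 Hd] := smoothf_neq0_near sg t0I g0.
exists (size X), b; split=> //; exists d => // t tI td.
have F : free [tuple b k t | k < size X].
  by apply/gram_unitP; rewrite unitmxE unitfE; exact: Hd.
have Vt : \dim (V t) = size X by rewrite (Vdim _ _ tI t0I) -(span_basis Xb); exact/eqP/(basis_free Xb).
rewrite basisEfree F size_tuple Vt leqnn andbT.
apply/span_subvP => v /tnthP[k ->]; rewrite tnth_mktuple VG //.
by have [As _] := vspanP [set g t | g in G]; apply: As; exists (b k) => //; have [] := Hb k.
Qed.

Variable omega : {skew_symmetric W}.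
Hypothesis omega_nd : nondegenerate omega.

Definition gram_omega : 'M[R]_N :=
  \matrix_(i, j) omega (vbasis {:W})`_i (vbasis {:W})`_j.

Lemma omega_mx v w : omega v w = (rc v *m gram_omega *m (rc w)^T) 0 0.
Proof.
rewrite omega_coord mxE exchange_big /=; apply: eq_bigr => j _.
rewrite !mxE mulr_suml; apply: eq_bigr => i _; rewrite !mxE; ring.
Qed.

Lemma omega_eq0 v : (forall w, omega v w = 0) -> v = 0.
Proof.
move=> H; have : v \in orthov omega fullv by apply/mem_orthovP => w _; exact: H.
by rewrite (eqP omega_nd) memv0 => /eqP.
Qed.

Lemma gram_omega_unit : gram_omega \in unitmx.
Proof.
rewrite -row_free_unit; apply: inj_row_free => a Ea.
suff : vr a = 0 by move=> /(congr1 rc); rewrite vrK => ->; apply/rowP => i; rewrite !mxE /vcoord linear0.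
by apply: omega_eq0 => w; rewrite omega_mx vrK Ea mul0mx mxE.
Qed.

(** If [Q] projects onto [V], the adjoint of [1 - Q] for [omega] projects onto the orthogonal of
    [V]. In coordinate rows this adjoint is [O *m (1%:M - Q^T) *m invmx O]. *)
Lemma orthov_bundle V : smooth_bundle V -> smooth_bundle (fun t => orthov omega (V t)).
Proof.
move=> [Q [sQ HQ]]; pose O := gram_omega.
exists (fun t => O *m (1%:M - (Q t)^T) *m invmx O); split.
  apply: smooth_mx_mul; last exact: smooth_mx_cst.
  apply: smooth_mx_mul; first exact: smooth_mx_cst.
  by apply: smooth_mxB; [exact: smooth_mx_cst | exact: smooth_mx_tr].
move=> t tI; have [Q1 Q2] := HQ t tI.
have QQ : Q t *m Q t = Q t.
  by apply/row_matrixP => i; rewrite row_mul row_rc_mx -rc_mact Q2.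
split=> [v|v vV].
  apply/mem_orthovP => w /Q2 <-; rewrite omega_mx !rc_mact trmx_mul -/O.
  rewrite !mulmxA mulmxKV ?gram_omega_unit // -!mulmxA.
  rewrite (mulmxA (1%:M - (Q t)^T)) mulmxBl mul1mx -trmx_mul QQ subrr.
  by rewrite mul0mx !mulmx0 mxE.
apply: (can_inj rcK); rewrite rc_mact mulmxBr mulmx1 mulmxBl mulmxBr mulmxV ?gram_omega_unit //.
rewrite mulmx1 !mulmxA (_ : rc v *m O *m (Q t)^T = 0) ?mul0mx ?subr0 //.
apply/rowP => i; rewrite [RHS]mxE.
have := mem_orthovP vV (mact (Q t) (vr (delta_mx 0 i))) (Q1 _).
rewrite omega_mx rc_mact vrK trmx_mul mulmxA => <-.
by rewrite trmx_delta -colE [RHS]mxE.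
Qed.

(** A bundle over an interval is trivial: a basis at [t0] is transported by the linear equation X' =
    X Q', where Q is the projection. Linear equations are solvable on all of [I], so the frame is
    global. *)
Lemma bundle_frame V n : smooth_bundle V -> (forall t, t \in I -> \dim (V t) = n) ->
  exists x : 'I_n -> R -> W, (forall k, vsmooth I (x k)) /\
    forall t, t \in I -> basis_of (V t) [tuple x k t | k < n].
Proof.
move=> [Q [sQ HQ]] Vdim; have [t0 t0I] : exists t0, t0 \in I by have [a [b [aI _ _]]] := I_nd; exists a.
pose Q' t : 'M[R]_N := \matrix_(i, j) derive_within I (fun s => Q s i j) t.
have DQ t i j : t \in I -> has_deriv I (fun s => Q s i j) t (Q' t i j).
  by move=> tI; rewrite mxE; exact: smoothf_has_deriv.
have sQ' i j : smoothf I (fun t => Q' t i j).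
  by apply: (@smoothf_eq _ _ (derive_within I (fun s => Q s i j))) => [s _|];
    [rewrite mxE | exact: smoothf_derive].
have QQ t : t \in I -> Q t *m Q t = Q t.
  move=> tI; have [Q1 Q2] := HQ t tI.
  by apply/row_matrixP => i; rewrite row_mul row_rc_mx -rc_mact Q2.
have QQ' t : t \in I -> Q' t *m Q t + Q t *m Q' t = Q' t.
  move=> tI; apply/matrixP => i j.
  have D := has_deriv_mulmx I_nd tI (fun i j => DQ t i j tI) (fun i j => DQ t i j tI) i j.
  rewrite -(has_derivE I_nd tI D); apply: has_derivE => //.
  by apply: (has_deriv_eq _ tI (DQ t i j tI)) => s sI; rewrite QQ.
(* Multiplying the derivative of Q Q = Q by Q leaves Q Q' Q = 0. *)
have QQQ t : t \in I -> Q t *m Q' t *m Q t = 0.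
  move=> tI; have := QQ' t tI => /(congr1 (mulmx (Q t))).
  by rewrite mulmxDr !mulmxA QQ // -[RHS]add0r => /addIr.
have sol (c : 'I_N -> R) := linear_ode I_nd c t0I (fun i j => sQ' j i).
have /choice[X HX] : forall k : 'I_n, exists x : R -> W, [/\ vsmooth I x,
    x t0 = (vbasis (V t0))`_k &
    forall t, t \in I -> vderive I x t = mact (Q' t) (x t)].
  move=> k; have [x [x0 sx Dx]] := sol (fun i => vcoord i (vbasis (V t0))`_k).
  exists (fun s => vr (\row_i x i s)); split.
  - apply/vsmoothP => i; apply: (smoothf_eq _ (sx i)) => s _.
    by rewrite vcoord_vr mxE.
  - by apply: vcoordP => i; rewrite vcoord_vr mxE x0.
  - move=> t tI; apply: vderive_has_deriv => // i.
    rewrite vcoord_vr vrK mxE; apply: (@has_deriv_eq _ _ (x i)) => //.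
      by move=> s _; rewrite vcoord_vr mxE.
    rewrite (eq_bigr (fun j => Q' t j i * x j t)); first exact: Dx.
    by move=> j _; rewrite [in LHS]mxE mulrC.
have XV k t : t \in I -> X k t \in V t.
  move=> tI; have [sX X0 DX] := HX k.
  have rcX s : s \in I -> forall i j, has_deriv I (fun s => rc (X k s) i j) s ((rc (X k s) *m Q' s) i j).
    move=> sI i j; rewrite -rc_mact -DX // mxE.
    apply: (@has_deriv_eq _ _ (fun s => vcoord j (X k s))) => //.
      by move=> u _; rewrite mxE.
    exact: vsmooth_has_deriv.
  (* The component of the solution outside [V]. As Q Q' Q = 0, it satisfies y' = - y Q' Q, and it
     starts at 0. *)
  pose y s := rc (X k s) - rc (X k s) *m Q s.
  have Dy s j : s \in I -> has_deriv I (fun s => y s 0 j) s (\sum_i (- (Q' s *m Q s) i j) * y s 0 i).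
    move=> sI; rewrite (_ : \sum_i _ = (rc (X k s) *m Q' s -
        (rc (X k s) *m Q' s *m Q s + rc (X k s) *m Q' s)) 0 j).
      have D1 := has_deriv_mulmx I_nd sI (rcX s sI) (fun i j => DQ s i j sI) 0 j.
      rewrite mxBE; apply: (has_deriv_eq _ sI (has_derivB I_nd sI (rcX s sI 0 j) D1)).
      by move=> u _; rewrite mxBE.
    have -> : rc (X k s) *m Q' s - (rc (X k s) *m Q' s *m Q s + rc (X k s) *m Q' s) =
        y s *m - (Q' s *m Q s).
      rewrite /y mulmxBl !mulmxN !mulmxA -(mulmxA _ (Q s)) -(mulmxA _ (_ *m _)) QQQ // mulmx0.
      by rewrite opprD addrCA subrr addr0 oppr0 subr0.
    by rewrite [RHS]mxE; apply: eq_bigr => i _; rewrite mxNE mulrC.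
  have sA i j : smoothf I (fun s => - (Q' s *m Q s) j i).
    by apply: smoothfN => //; apply: smoothf_mulmx.
  have y0 j : y t0 0 j = 0.
    have [_ Q2] := HQ t0 t0I; rewrite /y -rc_mact Q2 ?subrr ?mxE // X0.
    by apply: vbasis_mem; apply: mem_nth; rewrite size_tuple Vdim.
  have yt j : y t 0 j = 0.
    exact: (@linear_ode_unique _ _ I_nd _ (fun i j s => - (Q' s *m Q s) j i)
      (fun j s => y s 0 j) t0 t j t0I tI sA (fun j s => Dy s j) y0).
  have -> : X k t = mact (Q t) (X k t); last by have [] := HQ t tI.
  apply: (can_inj rcK); rewrite rc_mact; apply/eqP; rewrite -subr_eq0; apply/eqP/rowP => j.
  by rewrite [RHS]mxE; exact: yt.
exists X; split=> [k|t tI]; first by have [] := HX k.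
rewrite basisEfree size_tuple Vdim // leqnn andbT; apply/andP; split; last first.
  by apply/span_subvP => v /tnthP[k ->]; rewrite tnth_mktuple XV.
apply/freeP => c; rewrite (eq_bigr (fun k => c k *: X k t)); last first.
  by move=> k _; rewrite -tnth_nth tnth_mktuple.
(* A constant combination of the frame solves the same linear equation, so if it vanishes at [t] it
   vanishes at [t0], where the frame is a basis. *)
move=> c0; pose z s := \sum_k c k *: X k s.
have Dz i s : s \in I -> has_deriv I (fun s => vcoord i (z s)) s (\sum_j Q' s j i * vcoord j (z s)).
  move=> sI; have sz : vsmooth I z.
    by apply: vsmooth_sum => // k _; apply: vsmoothZ => //; [exact: smoothf_cst | have [] := HX k].
  have -> : \sum_j Q' s j i * vcoord j (z s) = vcoord i (vderive I z s).
    have := @iter_vderive_sum _ _ _ I_nd _ predT c X 1 (fun k _ => let: And3 H _ _ := HX k in H) s sI.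
    rewrite /= -/z => ->; rewrite vcoord_sum.
    rewrite (eq_bigr (fun k => \sum_j Q' s j i * (c k * vcoord j (X k s)))).
      rewrite exchange_big; apply: eq_bigr => j _; rewrite vcoord_sum mulr_sumr.
      by apply: eq_bigr => k _; rewrite vcoordZ.
    move=> k _; have [_ _ DX] := HX k; rewrite vcoordZ DX // vcoord_vr mxE mulr_sumr.
    by apply: eq_bigr => j _; rewrite [rc _ _ _]mxE; ring.
  exact: vsmooth_has_deriv.
have zt0 : z t0 = 0.
  apply: vcoordP => i; rewrite [RHS]/vcoord linear0.
  apply: (@linear_ode_unique _ _ I_nd _ (fun i j s => Q' s j i) (fun i s => vcoord i (z s)) t t0 i tI t0I (fun i j => sQ' j i) Dz).
  by move=> j; rewrite /z c0 /vcoord linear0.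
have F := basis_free (vbasisP (V t0)).
move: zt0; rewrite /z => z0 k.
have {}Vd := Vdim t0 t0I.
pose c' (j : 'I_(\dim (V t0))) := c (cast_ord Vd j).
have /freeP/(_ c') H := F.
have := H _ (cast_ord (esym Vd) k); rewrite /c' cast_ordKV; apply.
rewrite -[RHS]z0 (reindex (cast_ord (esym Vd))) /=.
  by apply: eq_bigr => j _; have [_ ->] := HX j; rewrite cast_ordKV.
by exists (cast_ord Vd) => j _; rewrite ?cast_ordK ?cast_ordKV.
Qed.

End Bundles.

(** * Extensions and contractions of a Lagrangian curve *)

Section OrthogonalDimension.
Context {R : realType} {W : vectType R} (omega : {skew_symmetric W}).
Hypothesis omega_nd : nondegenerate omega.
Implicit Types U V : {vspace W}.

Lemma dim_orthov_ge U : (\dim {:W} - \dim U <= \dim (orthov omega U))%N.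
Proof.
pose f (w : W) : 'rV[R]_(\dim U) := \row_i omega w (vbasis U)`_i.
have f_lin : linear f.
  by move=> a u v; apply/rowP => i; rewrite !mxE linearPl.
pose F := linfun (HB.pack_for {linear W -> 'rV[R]_(\dim U)} f
  (GRing.isLinear.Build _ _ _ _ f f_lin)).
have <- : lker F = orthov omega U.
  apply/vspaceP => w; rewrite memv_ker lfunE /=; apply/eqP/mem_orthovP => [fw u uU|H].
    rewrite (coord_vbasis uU) linear_sumr big1 // => i _; rewrite linearZr_LR /=.
    by move: fw => /rowP/(_ i); rewrite !mxE => ->; rewrite mulr0.
  by apply/rowP => i; rewrite !mxE H // vbasis_mem // mem_nth // size_tuple.
have : (\dim (F @: fullv) <= \dim U)%N.
  by rewrite (leq_trans (dimvS (subvf _))) // dimvf /dim /= mul1n.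
by have := limg_ker_dim F fullv; rewrite capfv; lia.
Qed.

(** The orthogonals of [U] and of a complement of [U] meet only in 0, since [omega] is
    nondegenerate. Hence the lower bounds on their dimensions cannot be strict. *)
Lemma dim_orthov U : (\dim (orthov omega U) = \dim {:W} - \dim U)%N.
Proof.
apply/eqP; rewrite eqn_leq dim_orthov_ge andbT.
have UC : (U :&: U^C = 0)%VS by exact: capv_compl.
have E0 : (orthov omega U :&: orthov omega U^C = 0)%VS.
  apply/eqP; rewrite -subv0; apply/subvP => w; rewrite memv_cap => /andP[wU wC].
  rewrite memv0; apply/eqP/(omega_eq0 omega_nd) => v.
  have : v \in (U + U^C)%VS by rewrite addv_complf memvf.
  case/memv_addP => u uU [c cC ->]; rewrite linearDr /=.
  by rewrite (mem_orthovP wU) // (mem_orthovP wC) // addr0.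
have := dim_orthov_ge U^C; rewrite dimv_compl => H.
have := dimvS (subvf U).
have := dimvS (subvf (orthov omega U + orthov omega U^C)%VS).
rewrite dimv_disjoint_sum //. lia.
Qed.

Lemma orthovS U V : (U <= V)%VS -> (orthov omega V <= orthov omega U)%VS.
Proof.
move=> /subvP UV; apply/subvP => w /mem_orthovP H; apply/mem_orthovP => u /UV.
exact: H.
Qed.

End OrthogonalDimension.

(** The standing assumptions on the curve. Condition (G) is kept apart: it enters only where the
    pairings of a new level are shown to be nondegenerate. *)
Record regular_curve {R : realType} {W : vectType R} (m : nat) (omega : {skew_symmetric W})
    (I : interval R) (L : R -> {vspace W}) (d : nat) (r p : 'I_d -> nat) : Prop := RegularCurve {
  rc_dim : \dim {:W} = (2 * m)%N;
  rc_nd : nondegenerate omega;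
  rc_itv : nondegenerate_itv I;
  rc_lagr : forall t, t \in I -> lagrangian omega (L t);
  rc_smooth : smooth_subspaces I L;
  rc_const : forall n s t, s \in I -> t \in I ->
    \dim (nth_extension I L n s) = \dim (nth_extension I L n t);
  rc_full : exists q, forall t, t \in I -> nth_extension I L q t = fullv;
  rc_young : is_young_diagram_of I L r p }.

(* Keeps unification from unfolding smoothness down to limits of filters. *)
#[local] Opaque vsmooth smoothf.

Section RegularCurves.
Context {R : realType} {W : vectType R} {m : nat} {omega : {skew_symmetric W}}.
Context {I : interval R} {L : R -> {vspace W}} {d : nat} {r p : 'I_d -> nat}.
Hypothesis C : regular_curve m omega I L r p.
Let I_nd := rc_itv C.
Let omega_nd := rc_nd C.
Implicit Types (x y : R -> W) (t : R) (v w : W).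

Lemma rc_orthov t : t \in I -> orthov omega (L t) = L t.
Proof.
move=> tI; have /andP[LL /eqP Ld] := rc_lagr C tI.
apply/esym/eqP; rewrite eqEdim LL /= dim_orthov // -Ld -addnn addnK.
by rewrite leqnn.
Qed.

Lemma rc_dimL t : t \in I -> \dim (L t) = m.
Proof.
by move=> tI; have /andP[_ /eqP] := rc_lagr C tI; rewrite (rc_dim C) -mul2n => /eqP; rewrite eqn_pmul2l // => /eqP.
Qed.

Lemma rc_isotropic t v w : t \in I -> v \in L t -> w \in L t -> omega v w = 0.
Proof. by move=> tI; rewrite -{1}rc_orthov // => /mem_orthovP; exact. Qed.

Lemma rc_bundle : smooth_bundle I L.
Proof. exact/(framed_bundle I_nd)/smooth_subspaces_framed/(rc_smooth C). Qed.

(* On [I] this is the [q]th contraction, see [nth_contractionE]. *)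
Definition contr q t := orthov omega (nth_extension I L q t).

Lemma mem_contr q t v : v \in contr q t <->
  forall x j, sections I L x -> (j <= q)%N -> omega v (iter j (vderive I) x t) = 0.
Proof.
rewrite /contr /nth_extension; set A := (X in vspan X).
have [As Am] := vspanP A; split=> [/mem_orthovP H x j sx jq|H].
  by apply/H/As; exists x, j.
have : (vspan A <= orthov omega <[v]>)%VS.
  apply: Am => _ [x [j [sx jq ->]]]; rewrite mem_orthov1 omegaC.
  by rewrite H // oppr0.
by rewrite orthov_sym memvE.
Qed.

Lemma mem_ext q t x j : sections I L x -> (j <= q)%N ->
  iter j (vderive I) x t \in nth_extension I L q t.
Proof. by move=> sx jq; apply: (vspanP _).1; exists x, j. Qed.

Lemma ext_bundle q : smooth_bundle I (nth_extension I L q).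
Proof.
apply: (generated_bundle I_nd (G := [set g | exists x j,
  [/\ sections I L x, (j <= q)%N & g = iter j (vderive I) x]])).
- by move=> _ [x [j [[sx _] _ ->]]]; exact: vsmooth_iter.
- move=> t tI; rewrite /nth_extension; congr vspan; apply/seteqP; split.
    by move=> _ [x [j [sx jq ->]]]; exists (iter j (vderive I) x) => //; exists x, j.
  by move=> _ [g [x [j [sx jq ->]]] <-]; exists x, j.
- exact: rc_const C q.
Qed.

Lemma contr_bundle q : smooth_bundle I (contr q).
Proof. by apply: orthov_bundle => //; exact: ext_bundle. Qed.

Lemma contr0 t : t \in I -> contr 0 t = L t.
Proof.
move=> tI; rewrite -[RHS]rc_orthov //; congr (orthov _ _).
have [As Am] := vspanP [set v | exists l j,
  [/\ sections I L l, (j <= 0)%N & v = iter j (vderive I) l t]].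
apply/eqP; rewrite eqEsubv; apply/andP; split.
  by apply: Am => _ [x [j [[_ xL] + ->]]]; rewrite leqn0 => /eqP ->; exact: xL.
apply/subvP => v vL; have [x [sx <-]] := ex_section I_nd rc_bundle tI vL.
exact: (@mem_ext 0 t x 0).
Qed.

Lemma extS q q' t : (q <= q')%N -> (nth_extension I L q t <= nth_extension I L q' t)%VS.
Proof.
move=> qq'; apply: (vspanP _).2 => _ [x [j [sx jq ->]]].
by apply: mem_ext => //; exact: leq_trans qq'.
Qed.

Lemma contrS q q' t : (q <= q')%N -> (contr q' t <= contr q t)%VS.
Proof. by move=> qq'; apply: orthovS; exact: extS. Qed.

Lemma contr_sub q t : t \in I -> (contr q t <= L t)%VS.
Proof. by move=> tI; rewrite -contr0 //; exact: contrS. Qed.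

(** A section of the contraction of order [q] pairs to 0 with all derivatives of order at most [q]
    of sections of [L]. Moving [a] of these derivatives to [x] leaves [q - a]. *)
Lemma section_contr_deriv q x a b t : sections I (contr q) x -> (a + b <= q)%N -> t \in I ->
  iter a (vderive I) x t \in contr b t.
Proof.
move=> [sx xC] abq tI; apply/mem_contr => y j sy jb.
apply: (@pairing_low _ _ _ I_nd _ _ _ q.+1) => //; first by case: sy.
  by move=> c s cq sI; have /mem_contr := xC s sI; apply.
by rewrite ltnS (leq_trans _ abq) // leq_add2l.
Qed.

Lemma section_contr_L q x a t : sections I (contr q) x -> (a <= q)%N -> t \in I ->
  iter a (vderive I) x t \in L t.
Proof.
by move=> sx aq tI; rewrite -contr0 //; apply: (section_contr_deriv sx _ tI); rewrite addn0.
Qed.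

(** Converse of [section_contr_L]: the sections of the contraction of order [q] are the curves whose
    derivatives up to order [q] stay in [L]. *)
Lemma deriv_section_contr q x : vsmooth I x ->
  (forall a t, (a <= q)%N -> t \in I -> iter a (vderive I) x t \in L t) -> sections I (contr q) x.
Proof.
move=> sx H; split=> // t tI; apply/mem_contr => y j [sy yL] jq.
rewrite omegaC -[X in omega _ X]/(iter 0 (vderive I) x t).
rewrite (@pairing_low _ _ _ I_nd _ _ _ q.+1) ?oppr0 // ?addn0 // => b s bq sI.
by apply: (rc_isotropic sI); [exact: yL | exact: H].
Qed.

(** The duality between contractions and extensions. Moving one derivative turns the orthogonality
    of x' to the derivatives of order [q] into that of x to those of order [q + 1]. *)
Lemma nth_contractionE q t : t \in I -> nth_contraction I L q t = contr q t.
Proof.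
elim: q t => [|q IHq] t tI; first by rewrite contr0.
rewrite -[nth_contraction I L q.+1 t]/(contraction1 I (nth_contraction I L q) t).
have sE x : sections I (nth_contraction I L q) x <-> sections I (contr q) x.
  by split=> -[sx xV]; split=> // s sI; have := xV s sI; rewrite IHq.
apply/vspaceP => v; apply/idP/idP.
  move=> /(memv_contraction1 _ _ I_nd tI); rewrite !IHq //.
  move=> [vq [x [/sE sx xt xq]]]; apply/mem_contr => y j sy.
  rewrite leq_eqVlt => /orP[/eqP ->|]; last first.
    by rewrite ltnS => jq; have /mem_contr := vq; apply.
  have [sx1 xC] := sx; have [sy1 _] := sy.
  have H b s : (b < q.+1)%N -> s \in I -> omega (x s) (iter b (vderive I) y s) = 0.
    by move=> bq sI; have /mem_contr := xC s sI; apply.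
  have := pairing_shift I_nd sx1 sy1 H (erefl (1 + q)%N) tI.
  have /mem_contr/(_ y q sy (leqnn q)) := xq => E; rewrite [LHS]E xt => /eqP.
  by rewrite expr1 mulN1r eq_sym oppr_eq0 => /eqP.
(* Any section through [v] of the previous contraction serves as witness: whether its derivative
   lies there depends only on its value [v]. *)
move=> vC; apply/(memv_contraction1 _ _ I_nd tI); rewrite !IHq //.
have vq : v \in contr q t by apply: subvP vC; apply: contrS.
split=> //; have [x [sx xt]] := ex_section I_nd (contr_bundle q) tI vq.
exists x; split=> //; first exact/sE.
have [sx1 xC] := sx; apply/mem_contr => y j sy jq; have [sy1 _] := sy.
have H b s : (b < j.+1)%N -> s \in I -> omega (x s) (iter b (vderive I) y s) = 0.
  by move=> bq sI; have /mem_contr := xC s sI; apply => //; exact: leq_trans jq.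
rewrite [LHS](pairing_shift I_nd sx1 sy1 H (erefl (1 + j)%N) tI) xt.
by have /mem_contr -> := vC; rewrite ?mulr0.
Qed.

Lemma dim_ext_young n t : t \in I ->
  \dim (nth_extension I L n t) = (m + \sum_i r i * minn n (p i))%N.
Proof.
move=> tI; elim: n => [|n IHn].
  rewrite big1 ?addn0; last by move=> i _; rewrite min0n muln0.
  rewrite -(rc_dimL tI) -(contr0 tI) dim_orthov // (rc_dim C).
  have := rc_dimL tI; rewrite -(contr0 tI) dim_orthov // (rc_dim C).
  by have := dimvS (subvf (nth_extension I L 0 t)); rewrite (rc_dim C); lia.
have [_ /(_ n t tI)] := rc_young C; have := dimvS (@extS n n.+1 t (leqnSn n)).
rewrite IHn => le E; rewrite -(subnK le) E addnC -addnA; congr (_ + _)%N.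
rewrite [X in (_ + X)%N]big_mkcond -big_split /=; apply: eq_bigr => i _.
case: ltnP => h; last by rewrite ?add0n ?addn0 !(minn_idPr _) // ltnW.
have -> : minn n.+1 (p i) = (minn n (p i)).+1 by lia.
by rewrite mulnS (minn_idPl (ltnW h)) addnC.
Qed.

(** The extensions grow from dimension [m] to [2 * m], and the growth counts the boxes column by
    column. [n] is taken so large that every row is exhausted. *)
Lemma sum_boxes : (\sum_i r i * p i)%N = m.
Proof.
have [t0 t0I] : exists t0, t0 \in I by have [a [b [aI _ _]]] := I_nd; exists a.
have [q Hq] := rc_full C; pose n := (q + \sum_i p i)%N.
have : \dim (nth_extension I L n t0) = (2 * m)%N.
  rewrite -(rc_dim C); congr (\dim _); apply/eqP; rewrite eqEsubv subvf -(Hq t0 t0I) /=.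
  exact/extS/leq_addr.
rewrite dim_ext_young // mul2n -addnn => /addnI <-; apply: eq_bigr => i _.
congr (_ * _)%N; apply/esym/minn_idPr.
by rewrite /n (bigD1 i) //= addnCA leq_addr.
Qed.

(** The number of boxes beyond column [q]; truncated subtraction discards the rows that are too
    short. *)
Lemma dim_contr q t : t \in I -> \dim (contr q t) = (\sum_i r i * (p i - q))%N.
Proof.
move=> tI; rewrite dim_orthov // dim_ext_young // (rc_dim C) mul2n -addnn subnDl.
rewrite -{1}sum_boxes -sumnB; last by move=> i _; rewrite leq_mul2l geq_minr orbT.
by apply: eq_bigr => i _; rewrite -mulnBr; congr (_ * _)%N; lia.
Qed.

(** The difference of two sections through the same vector vanishes at [t], and its derivative can
    be traded for a derivative of [x]. *)
Lemma velocityE t x : t \in I -> sections I L x ->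
  velocity I omega L t (x t) = omega (vderive I x t) (x t).
Proof.
move=> tI sx; rewrite /velocity; set y := xget _ _.
have [sy yt] : [set l | sections I L l /\ l t = x t] y.
  by rewrite /y; case: xgetP => [z -> //|/(_ x) H]; case: H.
move: y sy yt => y sy yt.
rewrite yt; apply/eqP; rewrite -subr_eq0 -linearBl; apply/eqP.
have [sx1 xL] := sx; have [sy1 yL] := sy.
have := iter_vderiveB I_nd 1 sy1 sx1 tI => /= <-.
pose z s := y s - x s.
have sz : vsmooth I z := vsmoothD I_nd sy1 (vsmoothN I_nd sx1).
have H b s : (b < 1)%N -> s \in I -> omega (z s) (iter b (vderive I) x s) = 0.
  by case: b => // _ sI; apply: (rc_isotropic sI) (xL s sI); rewrite memvB ?yL ?xL.
rewrite [LHS](pairing_shift I_nd sz sx1 H (erefl (1 + 0)%N) tI) /z yt subrr.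
by rewrite linear0l mulr0.
Qed.

Lemma section_symm t x y : t \in I -> sections I L x -> sections I L y ->
  omega (vderive I x t) (y t) = omega (vderive I y t) (x t).
Proof.
move=> tI [sx xL] [sy yL].
have H b s : (b < 1)%N -> s \in I -> omega (x s) (iter b (vderive I) y s) = 0.
  by case: b => // _ sI; apply: (rc_isotropic sI); [exact: xL | exact: yL].
rewrite [LHS](pairing_shift I_nd sx sy H (erefl (1 + 0)%N) tI) expr1 mulN1r /=.
by rewrite -omegaC.
Qed.

Lemma sectionsD x y : sections I L x -> sections I L y -> sections I L (fun s => x s + y s).
Proof.
move=> [sx xL] [sy yL]; split=> [|s sI]; first exact: (vsmoothD I_nd sx sy).
by rewrite memvD ?xL ?yL.
Qed.

Lemma polar_velocityE t x y : t \in I -> sections I L x -> sections I L y ->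
  polar (velocity I omega L t) (x t) (y t) = omega (vderive I x t) (y t).
Proof.
move=> tI sx sy; rewrite /polar (velocityE tI (sectionsD sx sy)) !velocityE //.
have [sx1 _] := sx; have [sy1 _] := sy.
rewrite vderiveD // linearDr !linearDl /= (section_symm tI sy sx); lra.
Qed.

End RegularCurves.

(** * Normal generators and normal frames *)

Lemma free_family_in {R : fieldType} {W : vectType R} (T : finType) (B : pred T) (v : T -> W) :
  (forall c : T -> R, \sum_(u | B u) c u *: v u = 0 -> forall u, B u -> c u = 0) ->
  \dim (\sum_(u | B u) <[v u]>) = #|[pred u | B u]|.
Proof.
move=> H; have dir : directv (\sum_(u | B u) <[v u]>).
  apply/directv_sum_independent => x xv x0 u Bu.
  have /fin_all_exists[c Hc] : forall u, exists c, B u -> x u = c *: v u.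
    move=> w; case Bw: (B w); last by exists 0.
    by have /vlineP[c ->] := xv w Bw; exists c.
  rewrite Hc // H ?scale0r // -[RHS]x0.
  by apply: eq_bigr => w /Hc ->.
have v0 u : B u -> v u != 0.
  move=> Bu; apply/eqP => vu; have := H (fun w => (w == u)%:R).
  rewrite (bigD1 u) //= eqxx scale1r vu add0r big1 => [/(_ erefl u Bu)|w /andP[_ /negbTE ->]].
    by rewrite eqxx => /eqP; rewrite oner_eq0.
  by rewrite scale0r.
rewrite (directvP dir) /= -sum1_card; apply: eq_bigr => u Bu.
by rewrite dim_vline v0.
Qed.

Lemma free_family {R : fieldType} {W : vectType R} (T : finType) (v : T -> W) :
  (forall c : T -> R, \sum_u c u *: v u = 0 -> forall u, c u = 0) ->
  \dim (\sum_u <[v u]>) = #|T|.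
Proof. by move=> H; rewrite free_family_in // => c c0 u _; exact: H. Qed.

(** * Normal generators and their triangular relations *)

Section Generators.
Context {R : realType} {W : vectType R} (I : interval R) (I_nd : nondegenerate_itv I).
Variables (omega : {skew_symmetric W}) (A : finType) (P : A -> nat) (eps : A -> R).
Hypothesis P_gt0 : forall s, (0 < P s)%N.
Hypothesis eps2 : forall s, eps s * eps s = 1.
Implicit Types (e : A -> R -> W) (s u : A) (k l j n : nat) (t : R) (B : pred A).
Local Notation D := (vderive I).

Lemma eps_neq0 s : eps s != 0.
Proof. by apply/eqP => e0; have := eps2 s; rewrite e0 mul0r => /eqP; rewrite eq_sym oner_eq0. Qed.

(* [e s] is the vector of the last box of row [s]: the vectors [E] of the row are
   its derivatives of orders less than [P s], and the derivative of order [P s]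
   is the first vector [F] of the row up to the sign [eps s]. *)
Record normal_gen B e : Prop := NormalGen {
  ng_smooth : forall s, B s -> vsmooth I (e s);
  ng_neq : forall s u k l t, B s -> B u -> P s != P u ->
    (k + l < 2 * maxn (P s) (P u))%N -> t \in I ->
    omega (iter k D (e s) t) (iter l D (e u) t) = 0;
  ng_eq : forall s u k l t, B s -> B u -> P s = P u -> (k + l <= 2 * P s)%N -> t \in I ->
    omega (iter k D (e s) t) (iter l D (e u) t) =
    if (k + l).+1 == (2 * P s)%N then (-1) ^+ (P s + k) * eps s * (s == u)%:R else 0 }.

(** The shift identities recover all pairings from those whose left argument is undifferentiated,
    and skew symmetry allows the longer row to stand on the right. At order 2p the correction term
    disappears because the pairing of order 2p - 1 is constant. *)
Lemma normal_genI B e : (forall s, B s -> vsmooth I (e s)) ->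
  (forall s u l t, B s -> B u -> (P s < P u)%N -> (l < 2 * P u)%N -> t \in I ->
    omega (e s t) (iter l D (e u) t) = 0) ->
  (forall s u l t, B s -> B u -> P s = P u -> (l <= 2 * P s)%N -> t \in I ->
    omega (e s t) (iter l D (e u) t) =
    if l.+1 == (2 * P s)%N then (-1) ^+ P s * eps s * (s == u)%:R else 0) ->
  normal_gen B e.
Proof.
move=> sm H1 H2; split=> // s u k l t Bs Bu.
  move=> neq kl tI; have [lt|lt] : (P s < P u)%N \/ (P u < P s)%N by lia.
    apply: (pairing_low I_nd (sm s Bs) (sm u Bu) (n := (2 * P u)%N)) => //; last by lia.
    by move=> b v bn vI; exact: H1.
  rewrite omegaC (pairing_low I_nd (sm u Bu) (sm s Bs) (n := (2 * P s)%N)) ?oppr0 //; last by lia.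
  by move=> b v bn vI; exact: H1.
move=> Psu kl tI; pose n := (2 * P s).-1.
have nE : n.+1 = (2 * P s)%N by rewrite /n; have := P_gt0 s; lia.
have low b v : (b < n)%N -> v \in I -> omega (e s v) (iter b D (e u) v) = 0.
  by move=> bn vI; rewrite H2 //; [rewrite ifN //; lia | lia].
have top v : v \in I -> omega (e s v) (iter n D (e u) v) = (-1) ^+ P s * eps s * (s == u)%:R.
  by move=> vI; rewrite H2 //; [rewrite nE eqxx | lia].
case: ifP => [/eqP E|/eqP E].
  rewrite (pairing_shift I_nd (sm s Bs) (sm u Bu) low) //; last by lia.
  by rewrite top // exprD; ring.
have [lt|/eqP kln] : (k + l < n)%N \/ (k + l)%N == n.+1 by lia.
  exact: (pairing_low I_nd (sm s Bs) (sm u Bu) low).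
rewrite (pairing_shift2 I_nd (sm s Bs) (sm u Bu) low kln tI).
rewrite H2 //; last by lia.
rewrite ifN; last by lia.
rewrite (@has_derivE _ _ I_nd _ _ 0) ?mulr0 ?subrr ?mulr0 //.
by apply: (has_deriv_eq _ tI (has_deriv_cst I_nd ((-1) ^+ P s * eps s * (s == u)%:R) tI)) => v vI; rewrite top.
Qed.

Lemma ng_zero B e s u k l t : normal_gen B e -> B s -> B u -> t \in I ->
  (P s <> P u -> (k + l < 2 * maxn (P s) (P u))%N) ->
  (P s = P u -> (k + l <= 2 * P s)%N /\ (k + l).+1 <> (2 * P s)%N) ->
  omega (iter k D (e s) t) (iter l D (e u) t) = 0.
Proof.
move=> ng Bs Bu tI H1 H2; have [E|/eqP E] := eqVneq (P s) (P u).
  by have [h1 /eqP/negbTE h2] := H2 E; rewrite (ng_eq ng) // h2.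
by apply: (ng_neq ng) => //; [exact/eqP | exact: H1].
Qed.

(** Pairing with the derivative of order [P u + j] of [e u] isolates the coefficient of its
    derivative of order [P u - j.+1]: lower orders pair to 0 and higher ones were eliminated for
    smaller [j]. The cut [j0] lets partial vanishing give partial information. *)
Lemma gen_triangular B e (c : A -> nat -> R) t j0 : normal_gen B e -> t \in I ->
  (forall u j, B u -> (j < P u)%N -> (j <= j0)%N ->
    omega (\sum_(s | B s) \sum_(k < P s) c s k *: iter k D (e s) t)
      (iter (P u + j) D (e u) t) = 0) ->
  forall s j, B s -> (j < P s)%N -> (j <= j0)%N -> c s (P s - j.+1)%N = 0.
Proof.
move=> ng tI H s j; elim/ltn_ind: j s => j IHj u Bu jP jj0.
have := H u j Bu jP jj0; rewrite linear_sumlz (bigD1 u) //= [X in _ + X]big1 => [|s /andP[Bs su]].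
  have jP' : (P u - j.+1 < P u)%N by lia.
  rewrite addr0 linear_sumlz (bigD1 (Ordinal jP')) //= [X in _ + X]big1 => [|k ku].
    rewrite addr0 linearZl_LR /= (ng_eq ng) //; last by lia.
    rewrite ifT ?eqxx ?mulr1; last by lia.
    move=> /eqP; rewrite !mulf_eq0 (negbTE (eps_neq0 u)) orbF.
    by rewrite expf_eq0 oppr_eq0 oner_eq0 andbF orbF => /eqP.
  have {ku} ku : (k : nat) != (P u - j.+1)%N by apply: contraNneq ku => ?; apply/eqP/val_inj.
  have kP := ltn_ord k.
  rewrite linearZl_LR /=; have [klt|kge] : (k < P u - j.+1)%N \/ (P u - j.+1 < k)%N by lia.
    by rewrite (ng_zero ng) ?mulr0 //; lia.
  have -> : (k : nat) = (P u - (P u - k.+1).+1)%N by lia.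
  by rewrite IHj ?mul0r //; lia.
rewrite linear_sumlz big1 // => k _; rewrite linearZl_LR /=.
have := ltn_ord k => kP.
have [klt|kge] : (k < P s - j)%N \/ (P s - j <= k)%N by lia.
  have [Psu|/eqP Psu] := eqVneq (P s) (P u); last first.
    by rewrite (ng_zero ng) ?mulr0 // => *; lia.
  rewrite (ng_eq ng) //; last by lia.
  by rewrite (negbTE su) mulr0; case: ifP => _; rewrite mulr0.
have -> : (k : nat) = (P s - (P s - k.+1).+1)%N by lia.
by rewrite IHj ?mul0r //; lia.
Qed.

Lemma gen_independent B e (c : A -> nat -> R) t : normal_gen B e -> t \in I ->
  (forall u j, B u -> (j < P u)%N ->
    omega (\sum_(s | B s) \sum_(k < P s) c s k *: iter k D (e s) t)
      (iter (P u + j) D (e u) t) = 0) ->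
  forall s k, B s -> (k < P s)%N -> c s k = 0.
Proof.
move=> ng tI H s k Bs kP; have -> : k = (P s - (P s - k.+1).+1)%N by lia.
apply: (@gen_triangular B e c t (P s)) => // [u j Bu jP _||]; [exact: H| lia | lia].
Qed.

(** The module over the smooth functions generated by the derivatives selected by [G]. All estimates
    on F are expressed by the set [G] of admissible orders. *)
Inductive cspan e (G : A -> nat -> Prop) : (R -> W) -> Prop :=
| cspan_gen s k : G s k -> cspan e G (iter k D (e s))
| cspan_0 : cspan e G (fun=> 0)
| cspan_D x y : cspan e G x -> cspan e G y -> cspan e G (fun t => x t + y t)
| cspan_Z f x : smoothf I f -> cspan e G x -> cspan e G (fun t => f t *: x t)
| cspan_eq x y : {in I, x =1 y} -> cspan e G x -> cspan e G y.

Lemma cspan_smooth e G x : (forall s, vsmooth I (e s)) -> cspan e G x -> vsmooth I x.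
Proof.
move=> se; elim=> {x} [s k _||x y _ Hx _ Hy|f x Hf _ Hx|x y xy _ Hx].
- exact: (@vsmooth_iter _ _ _ k).
- exact: (@vsmooth_cst _ _ _ I_nd 0).
- exact: (vsmoothD I_nd Hx Hy).
- exact: (vsmoothZ I_nd Hf Hx).
- exact: (vsmooth_eq xy Hx).
Qed.

Lemma cspan_sub e (G G' : A -> nat -> Prop) x : (forall s k, G s k -> G' s k) ->
  cspan e G x -> cspan e G' x.
Proof.
move=> GG'; elim=> {x} [s k Gsk||x y _ Hx _ Hy|f x Hf _ Hx|x y xy _ Hx].
- exact/cspan_gen/GG'.
- exact: cspan_0.
- exact: cspan_D.
- exact: cspan_Z.
- exact: cspan_eq Hx.
Qed.

(** By the Leibniz rule a term either has its coefficient differentiated and keeps its order, or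
    gains one order; [G'] must allow both. *)
Lemma cspan_deriv e (G G' : A -> nat -> Prop) x : (forall s, vsmooth I (e s)) ->
  (forall s k, G s k -> G' s k /\ G' s k.+1) -> cspan e G x -> cspan e G' (D x).
Proof.
move=> se GG' Hx; have GG'1 s k : G s k -> G' s k by move=> /GG'[].
elim: Hx => {x} [s k Gsk||x y Hx IHx Hy IHy|f x Hf Hx IHx|x y xy Hx IHx].
- by apply: (@cspan_gen _ _ _ k.+1); have [] := GG' _ _ Gsk.
- by apply: (cspan_eq _ (cspan_0 e G')) => t tI; rewrite (vderive_cst I_nd).
- apply: (cspan_eq _ (cspan_D IHx IHy)) => t tI.
  by rewrite (vderiveD I_nd tI (cspan_smooth se Hx) (cspan_smooth se Hy)).
- have Hf' := smoothf_derive Hf.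
  apply: (cspan_eq _ (cspan_D (cspan_Z Hf' (cspan_sub GG'1 Hx)) (cspan_Z Hf IHx))) => t tI.
  by rewrite (vderiveZ I_nd tI Hf (cspan_smooth se Hx)).
- by apply: (cspan_eq _ IHx) => t tI; exact: eq_vderive.
Qed.

Lemma cspanN e G x : cspan e G x -> cspan e G (fun t => - x t).
Proof.
move=> Hx; apply: (cspan_eq _ (cspan_Z (@smoothf_cst _ _ I_nd (-1)) Hx)) => t _.
by rewrite scaleN1r.
Qed.

Lemma cspan_sum e G (J : finType) (x : J -> R -> W) :
  (forall i, cspan e G (x i)) -> cspan e G (fun t => \sum_i x i t).
Proof.
move=> H; elim: (index_enum J) => [|a q IHq].
  by apply: (cspan_eq _ (cspan_0 e G)) => t _; rewrite big_nil.
by apply: (cspan_eq _ (cspan_D (H a) IHq)) => t _; rewrite big_cons.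
Qed.

Lemma cspan_vanish e G x t w : t \in I -> cspan e G x ->
  (forall s k, G s k -> omega (iter k D (e s) t) w = 0) -> omega (x t) w = 0.
Proof.
move=> tI Hx H; elim: Hx => {x} [s k /H //||x y _ Hx _ Hy|f x _ _ Hx|x y xy _ Hx].
- by rewrite linear0l.
- by rewrite linearDl /= Hx Hy addr0.
- by rewrite linearZl_LR /= Hx mulr0.
- by rewrite -xy.
Qed.

End Generators.

(** * Darboux frames indexed by rows and columns of the diagram *)

Section FlatFrames.
Context {R : realType} {W : vectType R} (I : interval R) (I_nd : nondegenerate_itv I).
Variables (omega : {skew_symmetric W}) (A : finType) (P : A -> nat) (eps : A -> R).
Hypothesis omega_nd : nondegenerate omega.
Hypothesis P_gt0 : forall s, (0 < P s)%N.
Hypothesis eps2 : forall s, eps s * eps s = 1.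
Hypothesis dimW : \dim {:W} = (2 * \sum_s P s)%N.
Implicit Types (e : A -> R -> W) (F : A -> nat -> R -> W) (s u : A) (k l j n : nat) (t : R).
Local Notation D := (vderive I).

(* [ecol e s j] is the vector attached to the [j]th column of row [s]. *)
Definition ecol e s j : R -> W := iter (P s - j.+1) D (e s).

(** The equations E' = E of the preceding column are built into [ecol], so only the one for the
    first column remains as [ff_F0]. Nothing is said about [F s j] for [j] outside row [s]. *)
Record flat_frame e F : Prop := FlatFrame {
  ff_e : forall s, vsmooth I (e s);
  ff_F : forall s j, (j < P s)%N -> vsmooth I (F s j);
  ff_EE : forall s j u j' t, (j < P s)%N -> (j' < P u)%N -> t \in I ->
    omega (ecol e s j t) (ecol e u j' t) = 0;
  ff_FF : forall s j u j' t, (j < P s)%N -> (j' < P u)%N -> t \in I ->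
    omega (F s j t) (F u j' t) = 0;
  ff_FE : forall s j u j' t, (j < P s)%N -> (j' < P u)%N -> t \in I ->
    omega (F s j t) (ecol e u j' t) = ((s == u) && (j == j'))%:R;
  ff_F0 : forall s t, t \in I -> iter (P s) D (e s) t = eps s *: F s 0%N t }.

Lemma ecol_smooth e s j : vsmooth I (e s) -> vsmooth I (ecol e s j).
Proof. by move=> H; exact: (@vsmooth_iter _ _ _ (P s - j.+1)). Qed.

Lemma ecolS e s j : (j.+1 < P s)%N -> D (ecol e s j.+1) = ecol e s j.
Proof. by move=> jP; rewrite /ecol -(subnSK jP). Qed.

Lemma ecol0 e s : D (ecol e s 0) = iter (P s) D (e s).
Proof. by rewrite /ecol -[in RHS](prednK (P_gt0 s)) /= subn1. Qed.

Section OneFrame.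
Variables (e : A -> R -> W) (F : A -> nat -> R -> W) (FF : flat_frame e F).
Let E := ecol e.

(* The coefficient of [E u j] in the derivative of [F s n], an entry of the
   mapping $R_t$. *)
Definition ff_coef s n u j t := omega (F u j t) (D (F s n) t).

Lemma ff_EF s j u j' t : (j < P s)%N -> (j' < P u)%N -> t \in I ->
  omega (E s j t) (F u j' t) = - ((s == u) && (j == j'))%:R.
Proof.
by move=> js ju tI; rewrite omegaC (ff_FE FF) // eq_sym (eq_sym j').
Qed.

Lemma flat_frame_total t w : t \in I ->
  (forall u j, (j < P u)%N -> omega w (E u j t) = 0) ->
  (forall u j, (j < P u)%N -> omega w (F u j t) = 0) -> w = 0.
Proof.
move=> tI wE wF; pose T : finType := {s : A & 'I_(P s)}.
pose v (x : T + T) : W := match x with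
  | inl a => E (tag a) (tagged a) t | inr a => F (tag a) (tagged a) t end.
have d : \dim (\sum_x <[v x]>)%VS = #|{: T + T}|.
  apply: free_family => c; rewrite big_sumType /= => c0 x.
  have teq (a b : T) : (tag a == tag b) && (tagged a == tagged b :> nat) = (a == b).
    apply/andP/eqP => [[]|->//]; case: a b => [a1 a2] [b1 b2] /= /eqP ab.
    by case: _ / ab b2 => b2 /eqP/val_inj ->.
  case: x => [a|a].
  - have := congr1 (fun w => omega (F (tag a) (tagged a) t) w) c0.
    rewrite /= linear0r linearDr !linear_sumr /= [X in _ + X]big1 ?addr0; last first.
      by move=> b _; rewrite linearZr_LR /= (ff_FF FF) ?mulr0.
    rewrite (bigD1 a) //= [X in _ + X]big1 => [|b ba].
      by rewrite linearZr_LR /= (ff_FE FF) // !eqxx mulr1 addr0.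
    by rewrite linearZr_LR /= (ff_FE FF) // teq eq_sym (negbTE ba) mulr0.
  - have := congr1 (fun w => omega (E (tag a) (tagged a) t) w) c0.
    rewrite /= linear0r linearDr !linear_sumr /= [X in X + _]big1 ?add0r; last first.
      by move=> b _; rewrite linearZr_LR /= (ff_EE FF) ?mulr0.
    rewrite (bigD1 a) //= [X in _ + X]big1 => [|b ba].
      by rewrite linearZr_LR /= ff_EF // !eqxx mulrN1 addr0 => /eqP; rewrite oppr_eq0 => /eqP.
    by rewrite linearZr_LR /= ff_EF // teq eq_sym (negbTE ba) oppr0 mulr0.
have full : (\sum_x <[v x]>)%VS = fullv.
  apply/eqP; rewrite eqEdim subvf /= d dimW card_sum addnn -mul2n leq_mul2l /=.
  rewrite card_tagged sumnE big_map big_enum /= leq_sum // => s _.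
  by rewrite card_ord.
apply: (omega_eq0 omega_nd) => w'; have : w' \in (\sum_x <[v x]>)%VS by rewrite full memvf.
move=> /memv_sumP[x xv ->]; rewrite linear_sumr big1 // => -[a|a] _ /=.
  by have /vlineP[c ->] := xv (inl a) isT; rewrite linearZr_LR /= wE ?mulr0.
by have /vlineP[c ->] := xv (inr a) isT; rewrite linearZr_LR /= wF ?mulr0.
Qed.

Lemma ff_derivE s n u j t : (n < P s)%N -> (j < P u)%N -> t \in I ->
  omega (D (F s n) t) (E u j t) = - ((s == u) && (n.+1 == j))%:R.
Proof.
move=> nP jP tI; have sE := @ecol_smooth e u j (@ff_e _ _ FF u).
have := has_deriv_omega I_nd (omega:=omega) tI (ff_F FF nP) sE.
move=> /(has_derivE I_nd tI); rewrite (@has_derivE _ _ I_nd _ _ 0) //; last first.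
  apply: (has_deriv_eq _ tI (has_deriv_cst I_nd ((s == u) && (n == j))%:R tI)) => v vI.
  by rewrite (ff_FE FF).
move=> /eqP; rewrite eq_sym addr_eq0 => /eqP ->; congr (- _).
case: j jP sE => [|j] jP _.
  by rewrite ecol0 (ff_F0 FF) // linearZr_LR /= (ff_FF FF) // mulr0 andbF.
by rewrite ecolS // (ff_FE FF) ?eqSS // ltnW.
Qed.

Lemma ff_comboE (c : A -> nat -> R) u j t : (j < P u)%N -> t \in I ->
  omega (\sum_s \sum_(k < P s) c s k *: E s k t) (E u j t) = 0.
Proof.
move=> jP tI; rewrite linear_sumlz big1 // => s _; rewrite linear_sumlz big1 // => k _.
by rewrite linearZl_LR /= (ff_EE FF) // mulr0.
Qed.

Lemma ff_comboF (c : A -> nat -> R) u j t : (j < P u)%N -> t \in I ->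
  omega (\sum_s \sum_(k < P s) c s k *: E s k t) (F u j t) = - c u j.
Proof.
move=> jP tI; rewrite linear_sumlz (bigD1 u) //= [X in _ + X]big1 ?addr0; last first.
  move=> s su; rewrite linear_sumlz big1 // => k _.
  by rewrite linearZl_LR /= ff_EF // (negbTE su) oppr0 mulr0.
rewrite linear_sumlz (bigD1 (Ordinal jP)) //= [X in _ + X]big1 ?addr0; last first.
  move=> k kj; rewrite linearZl_LR /= ff_EF // eqxx /=.
  by rewrite (_ : (k == j :> nat) = false) ?oppr0 ?mulr0 //; apply/negbTE.
by rewrite linearZl_LR /= ff_EF // !eqxx mulrN1.
Qed.

(** The Darboux relations already give the form of F': differentiating [omega (F, E)] determines its
    part along F, and pairing with F its part along E. Normality is therefore a condition on
    [ff_coef] alone. *)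
Lemma ff_structure s n t : (n < P s)%N -> t \in I ->
  D (F s n) t = \sum_u \sum_(j < P u) ff_coef s n u j t *: E u j t
                - (if (n.+1 < P s)%N then F s n.+1 t else 0).
Proof.
move=> nP tI; apply/eqP; rewrite -subr_eq0; apply/eqP; set x := \sum_u _; set f := (if _ then _ else _).
apply: (flat_frame_total tI) => u j jP.
- rewrite linearBl linearBl /= ff_derivE // (_ : omega x _ = 0) ?sub0r; last first.
    exact: (ff_comboE (fun u j => ff_coef s n u j t) jP tI).
  rewrite opprK /f; case: ifP => nP'; first by rewrite (ff_FE FF) // addNr.
  rewrite linear0l addr0; have [su|] := eqVneq s u; last by rewrite oppr0.
  have /negbTE -> : n.+1 != j by apply/eqP => nj; move: nP'; rewrite nj su jP.
  by rewrite /= mulr0n oppr0.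
- rewrite linearBl linearBl /=.
  have -> : omega x (F u j t) = - ff_coef s n u j t.
    exact: (ff_comboF (fun u j => ff_coef s n u j t) jP tI).
  rewrite /ff_coef -omegaC.
  rewrite /f; case: ifP => nP'; last by rewrite linear0l subr0 subrr.
  by rewrite (ff_FF FF) // subr0 subrr.
Qed.

(** The derivative of [omega (F, F) = 0]. *)
Lemma ff_coef_sym s n u j t : (n < P s)%N -> (j < P u)%N -> t \in I ->
  ff_coef s n u j t = ff_coef u j s n t.
Proof.
move=> nP jP tI; have := has_deriv_omega I_nd (omega:=omega) tI (ff_F FF jP) (ff_F FF nP).
move=> /(has_derivE I_nd tI); rewrite (@has_derivE _ _ I_nd _ _ 0) //; last first.
  apply: (has_deriv_eq _ tI (has_deriv_cst I_nd 0 tI)) => v vI.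
  by rewrite (ff_FF FF).
by rewrite /ff_coef (omegaC omega (F s n t)) => /eqP; rewrite eq_sym addrC addr_eq0 => /eqP.
Qed.

(* The first [P s - P u - 1] pairs of the tuple of the context are those with
   [n + j < P s - P u - 1]. *)
Definition ff_normal := forall s n u j t, (n < P s)%N -> (j < P u)%N ->
  (n + j + 1 + P u < P s)%N -> t \in I -> ff_coef s n u j t = 0.

(** The two truncated differences add up to |P s - P u|. The admissible orders are those less than P
    u + n - |P s - P u|. *)
Definition below s n u k := (k + (P s - P u) + (P u - P s) < P u + n)%N.

Lemma ff_coef_smooth s n u j : (n < P s)%N -> (j < P u)%N -> smoothf I (ff_coef s n u j).
Proof.
move=> nP jP; apply: (smoothf_omega I_nd); first exact: (ff_F FF).
exact/vsmooth_derive/(ff_F FF).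
Qed.

(** Induction through F_(n+1) = - F_n' + sum of R E: the leading term changes sign and gains a
    derivative. A surviving coefficient has n + j + 1 >= |P s - P u|, which is what puts the order P
    u - j - 1 of its vector within the bound for n + 1. *)
Lemma F_below s n : (n < P s)%N ->
  (forall n' u j t, (n' < n)%N -> (j < P u)%N ->
    (n' + j + 1 < (P s - P u) + (P u - P s))%N -> t \in I -> ff_coef s n' u j t = 0) ->
  cspan I e (below s n) (fun t => F s n t - ((-1) ^+ n * eps s) *: iter (P s + n) D (e s) t).
Proof.
have se := ff_e FF.
elim: n => [|n IHn] nP Z.
  apply: (cspan_eq _ (cspan_0 I e (below s 0))) => t tI.
  by rewrite addn0 (ff_F0 FF) // expr0 mul1r scalerA eps2 scale1r subrr.
have {IHn} H := IHn (ltnW nP) (fun n' u j t lt => @Z n' u j t (ltnW lt)).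
have sF := ff_F FF (ltnW nP).
have sE := @vsmooth_iter _ _ _ (P s + n) _ (se s).
have {}H : cspan I e (below s n.+1) (D (fun t => F s n t - ((-1) ^+ n * eps s) *: iter (P s + n) D (e s) t)).
  by apply: (cspan_deriv I_nd se _ H) => u k; rewrite /below; lia.
have HS : cspan I e (below s n.+1) (fun t => \sum_u \sum_(j < P u) ff_coef s n u j t *: E u j t).
  apply: cspan_sum => u; apply: cspan_sum => j.
  have [lt|ge] := ltnP (n + j + 1)%N ((P s - P u) + (P u - P s))%N.
    by apply: (cspan_eq _ (cspan_0 I e _)) => t tI; rewrite (Z n) ?scale0r.
  apply: (cspan_Z (ff_coef_smooth (ltnW nP) (ltn_ord j))); apply: cspan_gen.
  by rewrite /below; have := ltn_ord j; lia.
apply: (cspan_eq _ (cspan_D (cspanN I_nd H) HS)) => t tI.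
have sZ : vsmooth I (fun t => ((-1) ^+ n * eps s) *: iter (P s + n) D (e s) t).
  exact: (vsmoothZ I_nd (@smoothf_cst _ _ I_nd _) sE).
rewrite (vderiveD I_nd tI sF (vsmoothN I_nd sZ)) (vderiveN I_nd tI sZ).
rewrite (vderiveZ I_nd tI (@smoothf_cst _ _ I_nd _) sE).
rewrite (has_derivE I_nd tI (has_deriv_cst I_nd _ tI)) scale0r add0r.
rewrite (ff_structure (ltnW nP) tI) nP addnS /= exprS mulN1r mulNr scaleNr opprK.
by rewrite opprB opprB addrA subrK addrC.
Qed.

End OneFrame.
End FlatFrames.

(** * Relations forced by a normal frame, and uniqueness of its rows F *)

Section NormalFrames.
Context {R : realType} {W : vectType R} (I : interval R) (I_nd : nondegenerate_itv I).
Variables (omega : {skew_symmetric W}) (A : finType) (P : A -> nat) (eps : A -> R).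
Hypothesis omega_nd : nondegenerate omega.
Hypothesis P_gt0 : forall s, (0 < P s)%N.
Hypothesis eps2 : forall s, eps s * eps s = 1.
Hypothesis dimW : \dim {:W} = (2 * \sum_s P s)%N.
Implicit Types (e : A -> R -> W) (F : A -> nat -> R -> W) (s u : A) (k l j n : nat) (t : R).
Local Notation D := (vderive I).
Local Notation ecol := (ecol I P).
Local Notation flat_frame := (flat_frame I omega P eps).
Local Notation ff_normal := (ff_normal I omega P).
Local Notation ff_coef := (ff_coef I omega).

Lemma ecol_last e s : ecol e s (P s).-1 = e s.
Proof. by rewrite /ecol prednK // subnn. Qed.

Lemma ecol_iter e s k : (k < P s)%N -> ecol e s (P s - k.+1) = iter k D (e s).
Proof. by move=> kP; rewrite /ecol; congr (iter _ _ _); lia. Qed.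

Section FromFrame.
Variables (e : A -> R -> W) (F : A -> nat -> R -> W) (FF : flat_frame e F).
Let se s : vsmooth I (e s) := @ff_e _ _ _ _ _ _ _ _ _ FF s.

Lemma gen_low s u k l t : (k < P s)%N -> (l < P u)%N -> t \in I ->
  omega (iter k D (e s) t) (iter l D (e u) t) = 0.
Proof.
move=> ks lu tI; rewrite -(ecol_iter e ks) -(ecol_iter e lu).
by apply: (ff_EE FF) => //; lia.
Qed.

(** Isotropy of the columns E alone gives these orders, by moving derivatives away from the last one
    that stays in row [s]. *)
Lemma gen_basic s u k l t : (k + l + 2 <= P s + P u)%N -> t \in I ->
  omega (iter k D (e s) t) (iter l D (e u) t) = 0.
Proof.
move=> kl tI; have := P_gt0 s; have := P_gt0 u => Pu Ps.
have H s' u' k' l' : (P s' <= k')%N -> (k' + l' + 2 <= P s' + P u')%N ->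
    omega (iter k' D (e s') t) (iter l' D (e u') t) = 0.
  move=> h1 h2; have Ps' := P_gt0 s'.
  rewrite (_ : k' = (k' - (P s').-1) + (P s').-1)%N; last by lia.
  rewrite iterD; have sx := @vsmooth_iter _ _ _ (P s').-1 _ (@se s').
  apply: (pairing_low I_nd sx (@se u') (n := P u')) => //; last by lia.
  by move=> b v bP vI; apply: gen_low => //; lia.
have [h|h] := leqP (P s) k; first exact: H.
have [h'|h'] := leqP (P u) l; last exact: gen_low.
by rewrite omegaC H ?oppr0 //; lia.
Qed.

(* [F u i] is dual to the frame and differs from the generator derivative of
   order [P u + i] by terms below it, so the pairings vanish by induction on
   the order. *)
Lemma frame_normal_gen : ff_normal F -> normal_gen I omega P eps xpredT e.
Proof.
move=> Z; have Z' s n u j t : (n < P s)%N -> (j < P u)%N ->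
    (n + j + 1 < (P s - P u) + (P u - P s))%N -> t \in I -> ff_coef F s n u j t = 0.
  move=> ns ju lt tI; have [h|h] : (n + j + 1 + P u < P s)%N \/ (j + n + 1 + P s < P u)%N by lia.
    exact: Z.
  by rewrite (ff_coef_sym I_nd FF) //; exact: Z.
have high i s u t : (P s < P u)%N -> (i < P u)%N -> t \in I ->
    omega (iter (P u + i) D (e u) t) (e s t) = 0.
  elim/ltn_ind: i s u => i IHi s u su iu tI.
  have H : cspan I e (below P u i) (fun t => F u i t - ((-1) ^+ i * eps u) *: iter (P u + i) D (e u) t).
    apply: (F_below I_nd omega_nd P_gt0 eps2 dimW FF) => // n' u' j' t' lt jP lt' t'I.
    by apply: Z' => //; lia.
  have H0 : omega (F u i t - ((-1) ^+ i * eps u) *: iter (P u + i) D (e u) t) (e s t) = 0.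
    apply: (cspan_vanish tI H) => v k; rewrite /below => lt.
    have [vs|vs] := leqP (P v) (P s).
      by apply: (@gen_basic v s k 0) => //; have := P_gt0 s; lia.
    have [kv|kv] := ltnP k (P v).
      by apply: (@gen_low v s k 0) => //.
    rewrite -(subnKC kv); apply: IHi => //; lia.
  move: H0; rewrite linearBl /= -{1}(ecol_last e s) (ff_FE FF) //; last by rewrite prednK.
  rewrite (_ : (u == s) = false); last by apply: contraTF su => /eqP ->; rewrite ltnn.
  rewrite sub0r linearZl_LR /= => /eqP; rewrite oppr_eq0 !mulf_eq0.
  rewrite (negbTE (eps_neq0 eps2 u)) orbF expf_eq0 oppr_eq0 oner_eq0 andbF /=.
  by move=> /eqP.
have se' s : xpredT s -> vsmooth I (e s) by move=> _; exact: se.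
apply: (normal_genI I_nd P_gt0) => // s u l t _ _ su lP tI.
  have [h|h] := ltnP l (P u); first by apply: (@gen_low s u 0 l) => //.
  by rewrite omegaC -(subnKC h) high ?oppr0 //; lia.
have Ps := P_gt0 s; have Pu := P_gt0 u; pose n := (2 * P s).-1.
have nE : n.+1 = (2 * P s)%N by rewrite /n; lia.
have low b v : (b < n)%N -> v \in I -> omega (e s v) (iter b D (e u) v) = 0.
  by move=> bn vI; apply: (@gen_basic s u 0 b) => //; lia.
have E1 v : v \in I -> omega (e s v) (iter n D (e u) v) = (-1) ^+ P s * eps s * (s == u)%:R.
  move=> vI; have h : (P s + (P u).-1)%N = n by lia.
  have := pairing_shift I_nd (@se s) (@se u) low h vI.
  rewrite (ff_F0 FF) // linearZl_LR /= -{1}(subn1 (P u)) -/(ecol e u 0) (ff_FE FF) // andbT => E.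
  by rewrite -mulrA E mulrA -expr2 sqrr_sign mul1r.
have [h|h] : (l < n)%N \/ (l = n \/ l = n.+1)%N by lia.
  by rewrite low // ifN //; lia.
case: h => ->; first by rewrite E1 // nE eqxx.
rewrite ifN; last by lia.
(* At order 2p, split as p + p, both sides are multiples of vectors of the first column F, which is
   isotropic; the pairing of order 2p - 1 is constant and contributes nothing. *)
have h : (P s + P u)%N = n.+1 by lia.
have := pairing_shift2 I_nd (@se s) (@se u) low h tI.
rewrite (ff_F0 FF) // (ff_F0 FF) // linearZl_LR linearZr_LR /= (ff_FF FF) // !mulr0.
rewrite (@has_derivE _ _ I_nd _ _ 0) //; last first.
  by apply: (has_deriv_eq _ tI (has_deriv_cst I_nd ((-1) ^+ P s * eps s * (s == u)%:R) tI)) => v vI; rewrite E1.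
rewrite mulr0 subr0 => /esym/eqP; rewrite mulf_eq0 expf_eq0 oppr_eq0 oner_eq0 andbF /=.
by move=> /eqP.
Qed.

End FromFrame.

(* What quasi-normality says about the coefficients beyond the diagonal; the
   remaining ones are determined by symmetry. *)
Definition quasi_normal_coef F :=
  (forall s n u j t, (n.+1 < P s)%N -> (j < P u)%N -> (n.+1 < j)%N -> t \in I ->
     ff_coef F s n u j t = 0) /\
  (forall s n u t, (n.+1 < P s)%N -> (n.+1 < P u)%N -> t \in I ->
     ((P s < P u)%N -> ff_coef F s n u n.+1 t = 0) /\
     (P s = P u -> ff_coef F s n u n.+1 t = - ff_coef F u n s n.+1 t)).

(* The structure equations give [ff_coef s n u n.+1 - ff_coef u n s n.+1 =
   omega (D (F s n)) (D (F u n))].  Antisymmetry splits this evenly between rows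
   of equal length; otherwise the longer row takes all of it. *)
Definition half_coef s u : R :=
  if (P s < P u)%N then 0 else if P s == P u then 2^-1 else 1.

Lemma half_coefD s u : half_coef s u + half_coef u s = 1.
Proof.
rewrite /half_coef; case: ltngtP => _ //; rewrite ?add0r ?addr0 //.
by rewrite -div1r -splitr.
Qed.

Lemma ff_coef_next e F s u n t : flat_frame e F -> quasi_normal_coef F ->
  (n.+1 < P s)%N -> (n.+1 < P u)%N -> t \in I ->
  ff_coef F s n u n.+1 t = half_coef s u * omega (D (F s n) t) (D (F u n) t).
Proof.
move=> FF [_ Q] sn un tI.
have E : ff_coef F s n u n.+1 t - ff_coef F u n s n.+1 t = omega (D (F s n) t) (D (F u n) t).
  rewrite (ff_structure I_nd omega_nd P_gt0 dimW FF (ltnW sn) tI) sn linearBl /=.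
  have h (w : W) (c : A -> nat -> R) : (forall s' j, (j < P s')%N ->
      omega (ecol e s' j t) w = ((s' == u) && (n.+1 == j))%:R) ->
      omega (\sum_s' \sum_(j < P s') c s' j *: ecol e s' j t) w = c u n.+1.
    move=> H; rewrite linear_sumlz (bigD1 u) //= [X in _ + X]big1 ?addr0; last first.
      move=> s' s'u; rewrite linear_sumlz big1 // => k _.
      by rewrite linearZl_LR /= H // (negbTE s'u) mulr0.
    rewrite linear_sumlz (bigD1 (Ordinal un)) //= [X in _ + X]big1 ?addr0; last first.
      move=> k kj; rewrite linearZl_LR /= H // eqxx /=.
      by rewrite (_ : (n.+1 == k :> nat) = false) ?mulr0 //; rewrite eq_sym; apply/negbTE.
    by rewrite linearZl_LR /= H // !eqxx mulr1.
  rewrite (h _ (fun s' j => ff_coef F s n s' j t)); last first.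
    move=> s' j jP; rewrite omegaC (ff_derivE I_nd P_gt0 FF) ?opprK // 1?ltnW //.
    by rewrite eq_sym.
  by rewrite /ff_coef.
rewrite /half_coef; have [Q1 Q2] := Q s n u t sn un tI.
have [Q1' _] := Q u n s t un sn tI.
case: ltngtP => h.
- by rewrite mul0r Q1.
- by rewrite mul1r -E Q1' // subr0.
- by rewrite -E; have := Q2 h; lra.
Qed.

(** Column [n.+1] is determined by F' of column [n] and its coefficients: those in columns up to [n]
    are pairings of known vectors, those beyond [n.+1] vanish, and those in column [n.+1] are given
    by [half_coef]. *)
Lemma flat_frame_unique e F F' : flat_frame e F -> flat_frame e F' ->
  quasi_normal_coef F -> quasi_normal_coef F' ->
  forall s n t, (n < P s)%N -> t \in I -> F s n t = F' s n t.
Proof.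
move=> FF FF' Q Q' s n; elim/ltn_ind: n s => n IHn s t nP tI.
case: n nP IHn => [|n] nP IHn.
  have := ff_F0 FF' s tI; rewrite (ff_F0 FF) // => /(congr1 (fun w => eps s *: w)).
  by rewrite !scalerA eps2 !scale1r.
have nP' := ltnW nP.
have DE u : (n < P u)%N -> D (F u n) t = D (F' u n) t.
  by move=> nu; apply: (eq_vderive _ tI) => v vI; exact: IHn.
have := ff_structure I_nd omega_nd P_gt0 dimW FF nP' tI.
rewrite DE // (ff_structure I_nd omega_nd P_gt0 dimW FF' nP' tI) nP.
suff -> : \sum_u \sum_(j < P u) ff_coef F s n u j t *: ecol e u j t =
    \sum_u \sum_(j < P u) ff_coef F' s n u j t *: ecol e u j t.
  by move=> /addrI/oppr_inj ->.
apply: eq_bigr => u _; apply: eq_bigr => j _; congr (_ *: _); have ju := ltn_ord j.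
have [jn|jn|jn] := ltngtP (j : nat) n.+1.
- by rewrite /ff_coef DE // (IHn j) //.
- by rewrite (Q.1) // (Q'.1).
- have un : (n.+1 < P u)%N by rewrite -jn.
  rewrite jn (ff_coef_next FF Q) // (ff_coef_next FF' Q') // !DE //.
  exact: ltnW.
Qed.

End NormalFrames.

(** * Construction of the rows F over normal generators *)

Section FrameConstruction.
Context {R : realType} {W : vectType R} (I : interval R) (I_nd : nondegenerate_itv I).
Variables (omega : {skew_symmetric W}) (A : finType) (P : A -> nat) (eps : A -> R).
Hypothesis omega_nd : nondegenerate omega.
Hypothesis P_gt0 : forall s, (0 < P s)%N.
Hypothesis eps2 : forall s, eps s * eps s = 1.
Hypothesis dimW : \dim {:W} = (2 * \sum_s P s)%N.
Implicit Types (F : A -> nat -> R -> W) (s u : A) (k l j n : nat) (t : R).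
Variables (e : A -> R -> W) (ng : normal_gen I omega P eps xpredT e).
Local Notation D := (vderive I).
Local Notation E := (ecol I P e).
Local Notation flat_frame := (flat_frame I omega P eps).
Local Notation ff_normal := (ff_normal I omega P).
Local Notation ff_coef := (ff_coef I omega).

Lemma gen_smooth s : vsmooth I (e s).
Proof. exact: (@ng_smooth _ _ _ _ _ _ _ _ _ ng s isT). Qed.

Lemma colE_smooth s j : vsmooth I (E s j).
Proof. exact: (@vsmooth_iter _ _ _ (P s - j.+1) _ (@gen_smooth s)). Qed.

Lemma colEE s j u j' t : (j < P s)%N -> (j' < P u)%N -> t \in I -> omega (E s j t) (E u j' t) = 0.
Proof. by move=> js ju tI; apply: (ng_zero ng) => //; lia. Qed.

Lemma combo_delta (c : A -> nat -> R) t w u j0 z :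
  (forall s j, (j < P s)%N -> omega (E s j t) w = z * ((s == u) && (j == j0))%:R) ->
  omega (\sum_s \sum_(j < P s) c s j *: E s j t) w = if (j0 < P u)%N then c u j0 * z else 0.
Proof.
move=> H; rewrite linear_sumlz (bigD1 u) //= [X in _ + X]big1 ?addr0; last first.
  move=> s su; rewrite linear_sumlz big1 // => k _.
  by rewrite linearZl_LR /= H // (negbTE su) !mulr0.
rewrite linear_sumlz; case: ifP => j0u.
  rewrite (bigD1 (Ordinal j0u)) //= [X in _ + X]big1 ?addr0; last first.
    move=> k kj; rewrite linearZl_LR /= H // eqxx /=.
    by rewrite (_ : (k == j0 :> nat) = false) ?mulr0 //; apply/negbTE.
  by rewrite linearZl_LR /= H // !eqxx mulr1.
rewrite big1 // => k _; rewrite linearZl_LR /= H // eqxx /=.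
rewrite (_ : (k == j0 :> nat) = false) ?mulr0 //.
by apply/eqP => kj; have := ltn_ord k; rewrite kj j0u.
Qed.

(** The only coefficients that uniqueness permits. They involve the columns up to [n] only, so the
    structure equation can be read as a definition of column [n.+1]. *)
Definition next_coef F n s u j t : R :=
  if (j <= n)%N then omega (F u j t) (D (F s n) t)
  else if j == n.+1 then half_coef P s u * omega (D (F s n) t) (D (F u n) t) else 0.

Definition next_col F n s t : W :=
  - D (F s n) t + \sum_u \sum_(j < P u) next_coef F n s u j t *: E u j t.

(** A column needs all rows of the preceding ones, hence the recursion on whole tables; [Fcol] takes
    the diagonal. *)
Fixpoint cols n : A -> nat -> R -> W :=
  if n is n'.+1 then fun s j => if (j <= n')%N then cols n' s j else next_col (cols n') n' s
  else fun s _ t => eps s *: iter (P s) D (e s) t.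

Definition Fcol s j := cols j s j.

Lemma colsE n s j : (j <= n)%N -> cols n s j = Fcol s j.
Proof.
elim: n j => [|n IHn] j; first by rewrite leqn0 => /eqP ->.
rewrite leq_eqVlt => /orP[/eqP -> //|]; rewrite ltnS => jn /=.
by rewrite jn IHn.
Qed.

Lemma FcolS s n : Fcol s n.+1 = next_col Fcol n s.
Proof.
rewrite /Fcol /= ltnn; apply/funext => t; rewrite /next_col colsE //; congr (_ + _).
apply: eq_bigr => u _; apply: eq_bigr => j _; congr (_ *: _).
by rewrite /next_coef; case: ifP => jn; rewrite !colsE.
Qed.

(** Invariant of the recursion: smoothness and the Darboux relations for the columns F up to [n],
    against all columns E. *)
Definition upto n :=
  [/\ forall s j, (j <= n)%N -> (j < P s)%N -> vsmooth I (Fcol s j),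
      forall s j u j' t, (j <= n)%N -> (j < P s)%N -> (j' < P u)%N -> t \in I ->
        omega (Fcol s j t) (E u j' t) = ((s == u) && (j == j'))%:R &
      forall s j u j' t, (j <= n)%N -> (j' <= n)%N -> (j < P s)%N -> (j' < P u)%N ->
        t \in I -> omega (Fcol s j t) (Fcol u j' t) = 0].

Lemma upto0 : upto 0.
Proof.
split.
- move=> s j; rewrite leqn0 => /eqP -> _.
  exact: (vsmoothZ I_nd (@smoothf_cst _ _ I_nd (eps s)) (@vsmooth_iter _ _ _ (P s) _ (@gen_smooth s))).
- move=> s j u j' t; rewrite leqn0 => /eqP -> Ps ju tI.
  rewrite /Fcol /= linearZl_LR /= /ecol; have [Psu|/eqP Psu] := eqVneq (P s) (P u).
    rewrite (ng_eq ng) //; last by lia.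
    case: ifP => h.
      have -> : j' = 0%N by lia.
      by rewrite eqxx andbT addnn -muln2 exprM sqrr_sign mul1r mulrA eps2 mul1r.
    by rewrite mulr0 (_ : (0%N == j') = false) ?andbF //; apply/negP => /eqP j0; lia.
  rewrite (ng_neq ng) ?mulr0 //; [|exact/eqP|lia].
  by rewrite (_ : (s == u) = false) //; apply/negP => /eqP su; apply: Psu; rewrite su.
- move=> s j u j' t; rewrite !leqn0 => /eqP -> /eqP -> Ps Pu tI.
  rewrite /Fcol /= linearZl_LR linearZr_LR /= (ng_zero ng) ?mulr0 // => *; lia.
Qed.

Lemma upto_deriv n s u j t : upto n -> (n < P s)%N -> (j < P u)%N -> t \in I ->
  omega (D (Fcol s n) t) (E u j t) = - ((s == u) && (n.+1 == j))%:R.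
Proof.
move=> [sF FE FF] nP jP tI.
have := has_deriv_omega I_nd (omega := omega) tI (@sF s n (leqnn n) nP) (@colE_smooth u j).
move=> /(has_derivE I_nd tI); rewrite (@has_derivE _ _ I_nd _ _ 0) //; last first.
  apply: (has_deriv_eq _ tI (has_deriv_cst I_nd ((s == u) && (n == j))%:R tI)) => v vI.
  by rewrite FE.
move=> /eqP; rewrite eq_sym addr_eq0 => /eqP ->; congr (- _).
case: j jP => [|j] jP.
  rewrite (ecol0 I P_gt0) (_ : iter _ _ _ t = eps u *: Fcol u 0 t).
    by rewrite linearZr_LR /= FF // mulr0 andbF.
  by rewrite /Fcol /= scalerA eps2 scale1r.
by rewrite ecolS // FE ?eqSS // ltnW.
Qed.

Lemma next_coef_smooth n s u j : upto n -> (n < P s)%N -> (j < P u)%N ->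
  smoothf I (next_coef Fcol n s u j).
Proof.
move=> [sF _ _] nP jP.
have sD v : (n < P v)%N -> vsmooth I (D (Fcol v n)).
  by move=> nv; exact: vsmooth_derive (@sF v n (leqnn n) nv).
rewrite /next_coef; case: leqP => jn.
  exact: (smoothf_omega I_nd (@sF u j jn jP) (sD s nP)).
case: eqP => [jn1|_]; last exact: smoothf_cst.
have nu : (n < P u)%N by lia.
apply: (smoothfM I_nd (@smoothf_cst _ _ I_nd _)).
exact: (smoothf_omega I_nd (sD s nP) (sD u nu)).
Qed.

Lemma uptoS n : upto n -> upto n.+1.
Proof.
move=> H; have [sF FE FF] := H.
have ltS v : (n.+1 < P v)%N -> (n < P v)%N by exact: ltnW.
have combE (c : A -> nat -> R) u j t : (j < P u)%N -> t \in I ->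
    omega (\sum_s' \sum_(j' < P s') c s' j' *: E s' j' t) (E u j t) = 0.
  move=> jP tI; rewrite (combo_delta _ (z := 0) (u := u) (j0 := j)) => [|s' j' j'P].
    by case: ifP => _ //; rewrite mulr0.
  by rewrite colEE // mul0r.
have newE s u j t : (n.+1 < P s)%N -> (j < P u)%N -> t \in I ->
    omega (Fcol s n.+1 t) (E u j t) = ((s == u) && (n.+1 == j))%:R.
  move=> nP jP tI; rewrite FcolS linearDl linearNl /= (upto_deriv H (ltS _ nP)) //.
  by rewrite opprK (combE (fun u j => next_coef Fcol n s u j t)) // addr0.
have combF (c : A -> nat -> R) u j t : (j <= n)%N -> (j < P u)%N -> t \in I ->
    omega (\sum_s' \sum_(j' < P s') c s' j' *: E s' j' t) (Fcol u j t) = - c u j.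
  move=> jn jP tI; rewrite (combo_delta _ (z := -1) (u := u) (j0 := j)) => [|s' j' j'P].
    by rewrite jP mulrN1.
  by rewrite omegaC FE // mulN1r eq_sym (eq_sym j).
have combD (c : A -> nat -> R) u t : (n.+1 < P u)%N -> t \in I ->
    omega (\sum_s' \sum_(j' < P s') c s' j' *: E s' j' t) (D (Fcol u n) t) = c u n.+1.
  move=> nP tI; rewrite (combo_delta _ (z := 1) (u := u) (j0 := n.+1)) => [|s' j' j'P].
    by rewrite nP mulr1.
  by rewrite omegaC (upto_deriv H (ltS _ nP)) // opprK mul1r eq_sym (eq_sym j').
have newF s u j t : (n.+1 < P s)%N -> (j <= n)%N -> (j < P u)%N -> t \in I ->
    omega (Fcol s n.+1 t) (Fcol u j t) = 0.
  move=> nP jn jP tI; rewrite FcolS linearDl linearNl /=.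
  rewrite (combF (fun u j => next_coef Fcol n s u j t)) // /next_coef jn.
  by rewrite -omegaC subrr.
(* Isotropy inside the new column reduces to [half_coef s u + half_coef u s = 1]. *)
have newNew s u t : (n.+1 < P s)%N -> (n.+1 < P u)%N -> t \in I ->
    omega (Fcol s n.+1 t) (Fcol u n.+1 t) = 0.
  move=> ns nu tI; rewrite {1}FcolS linearDl linearNl /=.
  have EF v : (n.+1 < P v)%N -> forall w (c : A -> nat -> R),
      w = \sum_s' \sum_(j' < P s') c s' j' *: E s' j' t ->
      omega w (Fcol v n.+1 t) = - c v n.+1.
    move=> nv w c ->; rewrite (combo_delta _ (z := -1) (u := v) (j0 := n.+1)) => [|s' j' j'P].
      by rewrite nv mulrN1.
    by rewrite omegaC newE // mulN1r eq_sym (eq_sym j').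
  rewrite (EF u nu _ (fun u j => next_coef Fcol n s u j t) erefl).
  have -> : omega (D (Fcol s n) t) (Fcol u n.+1 t) =
      - omega (D (Fcol s n) t) (D (Fcol u n) t) - next_coef Fcol n u s n.+1 t.
    rewrite FcolS linearDr linearNr /=; congr (_ + _).
    by rewrite omegaC (combD (fun u' j => next_coef Fcol n u u' j t)).
  rewrite /next_coef ltnn eqxx (omegaC omega (D (Fcol u n) t)).
  have := @half_coefD R _ P s u; move: (half_coef P s u) (half_coef P u s) => a b ab.
  by have -> : a = 1 - b; [lra | ring].
split.
- move=> s j; rewrite leq_eqVlt => /orP[/eqP ->|]; last by rewrite ltnS; exact: sF.
  move=> nP; rewrite FcolS.
  have sD : vsmooth I (D (Fcol s n)) by exact: vsmooth_derive (@sF s n (leqnn n) (ltS _ nP)).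
  apply: (vsmoothD I_nd (vsmoothN I_nd sD)).
  apply: (vsmooth_sum I_nd) => u _; apply: (vsmooth_sum I_nd) => j' _.
  exact: (vsmoothZ I_nd (next_coef_smooth H (ltS _ nP) (ltn_ord j')) (@colE_smooth u j')).
- move=> s j u j' t; rewrite leq_eqVlt => /orP[/eqP ->|]; first exact: newE.
  by rewrite ltnS; exact: FE.
- move=> s j u j' t; rewrite leq_eqVlt => /orP[/eqP ->|].
    rewrite leq_eqVlt => /orP[/eqP ->|]; first exact: newNew.
    by rewrite ltnS => j'n jP j'P tI; exact: newF.
  rewrite ltnS => jn; rewrite leq_eqVlt => /orP[/eqP ->|]; last by rewrite ltnS; exact: FF.
  by move=> jP j'P tI; rewrite omegaC newF // oppr0.
Qed.

Lemma uptoP n : upto n.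
Proof. by elim: n => [|n IHn]; [exact: upto0 | exact: uptoS]. Qed.

Lemma Fcol_frame : flat_frame e Fcol.
Proof.
split.
- exact: gen_smooth.
- by move=> s j jP; have [sF _ _] := uptoP j; exact: (@sF s j (leqnn j) jP).
- exact: colEE.
- move=> s j u j' t js ju tI; have [_ _ FF] := uptoP (maxn j j').
  by apply: FF => //; rewrite ?leq_maxl ?leq_maxr.
- by move=> s j u j' t js ju tI; have [_ FE _] := uptoP j; apply: FE.
- by move=> s t tI; rewrite /Fcol /= scalerA eps2 scale1r.
Qed.

Lemma Fcol_coef s n u j t : (n.+1 < P s)%N -> (j < P u)%N -> t \in I ->
  ff_coef Fcol s n u j t = next_coef Fcol n s u j t.
Proof.
move=> nP jP tI; rewrite /ff_coef.
have -> : D (Fcol s n) t =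
    \sum_u \sum_(j < P u) next_coef Fcol n s u j t *: E u j t - Fcol s n.+1 t.
  by rewrite FcolS /next_col opprD opprK addrCA subrr addr0.
have FF := Fcol_frame; rewrite linearBr /= (ff_FF FF) // subr0 omegaC.
rewrite (combo_delta (fun u j => next_coef Fcol n s u j t) (z := -1) (u := u) (j0 := j)) => [|s' j' j'P].
  by rewrite jP mulrN1 opprK.
by rewrite (ff_EF FF) // mulN1r.
Qed.

Lemma Fcol_quasi_normal : quasi_normal_coef I omega P Fcol.
Proof.
split=> [s n u j t nP jP nj tI|s n u t ns nu tI].
  by rewrite Fcol_coef // /next_coef leqNgt (ltnW nj) /= gtn_eqF.
rewrite !Fcol_coef // /next_coef ltnn eqxx /half_coef; split=> [->|->]; first by rewrite mul0r.
by rewrite ltnn eqxx -mulrN -omegaC.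
Qed.

(** [below] together with the leading order [P s + n] of the row itself. *)
Definition lead s n u k :=
  (k + (P s - P u) + (P u - P s) < P u + n)%N \/ (u = s /\ k = (P s + n)%N).

Lemma lead_deriv s n x : cspan I e (lead s n) x -> cspan I e (lead s n.+1) (D x).
Proof.
apply: (cspan_deriv I_nd gen_smooth) => u k [H|[-> ->]]; rewrite /lead; last first.
  by split; [left; rewrite subnn; lia | right; rewrite addnS].
by split; left; lia.
Qed.

(* The triangle inequality for [|P s - P u|]. *)
Lemma lead_pair s a u b x y t : (a + b < (P s - P u) + (P u - P s))%N -> t \in I ->
  cspan I e (lead s a) x -> cspan I e (lead u b) y -> omega (x t) (y t) = 0.
Proof.
move=> ab tI Hx Hy; apply: (cspan_vanish tI Hx) => s' k Hk.
rewrite omegaC (cspan_vanish tI Hy) ?oppr0 // => u' l Hl.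
apply: (ng_zero ng) => //; rewrite /lead in Hk Hl.
  case: Hk => [Hk|[-> ->]]; case: Hl => [Hl|[-> ->]]; lia.
case: Hk => [Hk|[-> ->]]; case: Hl => [Hl|[-> ->]]; lia.
Qed.

(** The shape of F and the vanishing of coefficients are proved together. Coefficients of earlier
    columns are pairings of curves of known shape, which vanish for small sums of indices by
    [lead_pair], and this is what [F_below] needs for column [n]. *)
Lemma Fcol_lead s n : (n < P s)%N -> cspan I e (lead s n) (Fcol s n).
Proof.
elim/ltn_ind: n s => n IHn s nP; have FF := Fcol_frame.
have H : cspan I e (below P s n)
    (fun t => Fcol s n t - ((-1) ^+ n * eps s) *: iter (P s + n) D (e s) t).
  apply: (F_below I_nd omega_nd P_gt0 eps2 dimW FF) => // n' u j t lt jP dist tI.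
  have n'P : (n'.+1 < P s)%N by lia.
  have Ls := lead_deriv (IHn _ lt s (ltnW n'P)).
  rewrite Fcol_coef // /next_coef; case: leqP => jn'.
    apply: (lead_pair _ tI (IHn j _ u jP) Ls); lia.
  case: eqP => // jE; have n'u : (n' < P u)%N by lia.
  by rewrite (lead_pair _ tI Ls (lead_deriv (IHn _ lt u n'u))) ?mulr0 //; lia.
have H1 : cspan I e (lead s n) (fun t => ((-1) ^+ n * eps s) *: iter (P s + n) D (e s) t).
  by apply: (cspan_Z (@smoothf_cst _ _ I_nd _)); apply: cspan_gen; right.
have H2 : cspan I e (lead s n)
    (fun t => Fcol s n t - ((-1) ^+ n * eps s) *: iter (P s + n) D (e s) t).
  by apply: cspan_sub H => u k Hk; left.
by apply: (cspan_eq _ (cspan_D H2 H1)) => t tI; rewrite subrK.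
Qed.

Lemma Fcol_normal : ff_normal Fcol.
Proof.
move=> s n u j t nP jP lt tI.
apply: (lead_pair _ tI (Fcol_lead jP) (lead_deriv (Fcol_lead nP))); lia.
Qed.

End FrameConstruction.

(** * Two families of normal generators of the same curve *)

Section ChangeOfGenerators.
Context {R : realType} {W : vectType R} (I : interval R) (I_nd : nondegenerate_itv I).
Variables (omega : {skew_symmetric W}) (A : finType) (P : A -> nat) (eps : A -> R).
Hypothesis P_gt0 : forall s, (0 < P s)%N.
Hypothesis eps2 : forall s, eps s * eps s = 1.
Variable L : R -> {vspace W}.
Hypothesis L_dim : forall t, t \in I -> \dim (L t) = (\sum_s P s)%N.
Hypothesis L_isotropic : forall t v w, t \in I -> v \in L t -> w \in L t -> omega v w = 0.
Implicit Types (e : A -> R -> W) (s u : A) (k l j n q : nat) (t : R).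
Local Notation D := (vderive I).

Definition gen_of e := normal_gen I omega P eps xpredT e /\
  forall s k t, (k < P s)%N -> t \in I -> iter k D (e s) t \in L t.

Let gen_of_smooth e s (H : gen_of e) : vsmooth I (e s).
Proof. by have [ng _] := H; exact: (@ng_smooth _ _ _ _ _ _ _ _ _ ng s isT). Qed.

Definition nat_coef (c : {s : A & 'I_(P s)} -> R) s k : R :=
  if insub k is Some k' then c (Tagged (fun s => 'I_(P s)) (k' : 'I_(P s))) else 0.

Lemma nat_coefE c (b : {s : A & 'I_(P s)}) :
  nat_coef c (tag b) (tagged b : 'I_(P (tag b))) = c b.
Proof. by rewrite /nat_coef valK; case: b. Qed.

Lemma gen_span e t v : gen_of e -> t \in I -> v \in L t ->
  exists c : A -> nat -> R, v = \sum_s \sum_(k < P s) c s k *: iter k D (e s) t.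
Proof.
move=> [ng eL] tI vL; pose T : finType := {s : A & 'I_(P s)}.
pose x (a : T) := iter (tagged a) D (e (tag a)) t.
have sumT (c : A -> nat -> R) : \sum_(a : T) c (tag a) (tagged a) *: x a =
    \sum_s \sum_(k < P s) c s k *: iter k D (e s) t.
  by rewrite (sig_big_dep xpredT (fun _ => xpredT) (fun s (k : 'I_(P s)) => c s k *: iter k D (e s) t)).
have d : \dim (\sum_a <[x a]>)%VS = #|T|.
  apply: free_family => c c0 a.
  pose c' := nat_coef c.
  have c'E (b : T) : c' (tag b) (tagged b : 'I_(P (tag b))) = c b by exact: nat_coefE.
  rewrite -c'E; apply: (gen_independent eps2 ng tI (c := c')) => // u j _ jP.
  rewrite -sumT (eq_bigr (fun b => c b *: x b)) ?c0 ?linear0l // => b _.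
  by rewrite c'E.
have EL : (\sum_a <[x a]>)%VS = L t.
  apply/eqP; rewrite eqEdim d L_dim //; apply/andP; split.
    by apply/subv_sumP => a _; rewrite -memvE eL.
  rewrite card_tagged sumnE big_map big_enum /= leq_sum // => s _.
  by rewrite card_ord.
rewrite -EL in vL; have /memv_sumP[y yv ->] := vL.
have /fin_all_exists[c Hc] : forall a : T, exists c, y a = c *: x a.
  by move=> a; apply/vlineP/yv.
exists (nat_coef c); rewrite -sumT; apply: eq_bigr => b _.
by rewrite Hc nat_coefE.
Qed.

(** For generators of different families only the isotropy of [L] is available at first; it covers
    orders up to P s + P u - 2. *)
Lemma gen_cross_low e e' s u b t : gen_of e -> gen_of e' -> (b + 2 <= P s + P u)%N -> t \in I ->
  omega (e' s t) (iter b D (e u) t) = 0.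
Proof.
move=> H H' bP tI; have [ng eL] := H; have [ng' eL'] := H'.
have Ps := P_gt0 s; have Pu := P_gt0 u.
have [h|h] := ltnP b (P u).
  by apply: (L_isotropic tI); [exact: (eL' s 0%N) | exact: eL].
rewrite omegaC (_ : b = (b - (P u).-1) + (P u).-1)%N; last by lia.
rewrite iterD; have sx := @vsmooth_iter _ _ _ (P u).-1 _ (@gen_of_smooth e u H).
rewrite (@pairing_low _ _ _ I_nd _ _ _ (P s) sx (@gen_of_smooth e' s H') _ _ 0) ?oppr0 //; last by lia.
move=> c v cP vI; apply: (L_isotropic vI); [apply: eL => //; lia | exact: eL'].
Qed.

(** Expand [e' s] in the basis of [L] given by [e]. The low pairings remove shorter rows and all
    proper derivatives in rows of length [q]. In longer rows the generators are constant
    combinations of those of [e'], by hypothesis, so their derivatives satisfy the normal relations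
    with [e' s]. *)
Lemma gen_change_pointwise e e' q : gen_of e -> gen_of e' ->
  (forall w, (q < P w)%N -> exists V : A -> R, forall t, t \in I ->
    e w t = \sum_(w' | P w' == P w) V w' *: e' w' t) ->
  forall s, P s = q -> forall t, t \in I ->
    exists c : A -> R, e' s t = \sum_(u | P u == q) c u *: e u t.
Proof.
move=> H H' IH s Psq t tI; have [ng eL] := H; have [ng' eL'] := H'.
have [c cE] := gen_span H tI (eL' s 0%N t (P_gt0 s) tI); rewrite /= in cE.
have c0 u j : (j < P u)%N -> (j + 2 <= P s)%N -> c u (P u - j.+1)%N = 0.
  move=> jP js; apply: (gen_triangular eps2 (j0 := (P s - 2)%N) ng tI) => //; last by lia.
  by move=> u' j' _ j'P j's; rewrite -cE (gen_cross_low H H') //; lia.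
have ck u k : (k < P u)%N -> (P u - P s < k)%N -> c u k = 0.
  by move=> kP lt; rewrite (_ : k = P u - (P u - k.+1).+1)%N ?c0 //; lia.
pose B u := (q < P u)%N.
have cl u k : ~~ (q <= P u)%N -> (k < P u)%N -> c u k = 0.
  by rewrite -ltnNge => h kP; rewrite (_ : k = P u - (P u - k.+1).+1)%N ?c0 //; lia.
have split : e' s t = \sum_(u | P u == q) c u 0%N *: e u t +
    \sum_(u | B u) \sum_(k < P u) c u k *: iter k D (e u) t.
  rewrite cE (bigID (fun u => P u == q)) /=; congr (_ + _).
    apply: eq_bigr => u /eqP Puq; have Pu := P_gt0 u.
    rewrite (bigD1 (Ordinal Pu)) //= big1 ?addr0 // => k kn0.
    have {}kn0 : (k : nat) != 0%N by apply: contraNneq kn0 => k0; apply/eqP/val_inj.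
    by rewrite ck ?scale0r //; lia.
  rewrite (bigID B) /= [X in _ + X]big1 ?addr0; last first.
    move=> u /andP[neq nB]; apply: big1 => k _; rewrite cl ?scale0r // -ltnNge.
    by rewrite ltn_neqAle neq leqNgt.
  by apply: eq_bigl => u; rewrite /B; case: ltngtP.
have cB u k : B u -> (k < P u)%N -> c u k = 0.
  have ngB : normal_gen I omega P eps B e.
    by split=> [v _||]; [exact: gen_of_smooth | move=> *; exact: (ng_neq ng) | move=> *; exact: (ng_eq ng)].
  move=> Bu kP; apply: (gen_independent eps2 ngB tI (c := c)) => // w j Bw jP.
  have -> : \sum_(u | B u) \sum_(k < P u) c u k *: iter k D (e u) t =
      e' s t - \sum_(u | P u == q) c u 0%N *: e u t by rewrite split addrC addKr.
  have lt : (P w + j < 2 * P w)%N by lia.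
  rewrite linearBl /= [X in _ - X](_ : _ = 0) ?subr0; last first.
    rewrite linear_sumlz big1 // => u' /eqP Pu'; rewrite linearZl_LR /=.
    by rewrite (@ng_zero _ _ _ _ _ _ _ _ _ u' w 0 _ _ ng) ?mulr0 //; rewrite /B in Bw; lia.
  have [V HV] := IH w Bw.
  rewrite (iter_vderive_eq (P w + j) HV tI).
  rewrite (iter_vderive_sum I_nd) //; last by move=> w' _; exact: gen_of_smooth.
  rewrite linear_sumr big1 // => w' /eqP Pw'; rewrite linearZr_LR /=.
  by rewrite (@ng_zero _ _ _ _ _ _ _ _ _ s w' 0 _ _ ng') ?mulr0 //; rewrite /B in Bw; lia.
exists (c ^~ 0%N); rewrite split [X in _ + X]big1 ?addr0 // => u Bu.
by apply: big1 => k _; rewrite cB ?scale0r.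
Qed.

(** The coefficients are, up to sign, the pairings [g] of order 2q - 1, and the derivative of [g] is
    expressed by pairings of order 2q. *)
Lemma gen_change_const e e' q : gen_of e -> gen_of e' ->
  (forall s, P s = q -> forall t, t \in I ->
    exists c : A -> R, e' s t = \sum_(u | P u == q) c u *: e u t) ->
  (forall s, P s = q -> forall t, t \in I ->
    exists c : A -> R, e s t = \sum_(u | P u == q) c u *: e' u t) ->
  forall s, P s = q -> exists U : A -> R, forall t, t \in I ->
    e' s t = \sum_(u | P u == q) U u *: e u t.
Proof.
move=> H H' Pe' Pe s Psq; have [ng eL] := H; have [ng' eL'] := H'.
have q0 : (0 < q)%N by rewrite -Psq.
pose n := (2 * q).-1; have nE : n.+1 = (2 * q)%N by rewrite /n; lia.
pose g u t := omega (e' s t) (iter n D (e u) t).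
have cE u t c : P u = q -> t \in I -> e' s t = \sum_(u | P u == q) c u *: e u t ->
    g u t = (-1) ^+ q * eps u * c u.
  move=> Puq tI E; rewrite /g E linear_sumlz (bigD1 u) /=; last by rewrite Puq.
  rewrite [X in _ + X]big1 ?addr0 => [|u' /andP[/eqP Pu' neq]].
    rewrite linearZl_LR /= (@ng_eq _ _ _ _ _ _ _ _ _ ng u u 0) // Puq; last by lia.
    by rewrite add0n nE eqxx addn0 eqxx mulr1 mulrC.
  rewrite linearZl_LR /= (@ng_eq _ _ _ _ _ _ _ _ _ ng u' u 0) // ?Pu' //; last by lia.
  by rewrite (negbTE neq) mulr0; case: ifP => _; rewrite mulr0.
have gconst u : P u = q -> forall t, t \in I -> has_deriv I (g u) t 0.
  move=> Puq t tI; have sx := @gen_of_smooth e' s H'; have sy := @gen_of_smooth e u H.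
  have low b v : (b < n)%N -> v \in I -> omega (e' s v) (iter b D (e u) v) = 0.
    by move=> bn vI; apply: (gen_cross_low H H') => //; lia.
  have h : (2 * q + 0)%N = n.+1 by rewrite addn0 nE.
  (* All 2q derivatives are put on one side, so that the other argument is undifferentiated and may
     be replaced by its expansion at [t]. Each extreme pairing then becomes one inside a single
     family and vanishes. *)
  have := pairing_shift2 I_nd sx sy low h tI; rewrite exprM sqrrN !expr1n mul1r [iter 0 D (e u) t]/=.
  have [c' ->] := Pe u Puq t tI.
  rewrite linear_sumr big1 => [|u' /eqP Pu']; last first.
    rewrite linearZr_LR /= (@ng_zero _ _ _ _ _ _ _ _ _ s u' _ 0 _ ng') ?mulr0 //; lia.
  have [c ->] := Pe' s Psq t tI.
  rewrite linear_sumlz big1 => [|u' /eqP Pu']; last first.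
    rewrite linearZl_LR /= (_ : omega (e u' t) _ = 0) ?mulr0 //.
    by apply: (@ng_zero _ _ _ _ _ _ _ _ _ u' u 0 n.+1 t ng) => //; lia.
  rewrite sub0r => /esym/eqP; rewrite oppr_eq0 mulf_eq0 pnatr_eq0.
  rewrite (_ : (2 * q == 0)%N = false) /=; last by lia.
  have sg : smoothf I (g u).
    exact: (smoothf_omega I_nd sx (@vsmooth_iter _ _ _ n _ sy)).
  by move=> /eqP <-; exact: smoothf_has_deriv.
have [t0 t0I] : exists t0, t0 \in I by have [a [b [aI _ _]]] := I_nd; exists a.
exists (fun u => (-1) ^+ q * eps u * g u t0) => t tI.
have [c cE'] := Pe' s Psq t tI; rewrite {1}cE'; apply: eq_bigr => u /eqP Puq.
congr (_ *: _); rewrite (has_deriv0_cst I_nd t0I tI (gconst u Puq)) (cE u t c) //.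
by rewrite !mulrA [(-1) ^+ q * eps u * _]mulrAC -expr2 sqrr_sign mul1r eps2 mul1r.
Qed.

Theorem gen_change e e' : gen_of e -> gen_of e' ->
  exists U : A -> A -> R, (forall s t, t \in I ->
    e' s t = \sum_(u | P u == P s) U u s *: e u t) /\
  (forall s s', P s = P s' ->
    \sum_(u | P u == P s) eps u * U u s * U u s' = eps s * (s == s')%:R).
Proof.
move=> H H'; have [ng eL] := H; have [ng' eL'] := H'.
have both s : (exists U : A -> R, forall t, t \in I -> e' s t = \sum_(u | P u == P s) U u *: e u t) /\
    (exists U : A -> R, forall t, t \in I -> e s t = \sum_(u | P u == P s) U u *: e' u t).
  (* Descending induction on the length of the row, in both directions at once, because the
     constancy of one change uses the expansion of the other. *)
  pose M := (\max_u P u)%N; have PM u : (P u <= M)%N by exact: leq_bigmax.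
  move: {2}(M - P s)%N (erefl (M - P s)%N) => k.
  elim/ltn_ind: k s => k IHk s kE.
  have IH w : (P s < P w)%N -> _ := fun lt => IHk (M - P w)%N ltac:(have := PM w; have := PM s; lia) w erefl.
  have p1 : forall s', P s' = P s -> forall t, t \in I ->
      exists c : A -> R, e' s' t = \sum_(u | P u == P s) c u *: e u t.
    by apply: (gen_change_pointwise H H') => w /IH[_].
  have p2 : forall s', P s' = P s -> forall t, t \in I ->
      exists c : A -> R, e s' t = \sum_(u | P u == P s) c u *: e' u t.
    by apply: (gen_change_pointwise H' H) => w /IH[].
  by split; [apply: (gen_change_const H H' p1 p2) | apply: (gen_change_const H' H p2 p1)].
have /choice[U HU] : forall s, exists U : A -> R, forall t, t \in I ->
    e' s t = \sum_(u | P u == P s) U u *: e u t by move=> s; have [] := both s.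
exists (fun u s => U s u); split=> // s s' Pss'.
have [t tI] : exists t, t \in I by have [a [b [aI _ _]]] := I_nd; exists a.
have q0 := P_gt0 s; pose n := (2 * P s).-1; have nE : n.+1 = (2 * P s)%N by rewrite /n; lia.
have := @ng_eq _ _ _ _ _ _ _ _ _ ng' s s' 0 n t isT isT Pss' _ tI.
rewrite add0n nE eqxx addn0 => /(_ ltac:(lia)).
rewrite /= (iter_vderive_eq n (HU s') tI) (iter_vderive_sum I_nd) //; last first.
  by move=> u _; exact: gen_of_smooth.
rewrite (HU s t tI) linear_sumlz => E.
apply: (@mulfI _ ((-1) ^+ P s)); first by rewrite expf_eq0 oppr_eq0 oner_eq0 andbF.
rewrite mulrA -E mulr_sumr; apply: eq_bigr => u /eqP Pu.
rewrite /= [RHS]linearZl_LR /= linear_sumr (bigD1 u) /=; last by rewrite Pu Pss'.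
have ngu u' : P u' = P s -> omega (e u t) (iter n D (e u') t) = (-1) ^+ P s * eps u * (u == u')%:R.
  move=> Pu'; have le : (0 + n <= 2 * P u)%N by rewrite Pu; lia.
  have := ng_eq ng isT isT (etrans Pu (esym Pu')) le tI.
  by rewrite /= add0n Pu nE eqxx addn0.
rewrite [X in _ + X]big1 ?addr0 => [|u' /andP[/eqP Pu' neq]].
  by rewrite [omega _ _]linearZr_LR /= ngu // eqxx mulr1; ring.
by rewrite [LHS]linearZr_LR /= ngu ?Pu' // eq_sym (negbTE neq) !mulr0.
Qed.

End ChangeOfGenerators.

(** * Quadratic forms *)

Section QuadraticForms.
Context {R : realType}.

(* Positive vectors are chosen as long as there are any, so that the signs come
   out sorted. *)
Lemma sylvester n (G : 'M[R]_n) : G^T = G -> G \in unitmx ->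
  exists (T : 'M[R]_n) s, (s <= n)%N /\ T *m G *m T^T = sig_mx n s.
Proof.
move=> Gs Gu; pose f (u w : 'rV[R]_n) : R := (u *m G *m w^T) 0 0.
have fC u w : f u w = f w u.
  rewrite /f -[in LHS](trmxK (u *m G *m w^T)) [LHS]mxE !trmx_mul trmxK Gs.
  by rewrite mulmxA.
have fDl u u' w a : f (a *: u + u') w = a * f u w + f u' w.
  by rewrite /f !mulmxDl -!scalemxAl !mxE.
have fDr u u' w a : f w (a *: u + u') = a * f w u + f w u' by rewrite fC fDl !(fC _ w).
have f0l w : f 0 w = 0 by rewrite /f !mul0mx mxE.
have suml k (c : 'I_k -> R) (v : nat -> 'rV_n) w :
    f (\sum_(i < k) c i *: v i) w = \sum_(i < k) c i * f (v i) w.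
  elim: k c v => [|k IHk] c v; first by rewrite !big_ord0 f0l.
  rewrite !big_ord_recl fDl; congr (_ + _).
  exact: (IHk (fun i => c (lift ord0 i)) (fun j => v j.+1)).
have nd w : (forall u, f w u = 0) -> w = 0.
  move=> H; rewrite -[w](mulmxK Gu) (_ : w *m G = 0) ?mul0mx //.
  by apply/rowP => i; rewrite [RHS]mxE -[RHS](H (delta_mx 0 i)) /f trmx_delta -colE [RHS]mxE.
pose sg s i : R := if (i < s)%N then 1 else -1.
have sg2 s i : sg s i * sg s i = 1 by rewrite /sg; case: ifP => _; rewrite ?mulr1 ?mulrNN ?mulr1.
have step k : (k <= n)%N -> exists (v : nat -> 'rV[R]_n) s, [/\ (s <= k)%N,
    forall i j, (i < k)%N -> (j < k)%N -> f (v i) (v j) = sg s i * (i == j)%:R &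
    (s < k)%N -> forall w, (forall i, (i < k)%N -> f w (v i) = 0) -> f w w <= 0].
  elim: k => [|k IHk] kn; first by exists (fun=> 0), 0%N.
  have [v [s [sk vv neg]]] := IHk (ltnW kn).
  pose C w := forall i, (i < k)%N -> f w (v i) = 0.
  (* Otherwise, by polarisation, the form would vanish on the complement [C] of the vectors chosen
     so far. This would put [C] in the radical, although [C] is nonzero since [k < n]. *)
  have [w [Cw ww]] : exists w, C w /\ f w w != 0.
    apply: contrapT => /forallNP H.
    have q0 w : C w -> f w w = 0.
      by move=> Cw; apply/eqP; apply: contrapT => /negP ww; exact: (H w).
    have CC u w : C u -> C w -> f u w = 0.
      move=> Cu Cw; have Cuw : C (1 *: u + w) by move=> i ik; rewrite fDl Cu // Cw // mulr0 addr0.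
      have := q0 _ Cuw; rewrite fDl !fDr q0 // q0 // (fC w u); lra.
    have C0 w : C w -> w = 0.
      move=> Cw; apply: nd => u.
      pose z := \sum_(i < k) (sg s i * f u (v i)) *: v i.
      have Cz : C (-1 *: z + u).
        move=> i ik; rewrite fDl suml (bigD1 (Ordinal ik)) //= big1 => [|j ji].
          by rewrite vv // eqxx mulr1 addr0 mulrAC sg2 mul1r; ring.
        rewrite vv // (_ : (j == i :> nat) = false) ?mulr0 //; apply/negbTE.
        by apply: contraNneq ji => ?; apply/eqP/val_inj.
      have := CC _ _ Cz Cw; rewrite (fC w u) fDl suml big1 ?mulr0 ?add0r // => i _.
      by rewrite (fC (v i) w) Cw // mulr0.
    pose M : 'M[R]_(n, k) := \matrix_(i, j) (G *m (v j)^T) i 0.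
    have : kermx M != 0.
      rewrite -mxrank_eq0 mxrank_ker -lt0n subn_gt0.
      by rewrite (leq_ltn_trans (rank_leq_col _)).
    move=> /rowV0Pn[w /sub_kermxP wM w0]; move/eqP: w0; apply; apply: C0 => i ik.
    have := congr1 (fun X : 'rV_k => X 0 (Ordinal ik)) wM; rewrite [RHS]mxE => <-.
    rewrite /f -mulmxA [LHS]mxE [RHS]mxE; apply: eq_bigr => j _; congr (_ * _).
    by rewrite [RHS]mxE.
  have [w' [Cw' ww' pos]] : exists w, [/\ C w, f w w != 0 &
      f w w < 0 -> forall u, C u -> f u u <= 0].
    have [[u [Cu uu]]|no] := pselect (exists u, C u /\ 0 < f u u).
      by exists u; rewrite gt_eqF //; split=> // /(lt_trans uu); rewrite ltxx.
    exists w; split=> // _ u Cu; rewrite leNgt; apply/negP => uu.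
    by apply: no; exists u.
  pose c := (Num.sqrt `|f w' w'|)^-1; pose x := c *: w'.
  have c2 : c * c * `|f w' w'| = 1.
    have h : Num.sqrt `|f w' w'| != 0 by rewrite gt_eqF // sqrtr_gt0 normr_gt0.
    rewrite /c -invfM -expr2 sqr_sqrtr ?normr_ge0 // mulVf //.
    by rewrite normr_eq0.
  have xE u : f x u = c * f w' u by have := fDl w' 0 u c; rewrite f0l !addr0.
  have xx : f x x = Num.sg (f w' w').
    rewrite xE fC xE mulrA.
    case: (ltrgtP (f w' w') 0) ww' => // h _.
      by rewrite ltr0_sg // -c2 ltr0_norm //; ring.
    by rewrite gtr0_sg // -c2 gtr0_norm.
  pose v' i := if i == k then x else v i.
  have v'E i : (i < k)%N -> v' i = v i by move=> ik; rewrite /v' ltn_eqF.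
  have v'k : v' k = x by rewrite /v' eqxx.
  have xv i : (i < k)%N -> f x (v i) = 0 by move=> ik; rewrite xE Cw' // mulr0.
  have gram s' : (forall i, (i < k)%N -> sg s' i = sg s i) -> sg s' k = f x x ->
      forall i j, (i < k.+1)%N -> (j < k.+1)%N -> f (v' i) (v' j) = sg s' i * (i == j)%:R.
    move=> h1 h2 i j; rewrite !ltnS leq_eqVlt => /orP[/eqP ->|ik];
      rewrite leq_eqVlt => /orP[/eqP ->|jk].
    - by rewrite v'k eqxx mulr1 h2.
    - by rewrite v'k v'E // xv // gtn_eqF // mulr0.
    - by rewrite v'k v'E // fC xv // ltn_eqF // mulr0.
    - by rewrite !v'E // vv // h1.
  have C' u : (forall i, (i < k.+1)%N -> f u (v' i) = 0) -> C u.
    by move=> H i ik; rewrite -v'E // H // ltnW.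
  have [ww0|ww0] := ltrP (f w' w') 0.
    exists v', s; split; first exact: leqW.
      by apply: gram => //; rewrite /sg ltnNge sk xx ltr0_sg.
    by move=> _ u /C'; exact: pos.
  (* A positive vector is still available only if no negative one was taken before. *)
  have ks : s = k.
    apply/eqP; rewrite eqn_leq sk leqNgt; apply/negP => sk'.
    by have := neg sk' _ Cw'; rewrite leNgt lt_neqAle eq_sym ww' ww0.
  exists v', k.+1; split=> //; last by rewrite ltnn.
  apply: gram; last by rewrite /sg ltnSn xx gtr0_sg // lt_neqAle eq_sym ww'.
  by move=> i ik; rewrite /sg ks ik ltnW.
have [v [s [sn vv _]]] := step n (leqnn n).
exists (\matrix_i v i), s; split=> //; apply/matrixP => i j.
have -> : ((\matrix_i v i) *m G *m (\matrix_i v i)^T) i j = f (v i) (v j).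
  rewrite /f mxE [RHS]mxE; apply: eq_bigr => a _; congr (_ * _); last by rewrite !mxE.
  rewrite mxE [RHS]mxE; apply: eq_bigr => b _; congr (_ * _).
  by rewrite mxE.
by rewrite vv // !mxE mulr_natr.
Qed.

Context {W : vectType R}.
Variables (q : W -> R) (L V : {vspace W}) (T : finType) (y : T -> W) (Z : {vspace W}).
Hypothesis VL : (V <= L)%VS.
Hypothesis polar_lin : forall a u v w, u \in L -> v \in L -> w \in L ->
  polar q (a *: u + v) w = a * polar q u w + polar q v w.
Hypothesis polar_sym : forall u v, polar q u v = polar q v u.
Hypothesis yL : forall i, y i \in L.
Hypothesis ZL : (Z <= L)%VS.
Hypothesis Zrad : forall z w, z \in Z -> w \in L -> polar q z w = 0.
Hypothesis Vspan : (V <= \sum_i <[y i]> + Z)%VS.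

Lemma polar0 w : w \in L -> polar q 0 w = 0.
Proof.
by move=> wL; have := polar_lin 1 (mem0v L) (mem0v L) wL; rewrite scaler0 addr0; lra.
Qed.

Lemma polar_suml (J : finType) (c : J -> R) (x : J -> W) w : (forall j, x j \in L) -> w \in L ->
  polar q (\sum_j c j *: x j) w = \sum_j c j * polar q (x j) w.
Proof.
move=> xL wL; elim: (index_enum J) => [|a r IHr]; first by rewrite !big_nil polar0.
by rewrite !big_cons polar_lin // ?IHr //; apply: memv_suml => j _; exact: memvZ.
Qed.

Lemma span_coef v : v \in V -> exists c : T -> R, exists2 z, z \in Z & v = \sum_i c i *: y i + z.
Proof.
move=> /(subvP Vspan) /memv_addP[x /memv_sumP[x' x'y ->] [z zZ ->]].
have /fin_all_exists[c Hc] : forall i, exists c, x' i = c *: y i by move=> i; exact/vlineP/x'y.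
by exists c, z => //; congr (_ + _); apply: eq_bigr => i _; rewrite Hc.
Qed.

Lemma sum_yL (c : T -> R) : \sum_i c i *: y i \in L.
Proof. by apply: memv_suml => i _; exact: memvZ. Qed.

Lemma polar_coef c z w : z \in Z -> w \in L ->
  polar q (\sum_i c i *: y i + z) w = \sum_i c i * polar q (y i) w.
Proof.
move=> zZ wL; have zL := subvP ZL _ zZ.
by rewrite -[X in polar q (X + _)]scale1r polar_lin ?sum_yL // (Zrad zZ) // addr0 mul1r polar_suml.
Qed.

(** Modulo the radical [Z], the Gram matrix of [V] factors as CM X CM^T with X the Gram matrix of
    the [y i]; rank [#|T|] forces X to be invertible. *)
Lemma gram_nondegenerate : quad_rank q V = #|T| ->
  forall c : T -> R, (forall j, \sum_i c i * polar q (y i) (y j) = 0) -> forall i, c i = 0.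
Proof.
move=> rk c c0 i.
pose b (k : 'I_(\dim V)) := (vbasis V)`_k.
have bV k : b k \in V by apply: vbasis_mem; apply: mem_nth; rewrite size_tuple.
have /fin_all_exists[C HC] : forall k, exists c : T -> R, exists2 z, z \in Z & b k = \sum_i c i *: y i + z.
  by move=> k; exact: span_coef.
have sumE (F : T -> R) : \sum_i F i = \sum_(k < #|T|) F (enum_val k).
  by rewrite -(big_enum_val (A := T)); apply: eq_bigl.
pose X : 'M[R]_#|T| := \matrix_(k, l) polar q (y (enum_val k)) (y (enum_val l)).
pose CM : 'M[R]_(\dim V, #|T|) := \matrix_(k, l) C k (enum_val l).
have E : \matrix_(k < \dim V, l < \dim V) polar q (vbasis V)`_k (vbasis V)`_l = CM *m X *m CM^T.
  apply/matrixP => k l; rewrite !mxE -/(b k) -/(b l).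
  have [z zZ ->] := HC k; have [z' z'Z bl] := HC l.
  have blL : b l \in L by exact: subvP (bV l).
  rewrite polar_coef // sumE.
  rewrite [RHS](eq_bigr (fun n => \sum_m CM k m * X m n * C l (enum_val n))); last first.
    by move=> n _; rewrite !mxE mulr_suml.
  rewrite exchange_big; apply: eq_bigr => m _ /=.
  rewrite polar_sym bl polar_coef // sumE mulr_sumr; apply: eq_bigr => n _.
  by rewrite !mxE polar_sym; ring.
have rkX : \rank X = #|T|.
  apply/eqP; rewrite eqn_leq rank_leq_row -{1}rk /quad_rank E.
  by rewrite (leq_trans (mxrankM_maxl _ _)) // mxrankM_maxr.
have Xu : X \in unitmx by rewrite -row_full_unit /row_full rkX.
pose a : 'rV[R]_#|T| := \row_k c (enum_val k).
have a0 : a *m X = 0.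
  apply/rowP => l; rewrite !mxE -[RHS](c0 (enum_val l)) sumE.
  by apply: eq_bigr => m _; rewrite !mxE.
have : a = 0 by rewrite -[a](mulmxK Xu) a0 mul0mx.
by move=> /rowP/(_ (enum_rank i)); rewrite !mxE enum_rankK.
Qed.

Lemma pos_inertia_orthonormal (eps : T -> bool) : (forall i, y i \in V) ->
  (forall v, v \in L -> q v = polar q v v) ->
  (forall i j, polar q (y i) (y j) = (if eps i then 1 else -1) * (i == j)%:R) ->
  pos_inertia q V = #|[pred i | eps i]|.
Proof.
move=> yV qE gram.
pose s i : R := if eps i then 1 else -1.
have s2 i : s i * s i = 1 by rewrite /s; case: ifP => _; rewrite ?mulr1 ?mulrNN ?mulr1.
have polar_y (c : T -> R) j : polar q (\sum_i c i *: y i) (y j) = c j * s j.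
  rewrite polar_suml // (bigD1 j) //= gram eqxx mulr1 big1 ?addr0 // => i ij.
  by rewrite gram (negbTE ij) !mulr0.
have q_sum (c : T -> R) z : z \in Z -> q (\sum_i c i *: y i + z) = \sum_i c i * c i * s i.
  move=> zZ; have vL : \sum_i c i *: y i + z \in L by rewrite memvD ?sum_yL ?(subvP ZL).
  rewrite qE // polar_coef //; apply: eq_bigr => i _.
  rewrite polar_sym polar_coef // -mulrA; congr (_ * _).
  by rewrite -polar_suml // polar_y.
have indep (c : T -> R) : \sum_(u | eps u) c u *: y u = 0 -> forall u, eps u -> c u = 0.
  move=> c0 u eu; pose c' i := if eps i then c i else 0.
  have E : \sum_i c' i *: y i = 0.
    rewrite -[RHS]c0 [RHS]big_mkcond; apply: eq_bigr => i _; rewrite /c'.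
    by case: ifP => _; rewrite ?scale0r.
  have := polar_y c' u; rewrite E polar0 // /c' eu => /esym/eqP.
  rewrite mulf_eq0 => /orP[/eqP //|/eqP s0].
  by have := s2 u; rewrite s0 mul0r => /eqP; rewrite eq_sym oner_eq0.
pose Up := (\sum_(u | eps u) <[y u]>)%VS.
(* The form is nonpositive on [Un], so a positive subspace meets it trivially, while [Up + Un]
   contains [V]: comparing dimensions bounds the positive subspace by [Up]. *)
pose Un := (\sum_(u | ~~ eps u) <[y u]> + (Z :&: V))%VS.
have Upd : \dim Up = #|[pred i | eps i]| by exact: free_family_in.
have Udim (U : {vspace W}) : (U <= V)%VS -> (forall u, u \in U -> u != 0 -> 0 < q u) ->
    (\dim U <= #|[pred i | eps i]|)%N.
  move=> UV Upos.
  have UUn : (U :&: Un = 0)%VS.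
    apply/eqP; rewrite -subv0; apply/subvP => u; rewrite memv_cap => /andP[uU].
    move=> /memv_addP[x /memv_sumP[x' x'y ->] [z]]; rewrite memv_cap => /andP[zZ _] uE.
    rewrite memv0; apply: contraT => u0; have := Upos u uU u0.
    have /fin_all_exists[c Hc] : forall i, exists c, ~~ eps i -> x' i = c *: y i.
      move=> i; case ei: (eps i); first by exists 0.
      by have /vlineP[c ->] := x'y i (negbT ei); exists c.
    pose c' i := if eps i then 0 else c i.
    have -> : u = \sum_i c' i *: y i + z.
      rewrite uE big_mkcond; congr (_ + _); apply: eq_bigr => i _ /=; rewrite /c'.
      by case ei: (eps i) => /=; rewrite ?scale0r // Hc ?ei.
    rewrite q_sum // ltNge sumr_le0 // => i _; rewrite /s /c'.
    case: ifP => ei; first by rewrite !mul0r.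
    by rewrite mulrN1 oppr_le0 -expr2 sqr_ge0.
  have : (U + Un <= Up + Un)%VS.
    rewrite subv_add addvSr andbT; apply: subv_trans UV _; apply/subvP => v vV.
    have [c [z zZ vE]] := span_coef vV.
    rewrite vE (bigID eps) /= -addrA; apply: memv_add.
      apply: memv_suml => i ei; apply: memvZ.
      exact: (subvP (sumv_sup i ei (subvv _))) (memv_line _).
    apply: memv_add.
      apply: memv_suml => i ei; apply: memvZ.
      exact: (subvP (sumv_sup i ei (subvv _))) (memv_line _).
    rewrite memv_cap zZ /= -(addKr (\sum_i c i *: y i) z) -vE memvD // memvN.
    by apply: memv_suml => i _; exact: memvZ.
  move=> /dimvS; rewrite dimv_disjoint_sum // => le.
  by have := leq_trans le (dimv_add_leqif Up Un); rewrite leq_add2r Upd.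
apply/eqP; rewrite eqn_leq; apply/andP; split.
  apply/bigmax_leqP => k /asboolP[U [UV <- Upos]]; exact: Udim.
have UpV : (Up <= V)%VS by apply/subv_sumP => i _; rewrite -memvE.
have lt : (#|[pred i | eps i]| < (\dim V).+1)%N by rewrite ltnS -Upd dimvS.
rewrite /pos_inertia; apply: (bigop.bigmax_sup (Ordinal lt)) => //; apply/asboolP; exists Up; split=> //= u.
move=> /memv_sumP[x' x'y ->] u0.
have /fin_all_exists[c Hc] : forall i, exists c, eps i -> x' i = c *: y i.
  move=> i; case ei: (eps i); last by exists 0.
  by have /vlineP[c ->] := x'y i ei; exists c.
pose c' i := if eps i then c i else 0.
have E : \sum_(i | eps i) x' i = \sum_i c' i *: y i.
  rewrite big_mkcond; apply: eq_bigr => i _ /=; rewrite /c'.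
  by case ei: (eps i) => /=; rewrite ?scale0r // Hc ?ei.
rewrite E -[X in q X]addr0 (q_sum _ 0 (mem0v Z)).
have pos i : 0 <= c' i * c' i * s i.
  rewrite /c' /s; case: ifP => _; last by rewrite !mul0r.
  by rewrite mulr1 -expr2 sqr_ge0.
rewrite lt_neqAle eq_sym sumr_ge0 // andbT psumr_neq0 //.
apply: contraNT u0 => /hasPn H; rewrite E big1 // => i _.
have := H i (mem_index_enum _); rewrite /= lt_neqAle pos andbT negbK eq_sym mulf_eq0.
rewrite mulf_eq0 orbb => /orP[/eqP ->|/eqP s0]; first by rewrite scale0r.
by have := s2 i; rewrite s0 mul0r => /eqP; rewrite eq_sym oner_eq0.
Qed.

End QuadraticForms.

(** * Existence of normal generators *)

Section Leibniz.
Context {R : realType} {W : vectType R} (I : interval R) (I_nd : nondegenerate_itv I).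
Local Notation D := (vderive I).

(** Leibniz formula with only the two top orders explicit; the remainder will pair to 0. For [n = 0]
    the meaningless [n.-1] is multiplied by 0. *)
Lemma iter_vderiveZ (f : R -> R) (x : R -> W) n : smoothf I f -> vsmooth I x ->
  exists2 y, cspan I (fun _ : unit => x) (fun _ k => (k.+1 < n)%N) y &
    forall t, t \in I -> iter n D (fun s => f s *: x s) t =
      f t *: iter n D x t + (n%:R * derive_within I f t) *: iter n.-1 D x t + y t.
Proof.
move=> Hf Hx; have Hf' := smoothf_derive Hf.
elim: n => [|n [y Hy yE]].
  by exists (fun=> 0); [exact: cspan_0 | move=> t _; rewrite mul0r scale0r !addr0].
have sx k := @vsmooth_iter _ _ I k _ Hx.
have sy := cspan_smooth I_nd (fun=> Hx) Hy.
have sn : smoothf I (fun s => n%:R * derive_within I f s) := smoothfM I_nd (@smoothf_cst _ _ I_nd n%:R) Hf'.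
have sn' := smoothf_derive sn.
exists (fun t => derive_within I (fun s => n%:R * derive_within I f s) t *: iter n.-1 D x t + D y t).
  case: n y Hy {yE sy} sn sn' => [|n] y Hy sn sn'.
    apply: cspan_D; last by apply: (cspan_deriv I_nd (fun=> Hx) _ Hy).
    apply: (cspan_eq _ (cspan_0 _ _ _)) => t tI.
    rewrite (@has_derivE _ _ I_nd _ _ 0) ?scale0r //.
    by apply: (has_deriv_eq _ tI (has_deriv_cst I_nd 0 tI)) => v vI; rewrite mul0r.
  apply: cspan_D; last by apply: (cspan_deriv I_nd (fun=> Hx) _ Hy) => s k; split; lia.
  by apply: cspan_Z => //; exact: (@cspan_gen _ _ _ _ (fun=> x) _ tt n).
move=> t tI /=; rewrite (eq_vderive yE tI).
have s1 := vsmoothZ I_nd Hf (sx n); have s2 := vsmoothZ I_nd sn (sx n.-1).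
rewrite (vderiveD I_nd tI (vsmoothD I_nd s1 s2) sy) (vderiveD I_nd tI s1 s2).
rewrite (vderiveZ I_nd tI Hf (sx n)) (vderiveZ I_nd tI sn (sx n.-1)).
rewrite -[D (iter n D x) t]/(iter n.+1 D x t).
have -> : (n%:R * derive_within I f t) *: D (iter n.-1 D x) t = (n%:R * derive_within I f t) *: iter n D x t.
  by case: n {y Hy yE sx sy sn sn' s1 s2} => [|n] //; rewrite mul0r !scale0r.
rewrite -natr1 mulrDl mul1r scalerDl.
have addE (u1 u2 u3 u4 u5 : W) : u1 + u2 + (u3 + u4) + u5 = u2 + (u4 + u1) + (u3 + u5).
  by rewrite (addrC u1) (addrC u3) addrACA !addrA.
exact: addE.
Qed.

Lemma omega_iter_comb (omega : {skew_symmetric W}) n (f : 'I_n -> R -> R) (x : 'I_n -> R -> W) l w t :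
  (forall b, smoothf I (f b)) -> (forall b, vsmooth I (x b)) -> t \in I ->
  (forall b k, (k.+1 < l)%N -> omega w (iter k D (x b) t) = 0) ->
  omega w (iter l D (fun s => \sum_b f b s *: x b s) t) =
  \sum_b (f b t * omega w (iter l D (x b) t) +
    l%:R * derive_within I (f b) t * omega w (iter l.-1 D (x b) t)).
Proof.
move=> Hf Hx tI low.
have -> : (fun s => \sum_b f b s *: x b s) = (fun s => \sum_b 1 *: (fun s => f b s *: x b s) s).
  by apply/funext => s; apply: eq_bigr => b _; rewrite scale1r.
rewrite (iter_vderive_sum I_nd) //; last by move=> b _; exact: (vsmoothZ I_nd (Hf b) (Hx b)).
rewrite linear_sumr; apply: eq_bigr => b _; rewrite scale1r.
have [y Hy ->] := iter_vderiveZ l (Hf b) (Hx b); last exact: tI.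
rewrite !linearDr /= !linearZr_LR /= [X in _ + X](_ : _ = 0) ?addr0 //.
rewrite omegaC (cspan_vanish tI Hy) ?oppr0 // => _ k kl.
by rewrite omegaC low // oppr0.
Qed.

End Leibniz.

(** * Spans of the lowest derivatives of the generators *)

Section GeneratedBlocks.
Context {R : realType} {W : vectType R} (I : interval R).
Variables (omega : {skew_symmetric W}) (A : finType) (P : A -> nat) (eps : A -> R).
Hypothesis eps2 : forall s, eps s * eps s = 1.
Variables (B : pred A) (e : A -> R -> W).
Implicit Types (s : A) (k : nat) (t : R) (N : A -> nat).
Local Notation D := (vderive I).

Definition gen_block N t : {vspace W} :=
  (\sum_(a : {s : A & 'I_(P s)} | B (tag a) && (tagged a < N (tag a))%N)
     <[iter (tagged a) D (e (tag a)) t]>)%VS.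

Lemma gen_block_sub N t (V : {vspace W}) :
  (forall s k, B s -> (k < N s)%N -> iter k D (e s) t \in V) -> (gen_block N t <= V)%VS.
Proof. by move=> H; apply/subv_sumP => a /andP[Ba aN]; rewrite -memvE H. Qed.

Lemma sum_block (c : {s : A & 'I_(P s)} -> R) (Q : A -> pred nat) t :
  \sum_(a : {s : A & 'I_(P s)} | B (tag a) && Q (tag a) (tagged a))
    c a *: iter (tagged a) D (e (tag a)) t =
  \sum_(s | B s) \sum_(k < P s | Q s k) nat_coef c s k *: iter k D (e s) t.
Proof.
rewrite (sig_big_dep B (fun s (k : 'I_(P s)) => Q s k)
  (fun s (k : 'I_(P s)) => nat_coef c s k *: iter k D (e s) t)).
by apply: eq_bigr => a _; rewrite nat_coefE.
Qed.

Lemma gen_block_coef N t v : v \in gen_block N t -> exists c : A -> nat -> R,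
  (forall s k, (N s <= k)%N -> c s k = 0) /\
  v = \sum_(s | B s) \sum_(k < P s) c s k *: iter k D (e s) t.
Proof.
move=> /memv_sumP[y yv ->].
have /fin_all_exists[c Hc] : forall a : {s : A & 'I_(P s)}, exists c,
    B (tag a) && (tagged a < N (tag a))%N -> y a = c *: iter (tagged a) D (e (tag a)) t.
  move=> a; case h: (_ && _); last by exists 0.
  by have /vlineP[c ->] := yv a h; exists c.
exists (fun s k => if (k < N s)%N then nat_coef c s k else 0); split.
  by move=> s k; rewrite ltnNge => ->.
rewrite (eq_bigr _ Hc) (sum_block c (fun s k => k < N s)%N).
apply: eq_bigr => s _; rewrite big_mkcond; apply: eq_bigr => k _ /=.
by case: ifP => _; rewrite ?scale0r.
Qed.

Lemma gen_free (c : A -> nat -> R) t : normal_gen I omega P eps B e -> t \in I ->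
  \sum_(s | B s) \sum_(k < P s) c s k *: iter k D (e s) t = 0 ->
  forall s k, B s -> (k < P s)%N -> c s k = 0.
Proof.
move=> ng tI c0; apply: (gen_independent eps2 ng tI) => u j _ _.
by rewrite c0 linear0l.
Qed.

Lemma dim_gen_block N t : normal_gen I omega P eps B e -> t \in I ->
  (forall s, B s -> (N s <= P s)%N) -> \dim (gen_block N t) = (\sum_(s | B s) N s)%N.
Proof.
move=> ng tI NP; rewrite free_family_in => [|c c0 a /andP[Ba aN]].
  rewrite -sum1_card -(sig_big_dep B (fun s (k : 'I_(P s)) => k < N s)%N (fun _ _ => 1%N)).
  apply: eq_bigr => s Bs; rewrite -(big_ord_widen _ (fun=> 1%N) (NP s Bs)).
  by rewrite sum_nat_const card_ord muln1.
pose c' s k := if (k < N s)%N then nat_coef c s k else 0.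
have := @gen_free c' t ng tI _ (tag a) (tagged a) Ba (ltn_ord _).
rewrite {2}/c' aN nat_coefE; apply; rewrite -[RHS]c0.
rewrite (sum_block c (fun s k => k < N s)%N).
apply: eq_bigr => s _; rewrite [RHS]big_mkcond; apply: eq_bigr => k _ /=.
by rewrite /c'; case: ifP => _; rewrite ?scale0r.
Qed.

End GeneratedBlocks.

Definition sgn_of {R : realType} {d : nat} {r : 'I_d -> nat} (rp : 'I_d -> nat)
  (s : {i : 'I_d & 'I_(r i)}) : R := if (tagged s < rp (tag s))%N then 1 else -1.

Lemma sgn_of2 {R : realType} {d : nat} {r : 'I_d -> nat} (rp : 'I_d -> nat)
  (s : {i : 'I_d & 'I_(r i)}) : sgn_of rp s * sgn_of rp s = 1 :> R.
Proof. by rewrite /sgn_of; case: ifP => _; rewrite ?mulr1 ?mulrNN ?mulr1. Qed.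

Lemma sum_rows {d : nat} (r : 'I_d -> nat) (Q : pred 'I_d) (f : 'I_d -> nat) :
  (\sum_(s : {i : 'I_d & 'I_(r i)} | Q (tag s)) f (tag s) = \sum_(k | Q k) r k * f k)%N.
Proof.
have H := sig_big_dep Q (fun i (k : 'I_(r i)) => true) (fun i _ => f i).
transitivity (\sum_(i | Q i) \sum_(k < r i) f i)%N.
  by rewrite H; apply: eq_bigl => s; rewrite andbT.
by apply: eq_bigr => i _; rewrite sum_nat_const card_ord.
Qed.

(** * The space in which the generators of a new level live *)

Section Levels.
Context {R : realType} {W : vectType R} {m : nat} {omega : {skew_symmetric W}}.
Context {I : interval R} {L : R -> {vspace W}} {d : nat} {r p : 'I_d -> nat}.
Hypothesis C : regular_curve m omega I L r p.
Let I_nd := rc_itv C.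
Let omega_nd := rc_nd C.
Local Notation D := (vderive I).
Local Notation row := {i : 'I_d & 'I_(r i)}.
Local Notation P := (fun s : row => p (tag s)).
Local Notation contr := (@contr R W omega I L).
Implicit Types (s u : row) (k j l : nat) (t : R) (x y : R -> W).

Lemma rc_p_gt0 i : (0 < p i)%N.
Proof. by have [[]] := rc_young C. Qed.

Lemma rc_p_lt (i j : 'I_d) : (p j < p i)%N = (i < j)%N.
Proof.
have [[_ _ H] _] := rc_young C; case: (ltngtP i j) => ij; first exact: H.
  by have := H _ _ ij; lia.
by rewrite (val_inj ij) ltnn.
Qed.

Lemma rc_p_inj (i j : 'I_d) : p i = p j -> i = j.
Proof.
move=> E; apply/val_inj; have := rc_p_lt i j; have := rc_p_lt j i.
by rewrite E ltnn; case: ltngtP.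
Qed.

(** Moving [q] derivatives onto [x] turns the condition of order [q + 1] on the value of [x] into a
    condition of order 1 on its derivative of order [q]. *)
Lemma contr_jet q x t : sections I (contr q) x -> t \in I ->
  (x t \in contr q.+1 t) = (iter q D x t \in contr 1 t).
Proof.
move=> sx tI; have [sx1 xC] := sx.
have E y : sections I L y ->
    omega (iter q D x t) (iter 1 D y t) = (-1) ^+ q * omega (x t) (iter q.+1 D y t).
  move=> sy; have [sy1 _] := sy.
  apply: (pairing_shift I_nd sx1 sy1 _ (addn1 q) tI) => b v bq vI.
  by have /mem_contr := xC v vI; apply.
apply/idP/idP => /mem_contr H; apply/mem_contr => y j sy.
  case: j => [_|[_|//]]; last by rewrite E // H // mulr0.
  by apply: (rc_isotropic C tI); [exact: (section_contr_L C sx) | exact: sy.2].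
rewrite leq_eqVlt => /orP[/eqP ->|jq]; last by have /mem_contr := xC t tI; apply.
have := H y 1%N sy isT; rewrite E // => /eqP.
by rewrite mulf_eq0 expf_eq0 oppr_eq0 oner_eq0 andbF => /eqP.
Qed.

(* A state of the construction of the generators from the long rows to the
   short ones: the rows of the levels before [n] are done. *)
Record level_gen (n : nat) (rp : 'I_d -> nat) (e : row -> R -> W) : Prop := LevelGen {
  lg_gen : normal_gen I omega P (sgn_of rp) (fun s => tag s < n)%N e;
  lg_flag : forall s k t, (tag s < n)%N -> (k < p (tag s))%N -> t \in I -> iter k D (e s) t \in L t;
  lg_bound : forall i : 'I_d, (i < n)%N -> (rp i <= r i)%N }.

Lemma lg_section n rp e s : level_gen n rp e -> (tag s < n)%N ->
  sections I (contr (p (tag s)).-1) (e s).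
Proof.
move=> G sn; apply: (deriv_section_contr C) => [|a t ap tI]; first exact: (ng_smooth (lg_gen G) sn).
by apply: (lg_flag G) => //; have := rc_p_gt0 (tag s); lia.
Qed.

Section NextLevel.
Variables (i : 'I_d) (rp : 'I_d -> nat) (e : row -> R -> W).
Hypothesis G : level_gen i rp e.
Let q := (p i).-1.
Let B s := (tag s < i)%N.
Let ng := lg_gen G.
Let qE : q.+1 = p i.
Proof. by have := rc_p_gt0 i; rewrite /q; lia. Qed.
Let BP s : B s -> (q.+1 < p (tag s))%N.
Proof. by rewrite qE rc_p_lt. Qed.

(** The orders below 2p are those at which a row of length p must be orthogonal to every shorter
    row. *)
Definition old_span t : {vspace W} :=
  (\sum_(a : {s : row & 'I_(2 * p (tag s))} | B (tag a)) <[iter (tagged a) D (e (tag a)) t]>)%VS.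

(* A complement, in the contraction, of the span of the generators of the
   previous levels and of their derivatives; the new generators live there. *)
Definition level_space t := orthov omega (nth_extension I L q t + old_span t)%VS.

Let H t := gen_block I P B e (fun s => p (tag s) - q)%N t.

Lemma mem_level_space t v : v \in level_space t <->
  v \in contr q t /\ forall s a, B s -> (a < 2 * p (tag s))%N -> omega v (iter a D (e s) t) = 0.
Proof.
split=> [/mem_orthovP K|[/mem_orthovP K1 K2]].
  split=> [|s a Bs aP].
    by apply/mem_orthovP => u uE; apply: K; exact: (subvP (addvSl _ _)).
  apply: K; apply: (subvP (addvSr _ _)).
  pose b : {s : row & 'I_(2 * p (tag s))} := Tagged (fun s => 'I_(2 * p (tag s))) (Ordinal aP).
  exact: (subvP (sumv_sup b Bs (subvv _))) (memv_line _).
apply/mem_orthovP => _ /memv_addP[u uE [w wO ->]]; rewrite linearDr /= K1 // add0r.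
move: w wO => w /memv_sumP[f fE ->]; rewrite linear_sumr big1 // => a Ba.
by have /vlineP[c ->] := fE a Ba; rewrite linearZr_LR /= K2 ?mulr0.
Qed.

Lemma old_block_contr t : t \in I -> (H t <= contr q t)%VS.
Proof.
move=> tI; apply: gen_block_sub => s k Bs kN; have := BP Bs => lt.
by apply: (section_contr_deriv C (lg_section G Bs) _ tI); lia.
Qed.

Lemma level_old_block t v : t \in I -> v \in level_space t -> v \in H t -> v = 0.
Proof.
move=> tI /mem_level_space[_ K] /gen_block_coef[c [_ vE]].
rewrite vE big1 // => s Bs; rewrite big1 // => k _.
rewrite (gen_independent (@sgn_of2 _ _ _ rp) ng tI (c := c)) ?scale0r // => u j Bu jP.
by rewrite -vE K //; lia.
Qed.

Lemma dim_old_block t : t \in I -> \dim (H t) = (\sum_(k < d | (k < i)%N) r k * (p k - q))%N.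
Proof.
move=> tI; rewrite (dim_gen_block (@sgn_of2 _ _ _ rp) ng tI) => [|s _]; last exact: leq_subr.
exact: (@sum_rows d r (fun k : 'I_d => (k < i)%N) (fun k : 'I_d => (p k - q)%N)).
Qed.

(** In the formula for the dimension, level [i] contributes one box per row, longer rows make up
    [H], and shorter ones contribute nothing. *)
Lemma dim_contr_level t : t \in I -> \dim (contr q t) = (r i + \dim (H t))%N.
Proof.
move=> tI; rewrite (dim_contr C) // dim_old_block // (bigD1 i) //=.
rewrite (_ : p i - q = 1)%N ?muln1; last by rewrite -qE; lia.
congr (_ + _)%N; rewrite (bigID (fun k : 'I_d => k < i)%N) /= [X in (_ + X)%N]big1 ?addn0.
  by apply: eq_bigl => k; case: ltngtP => h; rewrite ?andbT ?andbF //; apply/eqP => E; move: h; rewrite E; lia.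
move=> k /andP[ki]; rewrite -leqNgt leq_eqVlt => /orP[/eqP/val_inj E|lt]; first by rewrite E eqxx in ki.
by have := rc_p_lt i k; rewrite lt -qE ltnS => le; rewrite (_ : _ - _ = 0)%N ?muln0 //; lia.
Qed.

(** Derivatives of old generators of order less than p + q already lie in the extension of order
    [q]. The others, [Y], impose p - q conditions per old row, no more in all than the dimension of
    [H]. *)
Lemma dim_level_space_ge t : t \in I -> (r i <= \dim (level_space t))%N.
Proof.
move=> tI; rewrite dim_orthov //.
pose Y : {vspace W} := (\sum_(a : {s : row & 'I_(2 * p (tag s))} |
  B (tag a) && (p (tag (tag a)) + q <= tagged a)%N) <[iter (tagged a) D (e (tag a)) t]>)%VS.
have dY : (\dim Y <= \dim (H t))%N.
  rewrite dim_old_block // (leq_trans (dimv_leq_sum _ _ _)) //.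
  apply: (@leq_trans (\sum_(a : {s : row & 'I_(2 * p (tag s))} |
      B (tag a) && (p (tag (tag a)) + q <= tagged a)%N) 1)%N).
    by apply: leq_sum => a _; rewrite dim_vline; case: eqP.
  rewrite -(sig_big_dep B (fun s (k : 'I_(2 * p (tag s))) => p (tag s) + q <= k)%N (fun _ _ => 1%N)).
  rewrite -(@sum_rows d r (fun k : 'I_d => (k < i)%N) (fun k : 'I_d => (p k - q)%N)) leq_sum // => s Bs.
  have -> : (\sum_(k < 2 * p (tag s) | (p (tag s) + q <= k)%N) 1 =
      \sum_(p (tag s) + q <= k < 2 * p (tag s)) 1)%N by rewrite big_geq_mkord.
  by rewrite sum_nat_const_nat muln1 /=; lia.
have sub : (nth_extension I L q t + old_span t <= nth_extension I L q t + Y)%VS.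
  rewrite subv_add addvSl; apply/subv_sumP => a Ba; rewrite -memvE.
  have [h|h] := ltnP (tagged a) (p (tag (tag a)) + q); last first.
    apply: (subvP (addvSr _ _)).
    by apply: (subvP (sumv_sup a _ (subvv _))) (memv_line _); rewrite Ba.
  apply: (subvP (addvSl _ _)); have Pa := rc_p_gt0 (tag (tag a)).
  pose k := minn (tagged a) (p (tag (tag a))).-1.
  have -> : nat_of_ord (tagged a) = ((tagged a - k) + k)%N by rewrite /k; lia.
  rewrite iterD; apply: mem_ext; last by rewrite /k; lia.
  split; first by apply: (@vsmooth_iter _ _ _ k); exact: (ng_smooth ng Ba).
  move=> v vI; apply: (lg_flag G Ba _ vI); rewrite /k /=; move: Pa => /=; lia.
have := dimvS sub; have := dimv_add_leqif (nth_extension I L q t) Y => -[le _].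
have := dim_contr_level tI; rewrite /contr dim_orthov //.
have := dimvS (subvf (nth_extension I L q t)); lia.
Qed.

Lemma level_decomposition t : t \in I -> (level_space t + H t)%VS = contr q t.
Proof.
move=> tI; apply/eqP; rewrite eqEdim subv_add old_block_contr // andbT.
have K0 : (level_space t :&: H t = 0)%VS.
  apply/eqP; rewrite -subv0; apply/subvP => v; rewrite memv_cap => /andP[vK vH].
  by rewrite memv0; apply/eqP/(level_old_block tI).
have -> : (level_space t <= contr q t)%VS by apply/subvP => v /mem_level_space[].
by rewrite dimv_disjoint_sum // dim_contr_level // leq_add2r dim_level_space_ge.
Qed.

Lemma dim_level_space t : t \in I -> \dim (level_space t) = r i.
Proof.
move=> tI; have := congr1 (fun V : {vspace W} => \dim V) (level_decomposition tI).
rewrite dim_contr_level // dimv_disjoint_sum => [/addIn //|].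
apply/eqP; rewrite -subv0; apply/subvP => v; rewrite memv_cap => /andP[vK vH].
by rewrite memv0; apply/eqP/(level_old_block tI).
Qed.

Lemma level_bundle : smooth_bundle I level_space.
Proof.
apply: (orthov_bundle I_nd omega_nd).
pose g (a : {s : row & 'I_(2 * p (tag s))}) := iter (tagged a) D (e (tag a)).
apply: (generated_bundle I_nd (G := [set h | (exists x j,
  [/\ sections I L x, (j <= q)%N & h = iter j D x]) \/ exists2 a, B (tag a) & h = g a])).
- move=> _ [[x [j [[sx _] _ ->]]]|[a Ba ->]]; first exact: (@vsmooth_iter _ _ _ j _ sx).
  exact: (@vsmooth_iter _ _ _ (tagged a) _ (ng_smooth ng Ba)).
- move=> t tI; set S := (X in vspan X); have [S1 S2] := vspanP S.
  apply/eqP; rewrite eqEsubv subv_add; apply/andP; split; first (apply/andP; split).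
  + apply: (vspanP _).2 => _ [x [j [sx jq ->]]]; apply: S1.
    by exists (iter j D x) => //; left; exists x, j.
  + apply/subv_sumP => a Ba; rewrite -memvE; apply: S1.
    by exists (g a) => //; right; exists a.
  + apply: S2 => _ [h [[x [j [sx jq ->]]]|[a Ba ->]] <-].
      by apply: (subvP (addvSl _ _)); exact: mem_ext.
    apply: (subvP (addvSr _ _)).
    exact: (subvP (sumv_sup a Ba (subvv _))) (memv_line _).
- move=> s t sI tI; have := dim_level_space sI; rewrite -(dim_level_space tI) !dim_orthov //.
  have := dimvS (subvf (nth_extension I L q s + old_span s)).
  have := dimvS (subvf (nth_extension I L q t + old_span t)); lia.
Qed.

Lemma level_frame : exists x : 'I_(r i) -> R -> W, (forall k : 'I_(r i), vsmooth I (x k)) /\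
  forall t, t \in I -> basis_of (level_space t) [tuple x k t | k < r i].
Proof. exact: (bundle_frame I_nd level_bundle dim_level_space). Qed.

Lemma level_section_contr x : sections I level_space x -> sections I (contr q) x.
Proof. by move=> [sx xK]; split=> // t /xK /mem_level_space[]. Qed.

Lemma level_section_old x s l t : sections I level_space x -> B s -> (l < 2 * p (tag s))%N ->
  t \in I -> omega (x t) (iter l D (e s) t) = 0.
Proof. by move=> [sx xK] Bs lP tI; have /mem_level_space[_] := xK t tI; apply. Qed.

(** The order splits into two parts, each at most [q]: the first keeps [y] in [L], the second stays
    within the extension to which [x] is orthogonal. *)
Lemma level_section_low x y l t : sections I level_space x -> sections I level_space y ->
  (l < (2 * p i).-1)%N -> t \in I -> omega (x t) (iter l D y t) = 0.
Proof.
move=> [sx xK] /level_section_contr sy lp tI; have /mem_level_space[/mem_contr H0 _] := xK t tI.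
pose k := minn l q; have kq : (k <= q)%N by rewrite /k; lia.
rewrite (_ : l = l - k + k)%N; last by rewrite /k; lia.
rewrite iterD; apply: H0; last by rewrite /k; lia.
split; first exact: (@vsmooth_iter _ _ _ k _ sy.1).
by move=> v vI; exact: (section_contr_L C sy).
Qed.

End NextLevel.
End Levels.

(** * Families indexed by rows, modified on one level *)

Section SetLevel.
Context {d : nat} {r : 'I_d -> nat}.
Local Notation row := {i : 'I_d & 'I_(r i)}.

(** Searching for the row with [pick] avoids transport along an equality of levels. *)
Definition set_level (Y : Type) (e : row -> Y) (i : 'I_d) (x : 'I_(r i) -> Y) (s : row) : Y :=
  if [pick k | Tagged (fun i => 'I_(r i)) k == s] is Some k then x k else e s.

Lemma set_levelE Y (e : row -> Y) i (x : 'I_(r i) -> Y) k :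
  set_level e x (Tagged (fun i => 'I_(r i)) k) = x k.
Proof.
rewrite /set_level; case: pickP => [l|/(_ k)]; last by rewrite eqxx.
by rewrite eq_Tagged /= => /eqP ->.
Qed.

Lemma set_level_old Y (e : row -> Y) i (x : 'I_(r i) -> Y) s :
  tag s != i -> set_level e x s = e s.
Proof.
by move=> si; rewrite /set_level; case: pickP => // k /eqP E; rewrite -E eqxx in si.
Qed.

Lemma row_level i (s : row) : tag s = i -> exists k : 'I_(r i), s = Tagged (fun i => 'I_(r i)) k.
Proof. by case: s => j k /= ji; subst j; exists k. Qed.

Lemma sum_level (V : nmodType) i (F : row -> V) :
  \sum_(s : row | tag s == i) F s = \sum_(k < r i) F (Tagged (fun i => 'I_(r i)) k).
Proof.
have H := sig_big_dep (pred1 i) (fun i (k : 'I_(r i)) => true)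
  (fun i k => F (Tagged (fun i => 'I_(r i)) k)).
transitivity (\sum_(j | j == i) \sum_(k < r j) F (Tagged (fun i => 'I_(r i)) k)).
  by rewrite H; apply: eq_big => [s|[]//]; rewrite andbT.
by rewrite big_pred1_eq.
Qed.

Lemma sum_le_level (V : nmodType) (i : 'I_d) (F : row -> V) :
  \sum_(s : row | (tag s <= i)%N) F s =
  \sum_(s : row | (tag s < i)%N) F s + \sum_(k < r i) F (Tagged (fun i => 'I_(r i)) k).
Proof.
rewrite -sum_level (bigID (fun s : row => tag s < i)%N) /=; congr (_ + _); apply: eq_bigl => s.
  by case: ltngtP.
by rewrite -leqNgt -eqn_leq.
Qed.

End SetLevel.

(** * The velocity form on the top derivatives of the generators *)

Section TopPairing.
Context {R : realType} {W : vectType R} {m : nat} {omega : {skew_symmetric W}}.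
Context {I : interval R} {L : R -> {vspace W}} {d : nat} {r p : 'I_d -> nat}.
Hypothesis C : regular_curve m omega I L r p.
Let I_nd := rc_itv C.
Local Notation D := (vderive I).
Local Notation row := {i : 'I_d & 'I_(r i)}.
Local Notation P := (fun s : row => p (tag s)).
Local Notation contr := (@contr R W omega I L).
Local Notation vel := (velocity I omega L).
Implicit Types (s : row) (t : R) (u v w : W).

Lemma polar_velocity_lin t a u v w : t \in I -> u \in L t -> v \in L t -> w \in L t ->
  polar (vel t) (a *: u + v) w = a * polar (vel t) u w + polar (vel t) v w.
Proof.
move=> tI uL vL wL.
have [x [sx xt]] := ex_section I_nd (rc_bundle C) tI uL.
have [y [sy yt]] := ex_section I_nd (rc_bundle C) tI vL.
have [z [sz zt]] := ex_section I_nd (rc_bundle C) tI wL.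
have sX : sections I L (fun s : R => a *: x s + y s).
  split; first exact: (@vsmooth_lin R W I x y a I_nd sx.1 sy.1).
  by move=> s sI; rewrite memvD ?memvZ ?sx.2 ?sy.2.
rewrite -xt -yt -zt (polar_velocityE C tI sX sz) !(polar_velocityE C tI) //.
have /= -> := iter_vderive_lin a 1 I_nd sx.1 sy.1 tI.
by rewrite linearDl /= linearZl_LR.
Qed.

Lemma polarC (q : W -> R) u v : polar q u v = polar q v u.
Proof. by rewrite /polar (addrC v u); congr (_ / _); ring. Qed.

Lemma polar_velocity_rad t z w : t \in I -> z \in contr 1 t -> w \in L t ->
  polar (vel t) z w = 0.
Proof.
move=> tI zC wL; have zL := subvP (contr_sub C 1 tI) _ zC.
have [x [sx xt]] := ex_section I_nd (rc_bundle C) tI zL.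
have [y [sy yt]] := ex_section I_nd (rc_bundle C) tI wL.
rewrite -xt -yt (polar_velocityE C tI sx sy) (section_symm C tI sx sy) xt omegaC.
by have /mem_contr/(_ y 1%N sy isT) /= -> := zC; rewrite oppr0.
Qed.

(** Modulo the first contraction, which is in the radical of the velocity, the space in condition
    (G) is spanned by the top derivatives of the generators of levels up to [i]. Only derivatives of
    order exactly [q] of a section matter, and modulo the first contraction they depend only on its
    value at [t]. *)
Lemma ext_contr_span (i : 'I_d) (e : row -> R -> W) t :
  (forall s, (tag s <= i)%N -> sections I (contr (p (tag s)).-1) (e s)) -> t \in I ->
  (forall v, v \in contr (p i).-1 t -> exists c : row -> nat -> R,
    (forall s k, (p (tag s) - (p i).-1 <= k)%N -> c s k = 0) /\
    v = \sum_(s : row | (tag s <= i)%N) \sum_(k < p (tag s)) c s k *: iter k D (e s) t) ->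
  (ext_contr I L (p i).-1 t <=
    \sum_(s : row | (tag s <= i)%N) <[iter (p (tag s)).-1 D (e s) t]> + contr 1 t)%VS.
Proof.
move=> se tI span; set q := (p i).-1 in span *; set V := (X in (_ <= X)%VS).
have VY (s : row) : (tag s <= i)%N -> iter (p (tag s)).-1 D (e s) t \in V.
  move=> si; apply: (subvP (addvSl _ _)).
  exact: (subvP (sumv_sup s si (subvv _))) (memv_line _).
have V1 v : v \in contr 1 t -> v \in V by exact: (subvP (addvSr _ _)).
apply: (vspanP _).2 => _ [l [j [sl' jq ->]]].
have sl : sections I (contr q) l.
  by have [s1 s2] := sl'; split=> // v vI; rewrite -(nth_contractionE C) // s2.
have [jq'|->] : (j < q)%N \/ j = q by lia.
  by apply/V1/(section_contr_deriv C sl _ tI); rewrite addn1.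
have [c [c0 lt]] := span _ (sl.2 t tI).
pose J : finType := {s : row & 'I_(p (tag s))}.
pose Q (a : J) := (tag (tag a) <= i)%N.
pose z (v : R) := \sum_(a | Q a) c (tag a) (tagged a) *: iter (tagged a) D (e (tag a)) v.
have smE (a : J) : Q a -> vsmooth I (iter (tagged a) D (e (tag a))).
  by move=> Qa; apply: (@vsmooth_iter _ _ _ (tagged a)); exact: (se _ Qa).1.
have sz : vsmooth I z.
  by apply: (vsmooth_sum I_nd) => a Qa; exact: (vsmoothZ I_nd (@smoothf_cst _ _ I_nd _) (smE a Qa)).
have zt : z t = l t.
  rewrite lt (sig_big_dep (fun s : row => tag s <= i)%N (fun s (k : 'I_(p (tag s))) => true)
    (fun s (k : 'I_(p (tag s))) => c s k *: iter k D (e s) t)).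
  by apply: eq_bigl => a; rewrite andbT.
have termC (a : J) (v : R) : Q a -> v \in I ->
    c (tag a) (tagged a) *: iter (tagged a) D (e (tag a)) v \in contr q v.
  move=> Qa vI; have [h|h] := leqP (p (tag (tag a)) - q) (tagged a).
    by rewrite c0 // scale0r mem0v.
  by apply/memvZ/(section_contr_deriv C (se _ Qa) _ vI); move: h => /=; lia.
have sw : sections I (contr q) (fun v : R => l v - z v).
  split; first exact: (vsmoothD I_nd sl.1 (vsmoothN I_nd sz)).
  move=> v vI; rewrite memvB ?sl.2 //; apply: memv_suml => a Qa; exact: termC.
(* [z] is the combination with constant coefficients that agrees with [l] at [t]. The difference
   vanishes there, so [contr_jet] puts its derivative of order [q] in the first contraction. *)
have : iter q D (fun v : R => l v - z v) t \in contr 1 t.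
  by rewrite -(contr_jet C sw tI) zt subrr mem0v.
rewrite (iter_vderiveB I_nd q sl.1 sz tI) => /V1 h.
rewrite -(subrK (iter q D z t) (iter q D l t)) memvD //.
rewrite (iter_vderive_sum I_nd _ q smE tI); apply: memv_suml => a Qa.
rewrite -iterD; have [h1|h1] := leqP (p (tag (tag a)) - q) (tagged a).
  by rewrite c0 // scale0r mem0v.
apply: memvZ; have [E|lt1] : (q + tagged a = (p (tag (tag a))).-1)%N \/
    (q + tagged a + 1 <= (p (tag (tag a))).-1)%N by move: h1 => /=; lia.
  by rewrite E; exact: VY.
exact/V1/(section_contr_deriv C (se _ Qa) lt1 tI).
Qed.

Section Frame.
Variables (i : 'I_d) (rp : 'I_d -> nat) (e : row -> R -> W).
Hypothesis G : level_gen (omega := omega) (I := I) (L := L) (p := p) i rp e.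
Variable x : 'I_(r i) -> R -> W.
Hypothesis x_smooth : forall k, vsmooth I (x k).
Local Notation K := (level_space (omega := omega) (I := I) (L := L) (p := p) i e).
Hypothesis x_basis : forall t, t \in I -> basis_of (K t) [tuple x k t | k < r i].
Let q := (p i).-1.
Let B s := (tag s < i)%N.
Let ng := lg_gen G.
Let H t := gen_block I P B e (fun s => p (tag s) - q)%N t.
Let H' t := gen_block I P B e (fun s => p (tag s) - p i)%N t.
Let e1 := set_level e x.
Let y s t := iter (p (tag s)).-1 D (e1 s) t.
Let qE : q.+1 = p i.
Proof. by have := rc_p_gt0 C i; rewrite /q; lia. Qed.

Lemma frame_section k : sections I K (x k).
Proof.
split=> // t tI; have /span_basis <- := x_basis tI.
by apply: memv_span; apply/tnthP; exists k; rewrite tnth_mktuple.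
Qed.

Lemma frame_free (a : 'I_(r i) -> R) t : t \in I -> \sum_k a k *: x k t = 0 -> forall k, a k = 0.
Proof.
move=> tI a0 k; have /basis_free/freeP := x_basis tI; apply.
by rewrite -[RHS]a0; apply: eq_bigr => l _; rewrite -tnth_nth tnth_mktuple.
Qed.

Let xK := frame_section.
Let x_free := frame_free.

Let x_span t v : t \in I -> v \in K t -> exists a : 'I_(r i) -> R, v = \sum_k a k *: x k t.
Proof.
move=> tI; have /span_basis <- := x_basis tI => /coord_span vE.
exists (fun k => coord [tuple x k t | k < r i] k v); rewrite {1}vE.
by apply: eq_bigr => k _; rewrite -tnth_nth tnth_mktuple.
Qed.

Lemma set_level_section s : (tag s <= i)%N -> sections I (contr (p (tag s)).-1) (e1 s).
Proof.
rewrite leq_eqVlt => /orP[/eqP/val_inj/row_level[k ->]|si].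
  by rewrite /e1 set_levelE; exact: (level_section_contr (xK k)).
rewrite /e1 set_level_old; first exact: (lg_section C G si).
by apply: contraTneq si => ->; rewrite ltnn.
Qed.

Let e1_old s : B s -> e1 s = e s.
Proof. by move=> Bs; rewrite /e1 set_level_old //; apply: contraTneq Bs => E; rewrite /B E ltnn. Qed.

Lemma contr_level_span t v : t \in I -> v \in contr q t -> exists c : row -> nat -> R,
  (forall s k, (p (tag s) - q <= k)%N -> c s k = 0) /\
  v = \sum_(s : row | (tag s <= i)%N) \sum_(k < p (tag s)) c s k *: iter k D (e1 s) t.
Proof.
move=> tI; rewrite -(level_decomposition C G tI) => /memv_addP[v1 /(x_span tI)[a ->] [v2 v2H ->]].
have [c [c0 ->]] := gen_block_coef v2H.
exists (fun s k => if B s then c s k else if k == 0%N then set_level (fun=> 0) a s else 0); split.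
  move=> s k h; case: ifPn => [_|_]; first exact: c0.
  case: eqP => [k0|//]; rewrite /set_level; case: pickP => [l /eqP E|//].
  by move: h; rewrite -E k0 /= -qE subSn // subnn.
rewrite sum_le_level addrC; congr (_ + _).
  apply: eq_bigr => s Bs; apply: eq_bigr => k _; rewrite e1_old //.
  by rewrite -/(B s) [B s]Bs.
apply: eq_bigr => k _; have p0 := rc_p_gt0 C i.
rewrite (bigD1 (Ordinal p0)) //= big1 ?addr0 => [|l l0].
  by rewrite /B ltnn /e1 !set_levelE.
by rewrite /B ltnn ifN ?scale0r.
Qed.

(** One contraction further, level [i] is exhausted and the old rows alone fill the dimension. *)
Lemma contr_next t : t \in I -> contr (p i) t = H' t.
Proof.
move=> tI; apply/esym/eqP; rewrite eqEdim; apply/andP; split.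
  apply: gen_block_sub => s k Bs kN.
  by apply: (section_contr_deriv C (lg_section C G Bs) _ tI); have := rc_p_gt0 C (tag s); lia.
rewrite (dim_contr C) // (dim_gen_block (@sgn_of2 _ _ _ rp) ng tI) => [|s _]; last exact: leq_subr.
rewrite (@sum_rows d r (fun k : 'I_d => (k < i)%N) (fun k : 'I_d => (p k - p i)%N)).
rewrite (bigID (fun k : 'I_d => k < i)%N) /= [X in (_ + X)%N]big1 ?addn0 // => k.
by rewrite -(rc_p_lt C) -leqNgt -subn_eq0 => /eqP ->; rewrite muln0.
Qed.

(** The total order is p_i + p_s - 1. On the new level this is 2 p_i - 1, covered by the hypothesis
    after a shift; on an older level it is below 2 p_s, where orthogonality is built into the level
    space. *)
Lemma top_pairing_old (u : R -> W) t : sections I K u -> t \in I ->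
  (forall b, omega (u t) (iter (2 * p i).-1 D (x b) t) = 0) ->
  forall s, (tag s <= i)%N -> omega (iter (p i) D u t) (y s t) = 0.
Proof.
move=> uK tI u0 s; have su := uK.1.
rewrite leq_eqVlt => /orP[/eqP/val_inj/row_level[k ->]|si].
  rewrite /y /e1 set_levelE /=.
  rewrite (@pairing_shift _ _ _ I_nd _ _ _ (2 * p i).-1 su (xK k).1) //.
  - by rewrite u0 mulr0.
  - by move=> b v bP vI; exact: (level_section_low C uK (xK k)).
  - by have := rc_p_gt0 C i; lia.
rewrite /y e1_old //; have sE := (lg_section C G si).1.
have := rc_p_lt C (tag s) i; rewrite si => lt; have := rc_p_gt0 C i => p0.
apply: (@pairing_low _ _ _ I_nd _ _ _ (2 * p (tag s))%N su sE) => //; last by lia.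
by move=> b v bP vI; exact: (level_section_old uK).
Qed.

(** By [contr_jet], [u t] lies in the next contraction, which is contained in the old block and so
    meets the level space only in 0. *)
Lemma level_section_eq0 (u : R -> W) t : sections I K u -> t \in I -> iter q D u t \in contr 1 t -> u t = 0.
Proof.
move=> uK tI; rewrite -(contr_jet C (level_section_contr uK) tI) qE contr_next // => uH.
apply: (level_old_block C G tI (uK.2 t tI)).
apply: (subvP _) uH; apply: gen_block_sub => s k Bs kN.
pose a : {s : row & 'I_(p (tag s))} := Tagged (fun s => 'I_(p (tag s))) (Ordinal (leq_trans kN (leq_subr _ _))).
apply: (subvP (sumv_sup a _ (subvv _))) (memv_line _); rewrite /= -/(B s) [B s]Bs /=.
by have := kN; rewrite -[X in (_ - X)%N]qE; lia.
Qed.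

(** The combination is the derivative of order [q] of [v], a section of the contraction, so [v t]
    lies in the next contraction [H']. Its new part vanishes because level space and old block are
    independent, and its old part because [H'] contains only orders below p_s - p_i. *)
Lemma top_vectors_independent (c : row -> R) t : t \in I ->
  \sum_(s : row | (tag s <= i)%N) c s *: y s t \in contr 1 t ->
  forall s, (tag s <= i)%N -> c s = 0.
Proof.
move=> tI cC.
pose v (w : R) := \sum_(s : row | (tag s <= i)%N) c s *: iter (p (tag s) - p i) D (e1 s) w.
have Ple s : (tag s <= i)%N -> (p i <= p (tag s))%N.
  by rewrite leqNgt -(rc_p_lt C) -leqNgt.
have smE s : (tag s <= i)%N -> vsmooth I (iter (p (tag s) - p i) D (e1 s)).
  by move=> si; apply: (@vsmooth_iter _ _ _ (p (tag s) - p i)); exact: (set_level_section si).1.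
have sv : sections I (contr q) v.
  split.
    by apply: (vsmooth_sum I_nd) => s si; exact: (vsmoothZ I_nd (@smoothf_cst _ _ I_nd _) (smE s si)).
  move=> w wI; apply: memv_suml => s si; apply: memvZ.
  by apply: (section_contr_deriv C (set_level_section si) _ wI); have := Ple s si; lia.
have : v t \in contr q.+1 t.
  rewrite (contr_jet C sv tI) (iter_vderive_sum I_nd _ q smE tI).
  rewrite (eq_bigr (fun s => c s *: y s t)) // => s si; rewrite -iterD /y.
  have -> // : (q + (p (tag s) - p i) = (p (tag s)).-1)%N.
  by have := Ple s si; have := qE; lia.
rewrite qE contr_next // {1}/v sum_le_level => vH.
have oldH : \sum_(s : row | (tag s < i)%N) c s *: iter (p (tag s) - p i) D (e1 s) t \in H t.
  apply: memv_suml => s Bs; apply: memvZ; rewrite e1_old //.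
  have lt : (p (tag s) - p i < p (tag s))%N by rewrite ltn_subrL !(rc_p_gt0 C).
  pose a : {s : row & 'I_(p (tag s))} := Tagged (fun s => 'I_(p (tag s))) (Ordinal lt).
  apply: (subvP (sumv_sup a _ (subvv _))) (memv_line _); rewrite /= -/(B s) [B s]Bs /=.
  by have := Ple s (ltnW Bs); lia.
have HH : (H' t <= H t)%VS.
  apply: gen_block_sub => s k Bs kN.
  pose a : {s : row & 'I_(p (tag s))} := Tagged (fun s => 'I_(p (tag s))) (Ordinal (leq_trans kN (leq_subr _ _))).
  apply: (subvP (sumv_sup a _ (subvv _))) (memv_line _); rewrite /= -/(B s) [B s]Bs /=.
  by have := kN; rewrite -[X in (_ - X)%N]qE; lia.
have new0 : \sum_(k < r i) c (Tagged (fun i => 'I_(r i)) k) *: x k t = 0.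
  apply: (level_old_block C G tI).
    by apply: memv_suml => k _; apply/memvZ/(xK k).2.
  have := memvB (subvP HH _ vH) oldH; rewrite addrAC subrr add0r.
  by under eq_bigr do rewrite /e1 set_levelE subnn.
have cnew := x_free tI new0.
move: vH; rewrite [X in _ + X]big1 ?addr0 => [|k _]; last by rewrite cnew scale0r.
move=> /gen_block_coef[c' [c'0 E]].
pose c2 s k := c' s k - (if k == (p (tag s) - p i)%N then c s else 0).
have c20 : \sum_(s | B s) \sum_(k < p (tag s)) c2 s k *: iter k D (e s) t = 0.
  rewrite (eq_bigr (fun s => \sum_(k < p (tag s)) c' s k *: iter k D (e s) t -
      c s *: iter (p (tag s) - p i) D (e1 s) t)) => [|s Bs].
    by rewrite sumrB -E subrr.
  have lt : (p (tag s) - p i < p (tag s))%N by rewrite ltn_subrL !(rc_p_gt0 C).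
  rewrite (eq_bigr (fun k : 'I_(p (tag s)) => c' s k *: iter k D (e s) t -
      (if k == (p (tag s) - p i)%N :> nat then c s else 0) *: iter k D (e s) t)) => [|k _]; last first.
    by rewrite scalerBl.
  rewrite sumrB; congr (_ - _); rewrite (bigD1 (Ordinal lt)) //= eqxx big1 ?addr0 ?e1_old // => k kn.
  rewrite ifN ?scale0r //; apply: contraNneq kn => E'; exact/eqP/val_inj.
move=> s; rewrite leq_eqVlt => /orP[/eqP/val_inj/row_level[k ->]|Bs]; first exact: cnew.
have lt : (p (tag s) - p i < p (tag s))%N by rewrite ltn_subrL !(rc_p_gt0 C).
have := gen_free (@sgn_of2 _ _ _ rp) ng tI c20 Bs lt.
by rewrite /c2 eqxx c'0 // sub0r => /eqP; rewrite oppr_eq0 => /eqP.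
Qed.

End Frame.
End TopPairing.

(** * Nondegeneracy and normalisation on a new level *)

Section LevelStep.
Context {R : realType} {W : vectType R} {m : nat} {omega : {skew_symmetric W}}.
Context {I : interval R} {L : R -> {vspace W}} {d : nat} {r p : 'I_d -> nat}.
Hypothesis C : regular_curve m omega I L r p.
Let I_nd := rc_itv C.
Local Notation D := (vderive I).
Local Notation row := {i : 'I_d & 'I_(r i)}.
Local Notation P := (fun s : row => p (tag s)).
Local Notation contr := (@contr R W omega I L).
Local Notation vel := (velocity I omega L).
Local Notation level_gen := (level_gen (omega := omega) (I := I) (L := L) (p := p)).
Implicit Types (s : row) (t : R) (u v w : W).

Section Frame.
Variables (i : 'I_d) (rp : 'I_d -> nat) (e : row -> R -> W).
Hypothesis G : level_gen i rp e.
Local Notation K := (level_space (omega := omega) (I := I) (L := L) (p := p) i e).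
Variable x : 'I_(r i) -> R -> W.
Hypothesis x_smooth : forall k, vsmooth I (x k).
Hypothesis x_basis : forall t, t \in I -> basis_of (K t) [tuple x k t | k < r i].
Let q := (p i).-1.
Let e1 := set_level e x.
Let y s t := iter (p (tag s)).-1 D (e1 s) t.
Let qE : q.+1 = p i.
Proof. by have := rc_p_gt0 C i; rewrite /q; lia. Qed.
Let xK k : sections I K (x k).
Proof. exact: (frame_section x_smooth x_basis). Qed.

Let y_L s t : (tag s <= i)%N -> t \in I -> y s t \in L t.
Proof.
by move=> si tI; apply: (section_contr_L C (set_level_section C G x_smooth x_basis si)).
Qed.

Let y_section s : (tag s <= i)%N -> sections I L (y s).
Proof.
move=> si; split; last by move=> t tI; exact: y_L.
by apply: (@vsmooth_iter _ _ _ (p (tag s)).-1); exact: (set_level_section C G x_smooth x_basis si).1.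
Qed.

Lemma comb_section (a : 'I_(r i) -> R -> R) : (forall k, smoothf I (a k)) ->
  sections I K (fun t => \sum_k a k t *: x k t).
Proof.
move=> sa; split=> [|t tI].
  by apply: (vsmooth_sum I_nd) => k _; exact: (vsmoothZ I_nd (@sa k) (xK k).1).
by apply: memv_suml => k _; apply/memvZ/(xK k).2.
Qed.

Let top_span t : t \in I -> ~~ (i.+1 < d)%N ->
  (\sum_(s : row | (tag s <= i)%N) <[y s t]> + contr 1 t)%VS = L t.
Proof.
move=> tI last_level; apply/eqP; rewrite eqEdim; apply/andP; split.
  rewrite subv_add (contr_sub C) // andbT; apply/subv_sumP => s si.
  by rewrite -memvE; exact: y_L.
have ind := top_vectors_independent C G x_smooth x_basis tI.
rewrite dimv_disjoint_sum; last first.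
  apply/eqP; rewrite -subv0; apply/subvP => v; rewrite memv_cap => /andP[].
  move=> /memv_sumP[f fy ->] fC; rewrite memv0.
  have /fin_all_exists[c Hc] : forall s, exists c, (tag s <= i)%N -> f s = c *: y s t.
    move=> s; case si: (tag s <= i)%N; last by exists 0.
    by have /vlineP[c ->] := fy s si; exists c.
  rewrite (eq_bigr _ Hc) in fC *; rewrite big1 // => s si.
  by rewrite (ind c fC) // scale0r.
rewrite free_family_in => [|c c0 s si]; last by apply: (ind c) => //; rewrite c0 mem0v.
rewrite -(contr0 C tI) !(dim_contr C) // -sum1_card.
have -> : (\sum_(s in [pred s : row | (tag s <= i)%N]) 1 = \sum_k r k)%N.
  rewrite (@sum_rows d r (fun k : 'I_d => (k <= i)%N) (fun _ : 'I_d => 1%N)).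
  apply: eq_big => k; last by rewrite muln1.
  by have := ltn_ord k; move: last_level; rewrite -leqNgt; lia.
rewrite -big_split leq_sum // => k _ /=.
by have := rc_p_gt0 C k; case: (p k) => // n _; rewrite subn0 subn1 mulnS.
Qed.

(* Condition (G) says nothing on the last level, where the vectors [y s t] span
   [L t] modulo the first contraction for dimension reasons. *)
Lemma top_pairing_unit t : t \in I ->
  ((i.+1 < d)%N -> quad_rank (vel t) (ext_contr I L q t) = (\sum_(k < d | (k <= i)%N) r k)%N) ->
  \matrix_(a < r i, b < r i) omega (x a t) (iter (2 * p i).-1 D (x b) t) \in unitmx.
Proof.
move=> tI condG; rewrite -row_free_unit; apply: inj_row_free => a a0.
pose u (w : R) := \sum_k a 0 k *: x k w.
have uK : sections I K u by apply: (comb_section (a := fun k _ => a 0 k)) => k; exact: smoothf_cst.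
have u0 b : omega (u t) (iter (2 * p i).-1 D (x b) t) = 0.
  rewrite /u linear_sumlz; have /rowP/(_ b) := a0; rewrite !mxE => E; rewrite -[RHS]E.
  by apply: eq_bigr => k _; rewrite linearZl_LR !mxE.
have uy := top_pairing_old C G x_smooth x_basis uK tI u0.
suff a00 : forall k, a 0 k = 0 by apply/rowP => k; rewrite a00 mxE.
have iter_u n : iter n D u t = \sum_k a 0 k *: iter n D (x k) t.
  by rewrite (iter_vderive_sum I_nd _ n _ tI) // => k _; exact: (xK k).1.
(* On the last level the top vectors span [L t] modulo the first contraction, so the derivative of
   order [q] of [u] is in the radical of the velocity and [u] vanishes at [t]. On the other levels a
   kernel vector would contradict the rank in condition (G). *)
have [lt|last_level] := boolP (i.+1 < d)%N; last first.
  apply: (frame_free x_basis tI).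
  apply: (level_section_eq0 C G uK tI).
  have suq := section_contr_L C (level_section_contr uK).
  have suL : sections I L (iter q D u).
    split; first exact: (@vsmooth_iter _ _ _ q _ uK.1).
    by move=> w wI; exact: suq.
  apply/mem_contr => z j sz; case: j => [_|[_|//]].
    by apply: (rc_isotropic C tI) (sz.2 t tI); exact: suq.
  rewrite omegaC -[iter 1 D z]/(D z) -(section_symm C tI suL sz).
  rewrite -[D (iter q D u)]/(iter q.+1 D u) qE.
  have := sz.2 t tI; rewrite -(top_span tI last_level) => /memv_addP[z1 z1y [z2 z2C ->]].
  rewrite linearDr /= [X in _ + X](_ : _ = 0) ?addr0; last first.
    rewrite omegaC; have /mem_contr/(_ _ 1%N suL isT) := z2C.
    by rewrite -[iter 1 D _]/(iter q.+1 D u) qE => ->; rewrite oppr0.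
  case/memv_sumP: z1y => f fy ->; rewrite linear_sumr big1 ?oppr0 // => s si.
  by have /vlineP[c ->] := fy s si; rewrite linearZr_LR /= uy // mulr0.
pose T : finType := {s : row | (tag s <= i)%N}.
pose c := set_level (fun=> 0) (a 0).
have big_T (V : nmodType) (F : row -> V) : \sum_(s : T) F (val s) = \sum_(s : row | (tag s <= i)%N) F s.
  by rewrite -(big_sub [pred s : row | (tag s <= i)%N] F).
suff cT (s : T) : c (val s) = 0.
  move=> k; rewrite -(set_levelE (fun=> 0) (a 0) k).
  by apply: (cT (exist _ (Tagged (fun i => 'I_(r i)) k) _)).
apply: (@gram_nondegenerate R W (vel t) (L t) (ext_contr I L q t) T (fun a : T => y (val a) t)
  (contr 1 t) _ _ _ _ _ _ _ _ (fun a : T => c (val a))).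
- apply: (vspanP _).2 => _ [l [j [sl jq ->]]]; apply: (section_contr_L C _ jq tI).
  by have [s1 s2] := sl; split=> // v vI; rewrite -(nth_contractionE C) // s2.
- by move=> b v1 v2 w; exact: (polar_velocity_lin C).
- by move=> v w; exact: polarC.
- by move=> s'; exact: y_L (valP s') tI.
- exact: (contr_sub C).
- by move=> z w; exact: (polar_velocity_rad C).
- have -> : (\sum_(s : T) <[y (val s) t]> = \sum_(s : row | (tag s <= i)%N) <[y s t]>)%VS.
    by rewrite -(big_sub [pred s : row | (tag s <= i)%N] (fun s => <[y s t]>%VS)).
  apply: (ext_contr_span C (set_level_section C G x_smooth x_basis) tI).
  by move=> v; exact: (contr_level_span C G x_basis tI).
- rewrite condG // card_sig -sum1_card.
  rewrite (@sum_rows d r (fun k : 'I_d => (k <= i)%N) (fun _ : 'I_d => 1%N)).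
  by apply: eq_bigr => k _; rewrite muln1.
move=> s'; have [ss ls] := y_section (valP s').
rewrite (big_T _ (fun s => c s * polar (vel t) (y s t) (y (val s') t))) sum_le_level.
rewrite big1 ?add0r => [|s1 si]; last first.
  rewrite /c set_level_old ?mul0r //.
  by apply: contraTneq si => ->; rewrite ltnn.
rewrite -[RHS](uy _ (valP s')) iter_u linear_sumlz; apply: eq_bigr => k _.
rewrite /c set_levelE linearZl_LR (polar_velocityE C tI _ (y_section (valP s'))); last exact: y_section.
rewrite {1}/y /e1 set_levelE -[D (iter _ D _)]/(iter (p i).-1.+1 D (x k)) prednK //.
exact: (rc_p_gt0 C).
Qed.

(* The pairings of order [2 p] of the combinations [\sum_b f c b x_b] vanish as
   soon as the matrix [f] solves [f'^T = - (2 p)^-1 G^-1 N f^T], where [G] and [N]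
   are the pairings of orders [2 p - 1] and [2 p] of the [x_b].  The pairings of
   order [2 p - 1] are then constant and are normalised at [t0]. *)
Lemma normalised_frame t0 : t0 \in I ->
  (forall t, t \in I ->
    \matrix_(a < r i, b < r i) omega (x a t) (iter (2 * p i).-1 D (x b) t) \in unitmx) ->
  exists (z : 'I_(r i) -> R -> W) (n : nat), [/\ (n <= r i)%N, forall k, sections I K (z k),
    forall a b t, t \in I -> omega (z a t) (iter (2 * p i).-1 D (z b) t) =
      (-1) ^+ p i * ((if (a < n)%N then 1 else -1) * (a == b)%:R) &
    forall a b t, t \in I -> omega (z a t) (iter (2 * p i) D (z b) t) = 0].
Proof.
move=> t0I Gunit; have p0 := rc_p_gt0 C i.
pose Gm t : 'M[R]_(r i) := \matrix_(a, b) omega (x a t) (iter (2 * p i).-1 D (x b) t).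
pose Nm t : 'M[R]_(r i) := \matrix_(a, b) omega (x a t) (iter (2 * p i) D (x b) t).
have sE a b l : smoothf I (fun t => omega (x a t) (iter l D (x b) t)).
  exact: (smoothf_omega I_nd (xK a).1 (@vsmooth_iter _ _ _ l _ (xK b).1)).
have sG : smooth_mx I Gm by move=> a b; apply: (smoothf_eq _ (sE a b (2 * p i).-1)) => t _; rewrite mxE.
have sN : smooth_mx I Nm by move=> a b; apply: (smoothf_eq _ (sE a b (2 * p i)%N)) => t _; rewrite mxE.
have low_x k l a t : sections I K k -> (l < (2 * p i).-1)%N -> t \in I -> omega (k t) (iter l D (x a) t) = 0.
  by move=> kK lp tI; exact: (level_section_low C kK (xK a)).
(* As 2p - 1 is odd, the sign from moving the derivatives cancels the one from skew symmetry. *)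
have Gsym t : t \in I -> (Gm t)^T = Gm t.
  move=> tI; apply/matrixP => a b; rewrite !mxE omegaC.
  have E := @pairing_shift _ _ _ I_nd omega _ _ (2 * p i).-1 (xK a).1 (xK b).1
    (fun l (v : R) lp vI => low_x _ _ b v (xK a) lp vI) (2 * p i).-1 0 t (addn0 _) tI.
  rewrite [X in - X]E -signr_odd (_ : odd _ = true) ?expr1 ?mulN1r ?opprK //.
  by case: (p i) p0 => // n _; rewrite mulnS /= oddM.
have kp : (2 * p i)%:R != 0 :> R by rewrite pnatr_eq0; lia.
pose A t := - (2 * p i)%:R^-1 *: (invmx (Gm t) *m Nm t).
have sA a b : smoothf I (fun t => A t a b).
  have H : smooth_mx I (fun t => invmx (Gm t) *m Nm t).
    by apply: smooth_mx_mul => // a' b'; apply: (@smoothf_invmx _ _ I_nd _ Gm) => //; exact: sG.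
  apply: (smoothf_eq _ (smoothfM I_nd (@smoothf_cst _ _ I_nd (- (2 * p i)%:R^-1)) (H a b))) => t _.
  by rewrite /A [in RHS]mxE.
(* The factor (-1)^p is the one in the definition of normal generators, so Sylvester's law is
   applied to this multiple of the Gram matrix. *)
have G0s : ((-1) ^+ p i *: Gm t0)^T = (-1) ^+ p i *: Gm t0 by rewrite linearZ /= Gsym.
have G0u : (-1) ^+ p i *: Gm t0 \in unitmx.
  by rewrite unitmxZ ?Gunit // unitrX // unitrN1.
have [T [n [nr TG]]] := sylvester G0s G0u.
have TGT : T *m Gm t0 *m T^T = (-1) ^+ p i *: sig_mx (r i) n.
  by rewrite -TG -scalemxAr -scalemxAl scalerA -expr2 sqrr_sign scale1r.
have /fin_all_exists[f Hf] : forall c, exists f : 'I_(r i) -> R -> R, [/\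
    forall b, f b t0 = T c b, forall b, smoothf I (f b) &
    forall b t, t \in I -> has_deriv I (f b) t (\sum_j A t b j * f j t)].
  by move=> c; have [f [f1 f2 f3]] := linear_ode I_nd (A := fun a b t => A t a b) (T c) t0I sA; exists f.
have f0 c b : f c b t0 = T c b by have [] := Hf c.
have fs c b : smoothf I (f c b) by have [_ H _] := Hf c; exact: H.
have fd c b t : t \in I -> derive_within I (f c b) t = \sum_j A t b j * f c j t.
  by move=> tI; have [_ _ H] := Hf c; exact: (has_derivE I_nd tI (H b t tI)).
pose z c t := \sum_b f c b t *: x b t.
have zK c : sections I K (z c) by apply: comb_section => b; exact: fs.
have omega_z c t v : omega (z c t) v = \sum_a f c a t * omega (x a t) v.
  by rewrite linear_sumlz; apply: eq_bigr => a _; rewrite linearZl_LR.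
have comb c b l t : t \in I -> (l <= 2 * p i)%N -> omega (z c t) (iter l D (z b) t) =
    \sum_a (f b a t * omega (z c t) (iter l D (x a) t) +
      l%:R * derive_within I (f b a) t * omega (z c t) (iter l.-1 D (x a) t)).
  move=> tI lp; apply: (@omega_iter_comb _ _ _ I_nd omega _ (f b) x l (z c t) t _ _ tI).
  - by move=> a; exact: fs.
  - by move=> a; exact: (xK a).1.
  - by move=> a k kl; apply: low_x => //; lia.
have top c b t : t \in I -> omega (z c t) (iter (2 * p i) D (z b) t) = 0.
  move=> tI; rewrite comb //.
  pose g a := omega (z c t) (iter (2 * p i).-1 D (x a) t).
  (* The factor 2p from the Leibniz formula cancels against the inverse in [A], and the two halves
     of the pairing of order 2p add up to 0. *)
  have gA j : \sum_a g a * A t a j = - (2 * p i)%:R^-1 * omega (z c t) (iter (2 * p i) D (x j) t).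
    pose phi : 'rV[R]_(r i) := \row_a f c a t.
    have gE : \row_a g a = phi *m Gm t.
      by apply/rowP => a; rewrite !mxE /g omega_z; apply: eq_bigr => a' _; rewrite !mxE.
    have nE : omega (z c t) (iter (2 * p i) D (x j) t) = (phi *m Nm t) 0 j.
      by rewrite mxE omega_z; apply: eq_bigr => a' _; rewrite !mxE.
    transitivity (((\row_a g a) *m A t) 0 j).
      by rewrite [RHS]mxE; apply: eq_bigr => a _; rewrite [X in _ = X * _]mxE.
    rewrite nE gE /A -scalemxAr [LHS]mxE; congr (_ * _).
    by rewrite mulmxA mulmxK //; exact: Gunit.
  rewrite big_split /= [X in _ + X](eq_bigr (fun a => \sum_j (2 * p i)%:R * (g a * A t a j) * f b j t)); last first.
    move=> a _; rewrite fd // mulr_sumr mulr_suml; apply: eq_bigr => j _.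
    by rewrite -/(g a); ring.
  rewrite [X in _ + X]exchange_big -big_split big1 // => j _ /=.
  rewrite -mulr_suml -mulr_sumr gA; field.
  by move: kp; rewrite natrM mulf_eq0 negb_or => /andP[].
exists z, n; split=> // a b t tI.
pose h t := omega (z a t) (iter (2 * p i).-1 D (z b) t).
have hd (v : R) : v \in I -> has_deriv I h v 0.
  move=> vI; have sh : smoothf I h := smoothf_omega I_nd (zK a).1 (@vsmooth_iter _ _ _ (2 * p i).-1 _ (zK b).1).
  have := smoothf_has_deriv sh vI; suff -> : derive_within I h v = 0 by [].
  have E : (2 * p i + 0 = (2 * p i).-1.+1)%N by lia.
  have := @pairing_shift2 _ _ _ I_nd omega _ _ (2 * p i).-1 (zK a).1 (zK b).1
    (fun l (v : R) lp vI => level_section_low C (zK a) (zK b) lp vI) (2 * p i)%N 0 v E vI.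
  rewrite prednK; last by lia.
  rewrite /= omegaC top // oppr0 top // sub0r => /esym/eqP.
  rewrite mulrN oppr_eq0 mulf_eq0 signr_eq0 /= mulf_eq0 (negbTE kp) /= => /eqP.
  exact.
have -> : omega (z a t) (iter (2 * p i).-1 D (z b) t) = h t0.
  exact: (has_deriv0_cst I_nd tI t0I hd).
rewrite /h comb //; last by lia.
transitivity ((T *m Gm t0 *m T^T) a b).
  rewrite [RHS]mxE; apply: eq_bigr => k _.
  rewrite [X in _ + X](_ : _ = 0) ?addr0; last by rewrite low_x ?mulr0 //; lia.
  rewrite f0 omega_z mulrC [X in _ = X * _]mxE [X in _ = _ * X]mxE.
  by congr (_ * _); apply: eq_bigr => j _; rewrite f0 [X in _ = _ * X]mxE.
by rewrite TGT !mxE mulr_natr.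
Qed.

End Frame.
End LevelStep.

Lemma normal_gen_sub {R : realType} {W : vectType R} (I : interval R) (omega : {skew_symmetric W})
    (A : finType) (P : A -> nat) (eps : A -> R) (B B' : pred A) e :
  (forall s, B' s -> B s) -> normal_gen I omega P eps B e -> normal_gen I omega P eps B' e.
Proof.
move=> BB' [sm neq eq]; split=> [s /BB'|s u k l t /BB' Bs /BB' Bu|s u k l t /BB' Bs /BB' Bu].
- exact: sm.
- exact: neq.
- exact: eq.
Qed.

(** * Generators for all levels, and the inertia indices *)

Section ExistenceOfGenerators.
Context {R : realType} {W : vectType R} {m : nat} {omega : {skew_symmetric W}}.
Context {I : interval R} {L : R -> {vspace W}} {d : nat} {r p : 'I_d -> nat}.
Hypothesis C : regular_curve m omega I L r p.
Let I_nd := rc_itv C.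
Local Notation D := (vderive I).
Local Notation row := {i : 'I_d & 'I_(r i)}.
Local Notation P := (fun s : row => p (tag s)).
Local Notation contr := (@contr R W omega I L).
Local Notation vel := (velocity I omega L).
Local Notation level_gen := (@level_gen R W omega I L d r p).
Implicit Types (s : row) (t : R).

Lemma level_step (i : 'I_d) rp e t0 : condition_G I omega L r p -> t0 \in I -> level_gen i rp e ->
  exists rp' e', level_gen i.+1 rp' e'.
Proof.
move=> condG t0I G; have ng := lg_gen G.
have [x [x_smooth x_basis]] := level_frame C G.
have Gunit t : t \in I -> \matrix_(a < r i, b < r i) omega (x a t) (iter (2 * p i).-1 D (x b) t) \in unitmx.
  move=> tI; apply: (top_pairing_unit C G x_smooth x_basis tI) => lt; exact: condG.
have [z [n [nr zK z1 z2]]] := normalised_frame C x_smooth x_basis t0I Gunit.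
pose rp' k := if k == i then n else rp k.
pose e' := set_level e z.
have oldE s : (tag s < i)%N -> e' s = e s.
  by move=> si; rewrite /e' set_level_old //; apply: contraTneq si => ->; rewrite ltnn.
have newE k : e' (Tagged (fun i => 'I_(r i)) k) = z k by rewrite /e' set_levelE.
have old_sgn s : (tag s < i)%N -> sgn_of rp' s = sgn_of rp s :> R.
  by move=> si; rewrite /sgn_of /rp' (_ : (tag s == i) = false) //; apply: contraTF si => /eqP ->; rewrite ltnn.
have cases s : (tag s < i.+1)%N -> (tag s < i)%N \/ exists k, s = Tagged (fun i => 'I_(r i)) (k : 'I_(r i)).
  rewrite ltnS leq_eqVlt => /orP[/eqP/val_inj/row_level|]; [by right | by left].
exists rp', e'; split.
- apply: (normal_genI I_nd (fun s => rc_p_gt0 C (tag s))).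
  + by move=> s /cases[si|[k ->]]; [rewrite oldE //; exact: (ng_smooth ng si) | rewrite newE; exact: (zK k).1].
  + move=> s u l t sB uB lt lP tI.
    have ui : (tag u < i)%N.
      by move: lt sB; rewrite (rc_p_lt C) => lt; rewrite ltnS; exact: leq_trans.
    rewrite (oldE u ui); case: (cases s sB) => [si|[k ->]].
      by rewrite oldE // (ng_neq ng (k := 0%N)) //; move: lt => /=; lia.
    rewrite newE; exact: (level_section_old (zK k) ui lP tI).
  + move=> s u l t sB uB /(rc_p_inj C) E lP tI.
    case: (cases s sB) => [si|[k sk]].
      have ui : (tag u < i)%N by rewrite -E.
      rewrite !oldE // old_sgn // (ng_eq ng (k := 0%N)) //; last by rewrite E.
      by rewrite add0n addn0.
    have [k' uk] : exists k', u = Tagged (fun i => 'I_(r i)) (k' : 'I_(r i)).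
      by apply: row_level; rewrite -E sk.
    rewrite sk uk !newE /=; have p0 := rc_p_gt0 C i.
    have {}lP : (l <= 2 * p i)%N by move: lP; rewrite sk.
    case: ifP => [/eqP lE|/eqP lE].
      have -> : l = (2 * p i).-1 by rewrite -lE.
      by rewrite z1 // /sgn_of /rp' /= eqxx eq_Tagged mulrA.
    have [->|lt] : l = (2 * p i)%N \/ (l < (2 * p i).-1)%N by lia.
      exact: z2.
    exact: (level_section_low C (zK k) (zK k')).
- move=> s k t /cases[si|[j ->]] kP tI; first by rewrite oldE //; exact: (lg_flag G).
  rewrite newE; apply: (section_contr_L C (level_section_contr (zK j)) _ tI).
  by move: kP => /=; lia.
- move=> k; rewrite ltnS leq_eqVlt /rp' => /orP[/eqP/val_inj ->|ki]; first by rewrite eqxx.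
  by rewrite ifN; [exact: (lg_bound G) | apply: contraTneq ki => ->; rewrite ltnn].
Qed.

Lemma ex_level_gen t0 : condition_G I omega L r p -> t0 \in I -> exists rp e, level_gen d rp e.
Proof.
move=> condG t0I.
suff H n : (n <= d)%N -> exists rp e, level_gen n rp e by exact: H.
elim: n => [_|n IHn nd]; first by exists (fun=> 0%N), (fun _ _ => 0).
have [rp [e G]] := IHn (ltnW nd).
exact: (level_step (i := Ordinal nd) condG t0I G).
Qed.

(** The top derivatives of the generators of levels up to [i] are orthonormal for the velocity with
    signs [rp], and they span the space in condition (G) modulo the radical. The time [t] is
    arbitrary, so the indices do not vary. *)
Lemma Gamma_level rp e i t : level_gen d rp e -> t \in I ->
  Gamma_pos I omega L p t i = (\sum_(k < d | (k <= i)%N) rp k)%N.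
Proof.
move=> G tI; set q := (p i).-1; have qE : q.+1 = p i by have := rc_p_gt0 C i; rewrite /q; lia.
have sd s : (tag s < d)%N by exact: ltn_ord.
have se s : sections I (contr (p (tag s)).-1) (e s) := lg_section C G (sd s).
pose B s := (tag s <= i)%N; pose y s t := iter (p (tag s)).-1 D (e s) t.
have ng : normal_gen I omega P (sgn_of rp) B e by apply: normal_gen_sub (lg_gen G).
have Ple s : B s -> (q < p (tag s))%N by rewrite qE leqNgt (rc_p_lt C) -leqNgt.
have sy s : sections I L (y s).
  split; first by apply: (@vsmooth_iter _ _ _ (p (tag s)).-1); exact: (se s).1.
  by move=> v vI; exact: (section_contr_L C (se s)).
have blockE : gen_block I P B e (fun s => p (tag s) - q)%N t = contr q t.
  apply/eqP; rewrite eqEdim; apply/andP; split.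
    apply: gen_block_sub => s k Bs kN.
    by apply: (section_contr_deriv C (se s) _ tI); lia.
  rewrite (dim_contr C) // (dim_gen_block (@sgn_of2 _ _ _ rp) ng tI) => [|s _]; last exact: leq_subr.
  rewrite (@sum_rows d r (fun k : 'I_d => (k <= i)%N) (fun k : 'I_d => (p k - q)%N)).
  rewrite (bigID (fun k : 'I_d => k <= i)%N) /= [X in (_ + X)%N]big1 ?addn0 // => k.
  rewrite -ltnNge -(rc_p_lt C) -qE ltnS -subn_eq0 => /eqP ->; exact: muln0.
pose T : finType := {s : row | (tag s <= i)%N}.
have sE (x : T) : x = x by [].
rewrite /Gamma_pos (@pos_inertia_orthonormal R W (vel t) (L t) _ T (fun x : T => y (val x) t) (contr 1 t)
  _ _ _ _ _ _ (fun x : T => tagged (val x) < rp (tag (val x)))%N).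
- rewrite -sum1_card big_mkcond /=.
  rewrite -(big_sub [pred s : row | (tag s <= i)%N]
    (fun s : row => if (tagged s < rp (tag s))%N then 1 else 0)%N) /=.
  have H := sig_big_dep (fun k : 'I_d => k <= i)%N (fun k (j : 'I_(r k)) => true)
    (fun k (j : 'I_(r k)) => if (j < rp k)%N then 1 else 0)%N.
  transitivity (\sum_(k < d | (k <= i)%N) \sum_(j < r k) if (j < rp k)%N then 1 else 0)%N.
    by rewrite H; apply: eq_bigl => s; rewrite andbT.
  apply: eq_bigr => k _; rewrite -big_mkcond.
  rewrite -(big_ord_widen _ (fun=> 1%N) (lg_bound G (ltn_ord k))).
  by rewrite sum_nat_const card_ord muln1.
- by move=> b v1 v2 w; exact: (polar_velocity_lin C).
- by move=> v w; exact: polarC.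
- by move=> s; exact: (sy _).2.
- exact: (contr_sub C).
- by move=> v w; exact: (polar_velocity_rad C).
- have -> : (\sum_(x : T) <[y (val x) t]> = \sum_(s : row | (tag s <= i)%N) <[y s t]>)%VS.
    by rewrite -(big_sub [pred s : row | (tag s <= i)%N] (fun s => <[y s t]>%VS)).
  apply: (ext_contr_span C (fun s _ => se s) tI) => v; rewrite -/q -blockE => /gen_block_coef[c [c0 vE]].
  by exists c.
- move=> x; have Bx : B (val x) := valP x; rewrite /y /ext_contr -/q.
  have qle : (q <= (p (tag (val x))).-1)%N by rewrite -ltnS prednK ?(rc_p_gt0 C) //; exact: Ple.
  rewrite -(subnKC qle).
  rewrite iterD; apply: mem_ext => //; split.
    exact: (@vsmooth_iter _ _ _ _ _ (se (val x)).1).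
  move=> v vI; rewrite (nth_contractionE C) //.
  by apply: (section_contr_deriv C (se (val x)) _ vI); rewrite subnK.
- move=> v vL; have [x [sx <-]] := ex_section I_nd (rc_bundle C) tI vL.
  by rewrite (velocityE C tI sx) (polar_velocityE C tI sx sx).
- move=> x x'; rewrite (polar_velocityE C tI (sy _) (sy _)).
  have Bx : B (val x) := valP x; have Bx' : B (val x') := valP x'.
  have := rc_p_gt0 C (tag (val x)); have := rc_p_gt0 C (tag (val x')) => p1 p2.
  rewrite /y -[D (iter _ D _)]/(iter (p (tag (val x))).-1.+1 D (e (val x))) prednK //.
  have [E|neq] := eqVneq (p (tag (val x))) (p (tag (val x'))).
    rewrite (ng_eq ng Bx Bx') //=; last by rewrite -E mul2n -addnn leq_add2l leq_pred.
    rewrite -addnS prednK // -E mul2n -addnn eqxx.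
    by rewrite -signr_odd addnn odd_double expr0 mul1r.
  rewrite (ng_neq ng Bx Bx') //=; last first.
    by rewrite -addnS prednK // mul2n -addnn leq_add ?leq_maxl ?leq_maxr.
  by case: eqVneq => [E|_]; [rewrite E eqxx in neq | rewrite mulr0].
Qed.

Lemma r_pos_level rp e i t : level_gen d rp e -> t \in I -> r_pos I omega L p t i = rp i.
Proof.
move=> G tI; rewrite /r_pos (Gamma_level i G tI) (eq_bigr _ (fun k _ => Gamma_level k G tI)).
rewrite (bigD1 i) //=; set S := (X in (_ + X - _)%N).
suff -> : (\sum_(k < d | k.+1 == i) \sum_(j < d | (j <= k)%N) rp j)%N = S by rewrite addnK.
have [i0|i0] := posnP i.
  have -> : S = 0%N.
    rewrite /S big1 // => k; rewrite i0 leqn0 => /andP[/eqP k0 /eqP[]].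
    by apply/val_inj; rewrite /= k0 i0.
  by rewrite big1 // => k; rewrite i0.
have lt : (i.-1 < d)%N by have := ltn_ord i; lia.
rewrite (big_pred1 (Ordinal lt)) => [|k]; last by rewrite /= -val_eqE /=; lia.
apply: eq_bigl => j /=; rewrite -val_eqE /=; lia.
Qed.

End ExistenceOfGenerators.

(** * Change of frame by constant pseudo-orthogonal matrices *)

Section ChangeOfFrame.
Context {R : realType} {W : vectType R} (I : interval R) (I_nd : nondegenerate_itv I).
Variables (omega : {skew_symmetric W}) (A : finType) (P : A -> nat) (eps : A -> R).
Hypothesis eps2 : forall s, eps s * eps s = 1.
Implicit Types (s u : A) (k l j n : nat) (t : R).
Local Notation D := (vderive I).
Variables (e : A -> R -> W) (F : A -> nat -> R -> W) (FF : flat_frame I omega P eps e F).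
Variable U : A -> A -> R.
Hypothesis U_orth : forall s s', P s = P s' ->
  \sum_(u | P u == P s) eps u * U u s * U u s' = eps s * (s == s')%:R.

Definition comb_e s t : W := \sum_(u | P u == P s) U u s *: e u t.
(** The coefficients are the entries of I U I, the inverse transpose of the pseudo-orthogonal U, as
    duality between E and F requires. *)
Definition comb_F s n t : W := \sum_(u | P u == P s) (eps u * U u s * eps s) *: F u n t.

Let F_smooth s n : (n < P s)%N -> forall u, P u == P s -> vsmooth I (F u n).
Proof. by move=> nP u /eqP E; apply: (ff_F FF); rewrite E. Qed.

Lemma iter_comb_e s k t : t \in I ->
  iter k D (comb_e s) t = \sum_(u | P u == P s) U u s *: iter k D (e u) t.
Proof.
move=> tI; rewrite (iter_vderive_sum I_nd _ k _ tI) // => u _.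
exact: (@ff_e _ _ _ _ _ _ _ _ _ FF u).
Qed.

Lemma ecol_comb_e s j t : t \in I ->
  ecol I P comb_e s j t = \sum_(u | P u == P s) U u s *: ecol I P e u j t.
Proof.
move=> tI; rewrite /ecol iter_comb_e //; apply: eq_bigr => u /eqP E.
by rewrite E.
Qed.

Lemma vderive_comb_F s n t : (n < P s)%N -> t \in I ->
  D (comb_F s n) t = \sum_(u | P u == P s) (eps u * U u s * eps s) *: D (F u n) t.
Proof. by move=> nP tI; have /= -> := iter_vderive_sum I_nd (fun u => eps u * U u s * eps s) 1 (F_smooth nP) tI. Qed.

Lemma omega_comb (c c' : A -> R) (x x' : A -> W) (Q Q' : pred A) :
  omega (\sum_(a | Q a) c a *: x a) (\sum_(b | Q' b) c' b *: x' b) =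
  \sum_(a | Q a) \sum_(b | Q' b) c a * c' b * omega (x a) (x' b).
Proof.
rewrite linear_sumlz; apply: eq_bigr => a _; rewrite linear_sumr; apply: eq_bigr => b _.
by rewrite linearZr_LR linearZl_LR /=; ring.
Qed.

Lemma comb_coef s n u j t : (n < P s)%N -> t \in I ->
  ff_coef I omega comb_F s n u j t =
  \sum_(b | P b == P u) \sum_(a | P a == P s)
    (eps b * U b u * eps u) * (eps a * U a s * eps s) * ff_coef I omega F a n b j t.
Proof. by move=> nP tI; rewrite /ff_coef vderive_comb_F // omega_comb. Qed.

Lemma comb_frame : flat_frame I omega P eps comb_e comb_F.
Proof.
split.
- move=> s; apply: (vsmooth_sum I_nd) => u _.
  exact: (vsmoothZ I_nd (@smoothf_cst _ _ I_nd _) (@ff_e _ _ _ _ _ _ _ _ _ FF u)).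
- move=> s n nP; apply: (vsmooth_sum I_nd) => u Pu.
  exact: (vsmoothZ I_nd (@smoothf_cst _ _ I_nd _) (F_smooth nP Pu)).
- move=> s j u j' t js ju tI; rewrite !ecol_comb_e // omega_comb.
  rewrite big1 // => a /eqP Pa; rewrite big1 // => b /eqP Pb.
  by rewrite (ff_EE FF) ?mulr0 ?Pa ?Pb.
- move=> s j u j' t js ju tI; rewrite omega_comb.
  rewrite big1 // => a /eqP Pa; rewrite big1 // => b /eqP Pb.
  by rewrite (ff_FF FF) ?mulr0 ?Pa ?Pb.
- move=> s j u j' t js ju tI; rewrite ecol_comb_e // omega_comb.
  have FE a b : P a == P s -> P b == P u -> omega (F a j t) (ecol I P e b j' t) = ((a == b) && (j == j'))%:R.
    by move=> /eqP Pa /eqP Pb; rewrite (ff_FE FF) ?Pa ?Pb.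
  have [E|neq] := eqVneq (P s) (P u); last first.
    rewrite big1 => [|a Pa]; last first.
      rewrite big1 // => b Pb; rewrite FE //; case: eqVneq => [ab|_]; last by rewrite mulr0.
      by rewrite -(eqP Pa) ab (eqP Pb) eqxx in neq.
    by case: eqVneq => [su|//]; rewrite su eqxx in neq.
  rewrite (eq_bigr (fun a => eps s * (j == j')%:R * (eps a * U a s * U a u))) => [|a Pa].
    by rewrite -mulr_sumr U_orth // mulrACA eps2 mul1r -natrM mulnb andbC.
  have Pa' : P a == P u by rewrite -E.
  rewrite (bigD1 a) //= big1 ?addr0 => [|b /andP[Pb ba]].
    by rewrite FE // eqxx /=; ring.
  by rewrite FE // eq_sym (negbTE ba) mulr0.
- move=> s t tI; rewrite iter_comb_e // scaler_sumr; apply: eq_bigr => u /eqP Pu.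
  rewrite -Pu (ff_F0 FF) // !scalerA; congr (_ *: _).
  by rewrite mulrC -[in LHS](mulr1 (eps u * _)) -(eps2 s); ring.
Qed.

Lemma comb_normal : ff_normal I omega P F -> ff_normal I omega P comb_F.
Proof.
move=> Z s n u j t nP jP lt tI; rewrite comb_coef //.
rewrite big1 // => b /eqP Pb; rewrite big1 // => a /eqP Pa.
by rewrite Z ?mulr0 // ?Pa ?Pb.
Qed.

Lemma comb_quasi_normal : quasi_normal_coef I omega P F -> quasi_normal_coef I omega P comb_F.
Proof.
move=> [Q1 Q2]; split=> [s n u j t nP jP lt tI|s n u t ns nu tI].
  rewrite (@comb_coef s n u j t (ltnW nP) tI) big1 // => b /eqP Pb; rewrite big1 // => a /eqP Pa.
  by rewrite (Q1 a n b j t) ?mulr0 // ?Pa ?Pb.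
split=> h; rewrite (@comb_coef s n u n.+1 t (ltnW ns) tI).
  rewrite big1 // => b /eqP Pb; rewrite big1 // => a /eqP Pa.
  have [|||H _] := Q2 a n b t; rewrite ?Pa ?Pb //.
  by rewrite H ?mulr0 ?Pa ?Pb.
rewrite (@comb_coef u n s n.+1 t (ltnW nu) tI) -sumrN exchange_big.
apply: eq_bigr => a /eqP Pa; rewrite -sumrN; apply: eq_bigr => b /eqP Pb.
have [|||_ H] := Q2 a n b t; rewrite ?Pa ?Pb //.
by rewrite H ?Pa ?Pb //; ring.
Qed.

End ChangeOfFrame.

(** * Normal moving frames *)

Section StarPairs.
Implicit Types (a b n : nat).

Lemma mem_star_pairs a b j j' : (0 < b < a)%N ->
  ((j, j') \in star_pairs a b) =
  ((j.+1 < b)%N && ((j' == j) || (j' == j.+1))) || [&& j' == b.-1, (b.-1 <= j)%N & (j < a)%N].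
Proof.
move=> /andP[b0 ba]; rewrite mem_cat; congr (_ || _).
  apply/flattenP/andP => [[x /mapP[k]]|[jb h]].
    rewrite mem_iota add0n => /andP[_ kb] ->; rewrite !inE !xpair_eqE.
    by case/orP => /andP[/eqP -> /eqP ->]; rewrite !eqxx ?orbT; split=> //; lia.
  exists [:: (j, j); (j, j.+1)]; first by apply/mapP; exists j => //; rewrite mem_iota; lia.
  by rewrite !inE !xpair_eqE eqxx.
apply/mapP/and3P => [[k]|[/eqP -> h1 h2]].
  by rewrite mem_iota => /andP[h1 h2] [-> ->]; split=> //; lia.
by exists j => //; rewrite mem_iota; lia.
Qed.

Let pair_sum (x : nat * nat) := (x.1 + x.2)%N.

(* The pairs are listed by increasing sums of indices, without gaps. *)
Lemma star_pairs_sum a b : map pair_sum (star_pairs a b) = iota 0 (size (star_pairs a b)).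
Proof.
have H1 k n : map pair_sum (flatten [seq [:: (k, k); (k, k.+1)] | k <- iota k n]) = iota (2 * k) (2 * n).
  elim: n k => [//|n IHn] k; rewrite (mulnS 2 n) /= IHn /pair_sum /=.
  by rewrite addnS addnn -mul2n mulnS.
have H2 c k n : map pair_sum [seq (k, c) | k <- iota k n] = iota (k + c) n.
  by elim: n k => [//|n IHn] k /=; rewrite IHn.
rewrite -[X in iota 0 X](size_map pair_sum) /star_pairs map_cat H1 H2 muln0 addnn -mul2n.
by rewrite -[X in _ ++ iota X _]add0n -iotaD size_iota.
Qed.

(** The position of a pair in the list is its sum of indices, so taking a prefix bounds that sum. *)
Lemma mem_take_star_pairs n a b x :
  (x \in take n (star_pairs a b)) = (x \in star_pairs a b) && (pair_sum x < n)%N.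
Proof.
set S := star_pairs a b.
have sumS i : (i < size S)%N -> pair_sum (nth (0, 0)%N S i) = i.
  move=> iS; rewrite -(nth_map _ 0%N) // star_pairs_sum nth_iota //.
apply/idP/andP => [xS|[/(nthP (0, 0)%N)[i iS <-]]].
  split; first exact: mem_take xS.
  have [i + <-] := nthP (0, 0)%N xS; rewrite size_take => ilt.
  have [iS ilt'] : (i < size S)%N /\ (i < n)%N.
    move: ilt; case: (ltnP n (size S)) => h1 h2; split=> //.
      exact: ltn_trans h1.
    exact: leq_trans h1.
  by rewrite nth_take // sumS.
rewrite sumS // => ilt; rewrite -(nth_take (0, 0)%N ilt) mem_nth // size_take.
by case: ifP.
Qed.

End StarPairs.

(** * Passage between frames indexed by levels and by rows *)

Section Conversion.
Context {R : realType} {W : vectType R} {m : nat} {omega : {skew_symmetric W}}.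
Context {I : interval R} {L : R -> {vspace W}} {d : nat} {r p : 'I_d -> nat}.
Hypothesis C : regular_curve m omega I L r p.
Let I_nd := rc_itv C.
Let omega_nd := rc_nd C.
Variable rp : 'I_d -> nat.
Local Notation D := (vderive I).
Local Notation row := {i : 'I_d & 'I_(r i)}.
Local Notation P := (fun s : row => p (tag s)).
Local Notation eps := (sgn_of rp : row -> R).
Local Notation Row := (fun i (k : 'I_(r i)) => Tagged (fun i => 'I_(r i)) k : row).
Implicit Types (s u : row) (t : R) (E F : vframe W r p) (e : row -> R -> W) (f : row -> nat -> R -> W).

Lemma dim_rows : \dim {:W} = (2 * \sum_(s : row) P s)%N.
Proof.
rewrite (rc_dim C) -(sum_boxes C); congr (2 * _)%N.
by rewrite (@sum_rows d r xpredT (fun k : 'I_d => p k)).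
Qed.

Lemma dim_L_rows t : t \in I -> \dim (L t) = (\sum_(s : row) P s)%N.
Proof.
move=> tI; rewrite (rc_dimL C) // -(sum_boxes C).
by rewrite (@sum_rows d r xpredT (fun k : 'I_d => p k)).
Qed.

Lemma sum_frame (V : Type) (idx : V) (op : Monoid.com_law idx) (X : forall i, 'I_(p i) -> 'I_(r i) -> V) :
  \big[op/idx]_(i < d) \big[op/idx]_(j < p i) \big[op/idx]_(k < r i) X i j k =
  \big[op/idx]_(s : row) \big[op/idx]_(j < p (tag s)) X (tag s) j (tagged s).
Proof.
have H := sig_big_dep (op := op) xpredT (fun i (k : 'I_(r i)) => true) (fun i k => \big[op/idx]_(j < p i) X i j k).
by rewrite -H; apply: eq_bigr => i _; exact: exchange_big.
Qed.

Lemma row_eqE s u : (s == u) = (tag s == tag u :> nat) && (tagged s == tagged u :> nat).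
Proof.
apply/eqP/andP => [->//|[]]; case: s u => [i k] [i' k'] /= /eqP/val_inj E; subst i'.
by move=> /eqP/val_inj ->.
Qed.

Lemma row_id s : Row (tag s) (tagged s) = s.
Proof. by case: s. Qed.

(** Equality is asked on [I] only; derivatives within [I] do not see other values. *)
Record frame_of E F e f : Prop := FrameOf {
  fo_E : forall i (j : 'I_(p i)) k t, t \in I -> E i j k t = ecol I P e (Row i k) j t;
  fo_F : forall i (j : 'I_(p i)) k t, t \in I -> F i j k t = f (Row i k) j t }.

Definition flat_normal e f :=
  [/\ flat_frame I omega P eps e f, quasi_normal_coef I omega P f, ff_normal I omega P f &
     forall s k t, (k < P s)%N -> t \in I -> iter k D (e s) t \in L t].

Lemma vrow_mul_sig (n k : nat) (X : 'I_n -> W) (h : 'I_n) :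
  vrow_mul X (sig_mx n k) h = (if (h < k)%N then 1 else -1 : R) *: X h.
Proof.
rewrite /vrow_mul (bigD1 h) //= big1 ?addr0 => [|j jh]; first by rewrite !mxE eqxx mulr1n.
by rewrite !mxE (negbTE jh) mulr0n scale0r.
Qed.

Section FromMoving.
Variables (E F : vframe W r p) (N : normal_moving_frame I omega L rp E F).

Let last_lt i : ((p i).-1 < p i)%N.
Proof. by rewrite ltn_predL (rc_p_gt0 C). Qed.

Let e s := E (Ordinal (last_lt (tag s))) (tagged s).
Let f s n := if insub n is Some j then F (j : 'I_(p (tag s))) (tagged s) else fun=> 0.

Let fE s n (nP : (n < p (tag s))%N) : f s n = F (Ordinal nP) (tagged s).
Proof. by rewrite /f insubT. Qed.

Let eE s n (nP : (n < p (tag s))%N) t : t \in I -> ecol I P e s n t = E (Ordinal nP) (tagged s) t.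
Proof.
have [_ _ _ [M HM]] := N.
rewrite /ecol; have : (n + (p (tag s) - n.+1) = (p (tag s)).-1)%N by lia.
move: (p (tag s) - n.+1)%N => l; elim: l n nP t => [|l IHl] n nP t nl tI.
  by rewrite /= /e; congr (E _ _ t); apply: val_inj; rewrite /= -nl addn0.
have nP' : (n.+1 < p (tag s))%N by have := rc_p_gt0 C (tag s); lia.
have [_ [H _ _ _]] := HM t tI.
rewrite -(H _ (Ordinal nP) (Ordinal nP') (tagged s) erefl) /=.
apply: (eq_vderive _ tI) => v vI; apply: (IHl _ nP' _ _ vI); lia.
Qed.

Let flat : flat_frame I omega P eps e f.
Proof.
have [sm Db LE [M HM]] := N; split.
- by move=> s; exact: (sm _ _ _).1.
- by move=> s n nP; rewrite (fE nP); exact: (sm _ _ _).2.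
- move=> s n u n' t nP n'P tI; rewrite (eE nP) // (eE n'P) //.
  by have [] := Db t tI _ (Ordinal nP) (tagged s) _ (Ordinal n'P) (tagged u).
- move=> s n u n' t nP n'P tI; rewrite (fE nP) (fE n'P).
  by have [] := Db t tI _ (Ordinal nP) (tagged s) _ (Ordinal n'P) (tagged u).
- move=> s n u n' t nP n'P tI; rewrite (fE nP) (eE n'P) //.
  have [_ _ ->] := Db t tI _ (Ordinal nP) (tagged s) _ (Ordinal n'P) (tagged u).
  by rewrite row_eqE -andbA; congr (_ && _)%:R; rewrite andbC.
- move=> s t tI; have p0 := rc_p_gt0 C (tag s).
  have -> : iter (p (tag s)) D (e s) = D (ecol I P e s 0).
    by rewrite -[in LHS](prednK p0) /= /ecol subn1.
  rewrite (eq_vderive (fun v vI => eE p0 vI) tI).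
  have [_ [_ H _ _]] := HM t tI.
  by rewrite (H _ (Ordinal p0) (tagged s) erefl) vrow_mul_sig fE.
Qed.

(** Pairing the structure equation with F isolates one entry of the mapping. The indices appear
    transposed because the matrix attached to a pair multiplies the row E of the second superbox on
    the right. *)
Let coefE (M : R -> compatible_map R r p) s n u n' (nP : (n < p (tag s))%N) (n'P : (n' < p (tag u))%N) t :
  t \in I -> structure_equations I rp E F (M t) t ->
  ff_coef I omega f s n u n' t = M t _ (Ordinal nP) _ (Ordinal n'P) (tagged u) (tagged s).
Proof.
move=> tI [_ _ H1 H2]; have [_ Db _ _] := N; rewrite /ff_coef (fE nP) (fE n'P).
pose ER := \sum_(i' < d) \sum_(j' < p i')
  vrow_mul (fun h => E j' h t) (M t _ (Ordinal nP) i' j') (tagged s).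
have ERE : omega (F (Ordinal n'P) (tagged u) t) ER =
    M t _ (Ordinal nP) _ (Ordinal n'P) (tagged u) (tagged s).
  rewrite /ER linear_sumr (bigD1 (tag u)) //= [X in _ + X]big1 ?addr0; last first.
    move=> i iu; rewrite linear_sumr big1 // => j _; rewrite linear_sumr big1 // => h _.
    rewrite linearZr_LR /=; have [_ _ ->] := Db t tI _ (Ordinal n'P) (tagged u) _ j h.
    by rewrite (_ : (tag u == i :> nat) = false) ?mulr0 //; apply: contraNF iu => /eqP/val_inj ->.
  rewrite linear_sumr (bigD1 (Ordinal n'P)) //= [X in _ + X]big1 ?addr0; last first.
    move=> j ju; rewrite linear_sumr big1 // => h _.
    rewrite linearZr_LR /=; have [_ _ ->] := Db t tI _ (Ordinal n'P) (tagged u) _ j h.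
    rewrite eqxx /= (_ : (n' == j :> nat) = false) ?mulr0 //.
    by apply: contraNF ju => /eqP E'; apply/eqP/val_inj.
  rewrite linear_sumr (bigD1 (tagged u)) //= [X in _ + X]big1 ?addr0; last first.
    move=> h hu; rewrite linearZr_LR /=; have [_ _ ->] := Db t tI _ (Ordinal n'P) (tagged u) _ (Ordinal n'P) h.
    rewrite !eqxx /= (_ : (tagged u == h :> nat) = false) ?mulr0 //.
    by apply: contraNF hu => /eqP/val_inj ->.
  rewrite linearZr_LR /=; have [_ _ ->] := Db t tI _ (Ordinal n'P) (tagged u) _ (Ordinal n'P) (tagged u).
  by rewrite !eqxx mulr1.
have [lt|ge] := ltnP n.+1 (p (tag s)).
  rewrite (H1 _ (Ordinal nP) (Ordinal lt) (tagged s) erefl) -/ER linearBr /= ERE.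
  have [_ -> _] := Db t tI _ (Ordinal n'P) (tagged u) _ (Ordinal lt) (tagged s).
  by rewrite subr0.
rewrite (H2 _ (Ordinal nP) (tagged s)) ?ERE //=; apply/eqP; rewrite eqn_leq ge; exact: nP.
Qed.

Lemma moving_frame_flat : exists e f, frame_of E F e f /\ flat_normal e f.
Proof.
have [sm Db LE [M HM]] := N; exists e, f; split.
  split=> i j k t tI; first by rewrite (@eE (Row i k) j (ltn_ord j) t tI) /=; congr (E _ _ t); exact: val_inj.
  by rewrite (@fE (Row i k) j (ltn_ord j)) /=; congr (F _ _ t); exact: val_inj.
have p0 := rc_p_gt0 C.
have coef0 s n u n' t : (n < p (tag s))%N -> (n' < p (tag u))%N -> t \in I ->
    (forall (j : 'I_(p (tag s))) (j' : 'I_(p (tag u))), j = n :> nat -> j' = n' :> nat ->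
      normal_map (M t) -> M t _ j _ j' = 0) -> ff_coef I omega f s n u n' t = 0.
  move=> nP n'P tI H; have [Mn Ms] := HM t tI.
  by rewrite (coefE nP n'P tI Ms) H // mxE.
have star0 t (i i' : 'I_d) (j : 'I_(p i)) (j' : 'I_(p i')) : normal_map (M t) -> (i < i')%N ->
    ~~ (((j.+1 < p i')%N && ((j' == j :> nat) || (j' == j.+1 :> nat))) ||
      [&& j' == (p i').-1 :> nat, ((p i').-1 <= j)%N & (j < p i)%N]) -> M t i j i' j' = 0.
  move=> [[_ _ H _] _] ii'; rewrite -mem_star_pairs; last by rewrite p0 (rc_p_lt C).
  by move=> nS; apply/eqP; apply: contraNT nS => /eqP; exact: H.
split=> //.
- split=> [s n u n' t nP n'P lt tI|s n u t ns nu tI].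
    apply: coef0 => // [|j j' jn j'n' Mn]; first exact: ltnW.
    have [[S1 S2 _ _] _] := Mn.
    (* The tuples are listed with the longer row first; in the opposite case symmetry exchanges the
       arguments. *)
    case: (ltngtP (tag s) (tag u)) => su.
    + by apply: star0 => //; rewrite jn j'n'; lia.
    + rewrite S1 star0 ?trmx0 //; rewrite jn j'n'; have := p0 (tag s); lia.
    + move/val_inj: su => su; case: u su n'P lt j' j'n' => [i' h] /= su; subst i' => n'P lt j' j'n'.
      apply/eqP; apply: contraT => /eqP/S2 H.
      by exfalso; case: H => [/(congr1 (@nat_of_ord _))||]; rewrite jn j'n'; lia.
  split=> h.
    apply: coef0 => // [|j j' jn j'n' Mn]; first exact: ltnW.
    have [[S1 _ _ _] _] := Mn; rewrite S1 star0 ?trmx0 //; first by rewrite -(rc_p_lt C).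
    by rewrite jn j'n'; lia.
  have [Mn Ms] := HM t tI; have [[_ _ _ S4] _] := Mn.
  rewrite (coefE (ltnW ns) nu tI Ms) (coefE (ltnW nu) ns tI Ms).
  move/(rc_p_inj C): h; case: u nu => [i' h] /= nu su; subst i'.
  have := S4 _ (Ordinal (ltnW ns)) (Ordinal nu) erefl => /matrixP/(_ (tagged s) h).
  by rewrite !mxE (bool_irrelevance (ltnW nu) (ltnW ns)) (bool_irrelevance ns nu) => ->.
- move=> s n u n' t nP n'P /= lt tI; apply: coef0 => // j j' jn j'n' Mn.
  have [[_ _ S3 _] S5] := Mn.
  have su : (tag s < tag u)%N by rewrite -(rc_p_lt C) (leq_trans _ lt) // ltnS leq_addl.
  apply/eqP; apply: contraT => /eqP M0; case: (M0); apply: S5 => //.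
  rewrite mem_take_star_pairs S3 //= jn j'n' -subnDA ltn_subRL.
  by rewrite addnC (addnC (p _)) addnA.
move=> s k t kP tI.
have nP : (p (tag s) - k.+1 < p (tag s))%N by have := p0 (tag s); lia.
have := eE nP tI; rewrite /ecol /= subnSK // subKn ?(ltnW kP) // => ->; rewrite LE //.
do 3!(apply: (subvP (sumv_sup _ isT (subvv _)))).
exact: memv_line.
Qed.

End FromMoving.

(** The mapping is taken to be the matrix of [ff_coef], for which the structure equations hold
    automatically; only the vanishing of entries and the equality with [L] require an argument. *)
Lemma flat_moving_frame E F e f : frame_of E F e f -> flat_normal e f -> normal_moving_frame I omega L rp E F.
Proof.
move=> FO [FF [Q1 Q2] Z eL]; have p0 := rc_p_gt0 C.
have oE := fo_E FO; have oF := fo_F FO.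
have sm i j k : vsmooth I (E i j k) /\ vsmooth I (F i j k).
  split; [apply: (vsmooth_eq (x := ecol I P e (Row i k) j)) | apply: (vsmooth_eq (x := f (Row i k) j))].
  - by move=> t tI; rewrite oE.
  - exact/ecol_smooth/(@ff_e _ _ _ _ _ _ _ _ _ FF (Row i k)).
  - by move=> t tI; rewrite oF.
  - exact: (@ff_F _ _ _ _ _ _ _ _ _ FF (Row i k) j (ltn_ord j)).
have symm := ff_coef_sym I_nd FF.
split=> //.
- move=> t tI i j k i' j' k'; rewrite !oE // !oF //; split.
  + by apply: (ff_EE FF) => //=.
  + by apply: (ff_FF FF) => //=.
  + by rewrite (ff_FE FF) //= row_eqE /= -andbA; congr (_ && _)%:R; rewrite andbC.
- move=> t tI; rewrite (sum_frame _ (fun i j k => <[E i j k t]>%VS)).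
  have ng : gen_of I omega P eps L e.
    split=> //; exact: (frame_normal_gen I_nd omega_nd (fun s => p0 (tag s)) (@sgn_of2 _ _ _ rp) dim_rows FF Z).
  apply/eqP; rewrite eqEsubv; apply/andP; split.
    apply/subvP => v vL.
    have [c ->] := gen_span (@sgn_of2 _ _ _ rp) dim_L_rows ng tI vL.
    apply: memv_suml => s _; apply: memv_suml => k _; apply: memvZ.
    have nP : (p (tag s) - k.+1 < p (tag s))%N by have := p0 (tag s); lia.
    have := oE _ (Ordinal nP) (tagged s) t tI.
    rewrite /ecol /= subnSK ?ltn_ord // subKn ?(ltnW (ltn_ord k)) // row_id => <-.
    do 2!(apply: (subvP (sumv_sup _ isT (subvv _)))).
    exact: memv_line.
  apply/subv_sumP => s _; apply/subv_sumP => j _; rewrite -memvE oE // /ecol eL //.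
  by rewrite ltn_subrL /= p0.
pose M t : compatible_map R r p := fun i j i' j' =>
  \matrix_(h, k) ff_coef I omega f (Row i k) j (Row i' h) j' t.
exists M => t tI.
have M0 i (j : 'I_(p i)) i' (j' : 'I_(p i')) :
    (forall k h, ff_coef I omega f (Row i k) j (Row i' h) j' t = 0) -> M t i j i' j' = 0.
  by move=> H; apply/matrixP => h k; rewrite !mxE.
have Msym : symmetric_map (M t).
  by move=> i j i' j'; apply/matrixP => h k; rewrite !mxE symm.
split; [split; [split=> //|]|].
- move=> i j j' Mn.
  have [lt|[lt|]] : (j.+1 < j')%N \/ (j'.+1 < j)%N \/
      [\/ j = j' :> nat, j' = j.+1 :> nat | j = j'.+1 :> nat].
    case: (ltngtP j j') => h; last by right; right; apply: Or31.
      by have [|] := ltnP j.+1 j'; [left | right; right; apply: Or32; lia].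
    by have [|] := ltnP j'.+1 j; [right; left | right; right; apply: Or33; lia].
  + by case: Mn; apply: M0 => k h; apply: Q1 => //=; exact: ltn_trans (ltn_ord j').
  + by case: Mn; apply: M0 => k h; rewrite symm //; apply: Q1 => //=; exact: ltn_trans (ltn_ord j).
  + by case=> [/val_inj|?|?]; [apply: Or31 | apply: Or32 | apply: Or33].
- move=> i i' j j' ii' Mn; have lt : (p i' < p i)%N by rewrite (rc_p_lt C).
  rewrite mem_star_pairs ?p0 //=; apply: contra_notT Mn => nS.
  apply: M0 => k h; have := ltn_ord j; have := ltn_ord j' => j'p jp.
  (* Off the tuple, columns more than one apart vanish in either order of the arguments. A
     neighbouring column vanishes because the longer row takes the whole of the difference. *)
  have [h1|h1] := ltnP j.+1 j'.
    by apply: Q1 => //=; exact: ltn_trans h1 (ltn_trans j'p lt).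
  have [h2 h3] : (j'.+1 < p i')%N /\ (j' < j)%N by lia.
  rewrite symm //; have [h4|h4] := ltnP j'.+1 j; first exact: Q1.
  have jE : nat_of_ord j = j'.+1 by lia.
  have [] := Q2 (Row i' h) j' (Row i k) t h2 _ tI => /=; first by rewrite -jE.
  by rewrite jE => -> //.
- move=> i j j' jj'; apply/matrixP => h k; rewrite !mxE jj'.
  have ltj : (j.+1 < p i)%N by rewrite -jj'.
  by have [_ -> //] := Q2 (Row i h) j (Row i k) t ltj ltj tI; rewrite ?opprK.
- move=> i i' j j' ii'; rewrite mem_take_star_pairs => /andP[_] /= lt.
  by apply: M0 => k h; apply: Z => //=; lia.
have ER i (j : 'I_(p i)) k : \sum_u \sum_(j' < p (tag u)) ff_coef I omega f (Row i k) j u j' t *: ecol I P e u j' t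
    = \sum_(i' < d) \sum_(j' < p i') vrow_mul (fun h => E i' j' h t) (M t i j i' j') k.
  rewrite /vrow_mul (sum_frame _ (fun i' j' h => M t i j i' j' h k *: E i' j' h t)).
  apply: eq_bigr => u _; apply: eq_bigr => j' _; rewrite oE // mxE.
  by rewrite row_id.
have DE i (j : 'I_(p i)) k : D (E i j k) t = D (ecol I P e (Row i k) j) t.
  by apply: (eq_vderive _ tI) => v vI; rewrite oE.
have DF i (j : 'I_(p i)) k : D (F i j k) t = D (f (Row i k) j) t.
  by apply: (eq_vderive _ tI) => v vI; rewrite oF.
split.
- move=> i j0 j k jj0; rewrite DE jj0 (ecolS I (P := P)) ?oE //=.
  by rewrite -jj0.
- move=> i j k j0; rewrite DE j0 (ecol0 I (fun s => p0 (tag s))).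
  have /= -> := ff_F0 FF (Row i k) tI.
  by rewrite vrow_mul_sig oF // j0.
- move=> i j j1 k jj1; rewrite DF (ff_structure I_nd omega_nd (fun s => p0 (tag s)) dim_rows FF) //=.
  by rewrite ER -jj1 ltn_ord oF.
- move=> i j k jE; rewrite DF (ff_structure I_nd omega_nd (fun s => p0 (tag s)) dim_rows FF) //=.
  by rewrite ER ifN ?subr0 // -leqNgt -[X in (_ <= X)%N]jE.
Qed.

End Conversion.

Lemma sig_mxE {R : realType} (n k : nat) (a b : 'I_n) :
  (sig_mx n k : 'M[R]_n) a b = (if (a < k)%N then 1 else -1) * (a == b)%:R.
Proof. by rewrite !mxE mulr_natr. Qed.

Lemma sig_mx_conjE {R : realType} (n k : nat) (U : 'M[R]_n) a b :
  (sig_mx n k *m U *m sig_mx n k) a b =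
  (if (a < k)%N then 1 else -1) * U a b * (if (b < k)%N then 1 else -1).
Proof.
by rewrite /sig_mx mul_mx_diag mxE mul_diag_mx !mxE.
Qed.

Lemma pseudo_orthogonalP {R : realType} (n k : nat) (U : 'M[R]_n) :
  is_pseudo_orthogonal k U <-> forall a b : 'I_n, \sum_(h < n) (if (h < k)%N then 1 else -1) * U h a * U h b =
    (if (a < k)%N then 1 else -1) * (a == b)%:R.
Proof.
have E a b : (U^T *m sig_mx n k *m U) a b = \sum_(h < n) (if (h < k)%N then 1 else -1) * U h a * U h b.
  rewrite mxE; apply: eq_bigr => h _; rewrite /sig_mx mul_mx_diag !mxE; ring.
split=> [UO a b|H]; first by rewrite -sig_mxE -UO E.
by apply/matrixP => a b; rewrite E H sig_mxE.
Qed.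

Lemma flat_frame_congr {R : realType} {W : vectType R} (I : interval R) (omega : {skew_symmetric W})
    (A : finType) (P : A -> nat) (eps : A -> R) (e e' : A -> R -> W) F :
  (forall s, {in I, e s =1 e' s}) -> flat_frame I omega P eps e F -> flat_frame I omega P eps e' F.
Proof.
move=> ee' FF.
have eE s j t : t \in I -> ecol I P e' s j t = ecol I P e s j t.
  by move=> tI; rewrite /ecol (iter_vderive_eq _ (ee' s) tI).
split.
- by move=> s; exact: (vsmooth_eq (ee' s) (@ff_e _ _ _ _ _ _ _ _ _ FF s)).
- exact: (ff_F FF).
- by move=> s j u j' t js ju tI; rewrite !eE // (ff_EE FF).
- exact: (ff_FF FF).
- by move=> s j u j' t js ju tI; rewrite !eE // (ff_FE FF).
- by move=> s t tI; rewrite -(iter_vderive_eq _ (ee' s) tI) (ff_F0 FF).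
Qed.

(** * Existence of normal moving frames and the change between two of them *)

Section NormalMovingFrames.
Context {R : realType} {W : vectType R} {m : nat} {omega : {skew_symmetric W}}.
Context {I : interval R} {L : R -> {vspace W}} {d : nat} {r p : 'I_d -> nat}.
Hypothesis C : regular_curve m omega I L r p.
Let I_nd := rc_itv C.
Let omega_nd := rc_nd C.
Variable rp : 'I_d -> nat.
Local Notation row := {i : 'I_d & 'I_(r i)}.
Local Notation P := (fun s : row => p (tag s)).
Local Notation eps := (sgn_of rp : row -> R).
Local Notation Row := (fun i (k : 'I_(r i)) => Tagged (fun i => 'I_(r i)) k : row).
Local Notation normal_frame := (normal_moving_frame I omega L rp).
Implicit Types (E F : vframe W r p) (e : row -> R -> W) (f : row -> nat -> R -> W).
Let P_gt0 (s : row) : (0 < p (tag s))%N.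
Proof. exact: (rc_p_gt0 C). Qed.
Let eps2 := @sgn_of2 R d r rp.

Lemma level_gen_moving_frame e : level_gen (omega := omega) (I := I) (L := L) (p := p) d rp e ->
  exists E F, normal_frame E F.
Proof.
move=> G; have ng : normal_gen I omega P eps xpredT e by apply: normal_gen_sub (lg_gen G).
pose f := Fcol I omega P eps e.
exists (fun i j k => ecol I P e (Row i k) j), (fun i j k => f (Row i k) j).
apply: (@flat_moving_frame _ _ _ _ _ _ _ _ _ C rp _ _ e f); first by [].
split.
- exact: (Fcol_frame I_nd omega_nd P_gt0 eps2 (dim_rows C) ng).
- exact: (Fcol_quasi_normal I_nd omega_nd P_gt0 eps2 (dim_rows C) ng).
- exact: (Fcol_normal I_nd omega_nd P_gt0 eps2 (dim_rows C) ng).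
- by move=> s k t kP tI; apply: (lg_flag G) => //; exact: ltn_ord.
Qed.

Lemma sum_same_length (V : nmodType) i (X : row -> V) :
  \sum_(u : row | p (tag u) == p i) X u = \sum_(h < r i) X (Row i h).
Proof.
rewrite -(sum_level i X); apply: eq_bigl => u.
by apply/eqP/eqP => [/(rc_p_inj C)|->].
Qed.

Lemma flat_normal_gen e f : flat_normal (omega := omega) (I := I) (L := L) (p := p) rp e f ->
  gen_of I omega P eps L e.
Proof.
by move=> [FF _ Z eL]; split; [exact: (frame_normal_gen I_nd omega_nd P_gt0 eps2 (dim_rows C) FF Z)|].
Qed.

(** The generators of E' are constant combinations of those of E. The same change applied to F gives
    another quasi-normal completion of the generators of E', which must be F' by uniqueness. *)
Lemma frame_change E F E' F' : normal_frame E F -> normal_frame E' F' ->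
  forall i, exists U : 'M[R]_(r i), is_pseudo_orthogonal (rp i) U /\
    forall t, t \in I -> forall (j : 'I_(p i)) (k : 'I_(r i)),
      E' i j k t = vrow_mul (fun h => E i j h t) U k /\
      F' i j k t = vrow_mul (fun h => F i j h t)
        (sig_mx (r i) (rp i) *m U *m sig_mx (r i) (rp i)) k.
Proof.
move=> /(moving_frame_flat C)[e [f [FO N]]] /(moving_frame_flat C)[e' [f' [FO' N']]].
have [U [eU oU]] := gen_change I_nd P_gt0 eps2 (dim_L_rows C) (@rc_isotropic _ _ _ _ _ _ _ _ _ C)
  (flat_normal_gen N) (flat_normal_gen N').
have [FF Q _ _] := N; have [FF' Q' _ _] := N'.
have e'E s : {in I, comb_e P e U s =1 e' s} by move=> t tI; rewrite eU.
have FFc := flat_frame_congr e'E (comb_frame I_nd eps2 FF oU).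
have Qc := comb_quasi_normal I_nd FF U Q.
have F'E := flat_frame_unique I_nd omega_nd P_gt0 eps2 (dim_rows C) FF' FFc Q' Qc.
move=> i; exists (\matrix_(h, k) U (Row i h) (Row i k)); split.
  apply/pseudo_orthogonalP => a b; have := oU (Row i a) (Row i b) erefl.
  rewrite /= (sum_same_length i) eq_Tagged /= => <-.
  by apply: eq_bigr => h _; rewrite !mxE.
move=> t tI j k; split.
  have -> : E' i j k t = ecol I P (comb_e P e U) (Row i k) j t.
    by rewrite (fo_E FO') // /ecol (iter_vderive_eq _ (e'E _) tI).
  rewrite (ecol_comb_e I_nd FF U _ _ tI).
  rewrite /= (sum_same_length i) /vrow_mul; apply: eq_bigr => h _.
  by rewrite mxE (fo_E FO).
rewrite (fo_F FO') // (F'E (Row i k) j t (ltn_ord j) tI) /comb_F /= (sum_same_length i) /vrow_mul.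
by apply: eq_bigr => h _; rewrite sig_mx_conjE mxE (fo_F FO).
Qed.

Lemma frame_change_normal E F E' F' : normal_frame E F ->
  (forall i, exists U : 'M[R]_(r i), is_pseudo_orthogonal (rp i) U /\
    forall t, t \in I -> forall (j : 'I_(p i)) (k : 'I_(r i)),
      E' i j k t = vrow_mul (fun h => E i j h t) U k /\
      F' i j k t = vrow_mul (fun h => F i j h t)
        (sig_mx (r i) (rp i) *m U *m sig_mx (r i) (rp i)) k) ->
  normal_frame E' F'.
Proof.
move=> /(moving_frame_flat C)[e [f [FO [FF Q Z eL]]]] /fin_all_exists[V HV].
(* The blocks of all levels form one matrix indexed by rows, zero between different levels. *)
pose U (u s : row) : R := set_level (fun=> 0) (fun h => V (tag s) h (tagged s)) u.
have UE i (h k : 'I_(r i)) : U (Row i h) (Row i k) = V i h k by rewrite /U set_levelE.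
have oU (s s' : row) : p (tag s) = p (tag s') ->
    \sum_(u : row | p (tag u) == p (tag s)) eps u * U u s * U u s' = eps s * (s == s')%:R.
  case: s s' => [i a] [i' b] /= /(rc_p_inj C) E'i; subst i'.
  rewrite (sum_same_length i) eq_Tagged /=.
  have /pseudo_orthogonalP/(_ a b) := (HV i).1; rewrite {2}/sgn_of /= => <-.
  by apply: eq_bigr => h _; rewrite !UE.
apply: (@flat_moving_frame _ _ _ _ _ _ _ _ _ C rp _ _ (comb_e P e U) (comb_F P eps f U)).
  split=> i j k t tI; have [h1 h2] := (HV i).2 t tI j k.
    rewrite h1 (ecol_comb_e I_nd FF U _ _ tI) /= (sum_same_length i).
    by apply: eq_bigr => h _; rewrite UE (fo_E FO).
  rewrite h2 /comb_F /= (sum_same_length i).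
  by apply: eq_bigr => h _; rewrite UE sig_mx_conjE (fo_F FO).
split.
- exact: (comb_frame I_nd eps2 FF oU).
- exact: (comb_quasi_normal I_nd FF U Q).
- exact: (comb_normal I_nd FF U Z).
- move=> s k t kP tI; rewrite (iter_comb_e I_nd FF) //.
  by apply: memv_suml => u /eqP E'u; apply/memvZ/eL; rewrite // E'u.
Qed.

End NormalMovingFrames.

Local Close Scope classical_set_scope.

Theorem theorem3 (R : realType) (m : nat) (W : vectType R)
    (dimW : \dim {:W} = (2 * m)%N)
    (omega : {skew_symmetric W}) (omega_sympl : is_psymplectic omega)
    (I : interval R) (I_nondeg : nondegenerate_itv I)
    (L : R -> {vspace W})
    (L_lagr : forall t, t \in I -> lagrangian omega (L t))
    (L_smooth : smooth_subspaces I L)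
    (L_const : forall n s t, s \in I -> t \in I ->
       \dim (nth_extension I L n s) = \dim (nth_extension I L n t))
    (L_full : exists q, forall t, t \in I -> nth_extension I L q t = fullv)
    (d : nat) (r p : 'I_d -> nat)
    (L_young : is_young_diagram_of I L r p)
    (L_G : condition_G I omega L r p)
    (t0 : R) (t0I : t0 \in I) :
  let rp := r_pos I omega L p t0 in
  (exists E F : vframe W r p, normal_moving_frame I omega L rp E F) /\
  (forall E F : vframe W r p, normal_moving_frame I omega L rp E F ->
   forall E' F' : vframe W r p,
     normal_moving_frame I omega L rp E' F' <->
     forall i : 'I_d, exists U : 'M[R]_(r i),
       is_pseudo_orthogonal (rp i) U /\
       forall t, t \in I -> forall (j : 'I_(p i)) (k : 'I_(r i)),
         E' i j k t = vrow_mul (fun h => E i j h t) U k /\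
         F' i j k t = vrow_mul (fun h => F i j h t)
           (sig_mx (r i) (rp i) *m U *m sig_mx (r i) (rp i)) k).
Proof.
have [omega_nd _ _] := omega_sympl; move=> rp.
have C := RegularCurve dimW omega_nd I_nondeg L_lagr L_smooth L_const L_full L_young.
(* The signs [rp'] come from Sylvester's law; the next line identifies them with the inertia indices
   computed at [t0]. *)
have [rp' [e G]] := ex_level_gen C L_G t0I.
have rpE : rp = rp' by apply/funext => i; exact: (r_pos_level C i G t0I).
split; first by rewrite rpE; exact: (level_gen_moving_frame C G).
move=> E F N E' F'; split; first exact: (frame_change C N).
exact: (frame_change_normal C N).
Qed.
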